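(* Let $A$ be a normal operator in a complex Hilbert space. Then $A$ generates an immediately norm-continuous $C_0$-semigroup (of normal operators) if and only if, for every $b\in\mathbb{R}$, the set $\{\lambda\in\sigma(A) : \operatorname{Re}\lambda\ge b\}$ is bounded.
   Context: Normal operators are allowed to be unbounded (densely defined, closed, $A^*A=AA^*$); $\sigma(A)$ is the spectrum. A $C_0$-semigroup $\{T(t)\}_{t\ge 0}$ is immediately norm-continuous if the map $(0,\infty)\ni t\mapsto T(t)$ is continuous in the operator norm. *)

(* Defs.v *)
From HB Require Import structures.
From mathcomp Require Import all_boot all_order all_algebra.
From mathcomp Require Import complex.
From mathcomp Require Import all_classical all_reals all_analysis.

Set Implicit Arguments.
Unset Strict Implicit.
Unset Printing Implicit Defensive.

Import Order.TTheory GRing.Theory Num.Theory.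
Import numFieldNormedType.Exports.

Local Open Scope classical_set_scope.
Local Open Scope ring_scope.
Local Open Scope complex_scope.

Section Operators.
Context {R : realType} {H : completeNormedModType R[i]}.

(* Only the values of op_fun on op_dom are meaningful, so operators are compared
   with op_eq and not with =. *)
Record operator := Operator { op_dom : set H; op_fun :> H -> H }.

Definition op_eq (A B : operator) : Prop :=
  op_dom A = op_dom B /\ {in op_dom A, forall x, A x = B x}.

Definition op_linear (A : operator) : Prop :=
  op_dom A 0 /\
  forall (a : R[i]) (x y : H), op_dom A x -> op_dom A y ->
    op_dom A (a *: x + y) /\ A (a *: x + y) = a *: A x + A y.

Definition op_graph (A : operator) : set (H * H) :=
  [set p | op_dom A p.1 /\ p.2 = A p.1].

Definition op_comp (A B : operator) : operator :=
  Operator [set x | op_dom B x /\ op_dom A (B x)] (A \o B).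

Definition total_op (f : H -> H) : operator := Operator setT f.

(* Inner products follow {dot H for conj}: linear in the first argument,
   conjugate-linear in the second. *)
Definition adjoint_rel (dot : H -> H -> R[i]) (A : operator) (y : H) : set H :=
  [set z | forall x, op_dom A x -> dot (A x) y = dot x z].

(* The vector selected by get is unique as soon as A is densely defined. *)
Definition adjoint (dot : H -> H -> R[i]) (A : operator) : operator :=
  Operator [set y | adjoint_rel dot A y !=set0]
           (fun y => get (adjoint_rel dot A y)).

Definition normal_op (dot : H -> H -> R[i]) (A : operator) : Prop :=
  [/\ op_linear A, dense (op_dom A), closed (op_graph A)
    & op_eq (op_comp (adjoint dot A) A) (op_comp A (adjoint dot A))].

Definition resolvent_set (A : operator) : set R[i] :=
  [set l | exists S : {linear H -> H},
    [/\ continuous S,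
        forall x, op_dom A (S x) /\ l *: S x - A (S x) = x
      & forall x, op_dom A x -> S (l *: x - A x) = x]].

Definition spectrum (A : operator) : set R[i] := ~` resolvent_set A.

(* The norm of H takes its values in R[i], where it is real and nonnegative.
   Since sup of an unbounded set is 0, opnorm is only meaningful for bounded f. *)
Definition opnorm (f : H -> H) : R :=
  sup [set complex.Re `|f x| | x in [set x : H | `|x| <= 1]].

(* A semigroup is indexed by the whole of R; its values at negative times are
   never used. *)
Definition C0_semigroup (T : R -> {linear H -> H}) : Prop :=
  [/\ forall t, 0 <= t -> continuous (T t),
      forall x, T 0 x = x,
      forall s t, 0 <= s -> 0 <= t -> forall x, T (s + t) x = T s (T t x)
    & forall x, T t x @[t --> 0^'+] --> x].

Definition diff_quotient (T : R -> {linear H -> H}) (x : H) (h : R) : H :=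
  (h^-1)%:C *: (T h x - x).

Definition generator (T : R -> {linear H -> H}) : operator :=
  Operator [set x | cvg (diff_quotient T x h @[h --> 0^'+])]
           (fun x => lim (diff_quotient T x h @[h --> 0^'+])).

Definition generates (A : operator) (T : R -> {linear H -> H}) : Prop :=
  C0_semigroup T /\ op_eq A (generator T).

Definition immediately_norm_continuous (T : R -> {linear H -> H}) : Prop :=
  forall t : R, 0 < t -> opnorm (T s \- T t) @[s --> t] --> (0 : R).

End Operators.

Arguments operator {R} H.

(* Main.v *)
(* Everything about the spectrum is extracted from approximate eigenvectors, without
   a spectral measure. For commuting bounded symmetric operators, joint approximate
   eigenvectors exist, and the top of the numerical range of the first operator can
   be prescribed. Let [Q = (l0 - A)^-1] be a resolvent, which is normal, and let [N]
   be an operator acting on approximate eigenvectors of [Q] at [z] as a scalar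
   [f z]. Applied to [N^* N] and the two symmetric parts of [Q], this gives
   [|N| <= sup |f|] over the spectrum of [Q].

   If: with [z = 1 / (l0 - l)], the function equal to [exp (t * l)] for [z <> 0]
   and to [0] at [z = 0] is a uniform limit on the spectrum of [Q] of the Euler
   approximations [exp (t * l0) (1 + t * (l0 - l) / n)^-n]: this is where one needs
   the spectrum to be bounded in right half-planes. So these approximations,
   formed with resolvents of [A], converge in norm to a semigroup, and the generator
   and the norm continuity are read off from bounds on scalar functions.

   Only if: since [A] and its adjoint have the same domain, with equal norms
   [|A x|], a point [l] of the spectrum has approximate eigenvectors [x], and
   [T t x] is then close to [exp (t * l) x]; hence
   [|exp (s * l) - exp (t * l)| <= |T s - T t|], and norm continuity at [1] bounds
   [Im l] when [Re l >= b], while [|T 1|] bounds [Re l].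

   Normality of the semigroup follows from uniqueness, since the semigroup
   constructed above is normal. *)

Require Import Defs.
From HB Require Import structures.
From mathcomp Require Import all_boot all_order all_algebra.
From mathcomp Require Import complex.
From mathcomp Require Import all_classical all_reals all_analysis.
From mathcomp Require Import ring lra.
Import Order.TTheory GRing.Theory Num.Theory.
Import numFieldNormedType.Exports.

Local Open Scope classical_set_scope.
Local Open Scope ring_scope.
Local Open Scope complex_scope.

Set Implicit Arguments.
Unset Strict Implicit.
Unset Printing Implicit Defensive.

(** * Real-valued modulus of complex numbers *)

Section ComplexModulus.
Context {R : realType}.
Implicit Types z w : R[i].

(** Normality is given only as an equality of the two products of [A] with its adjoint, domains
    included, whereas the arguments need that the resolvent commutes with its adjoint and that there
    is no residual spectrum. Both come from [|As x| = |A x|] on a common domain, which holds on the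
    domain of [As A] by computation and extends because that domain is a core. Riesz representation,
    the core and the range of [l - A] all rest on one nearest-point argument in the product of [H]
    with itself.

    The bound of an operator by its symbol also gives limits: uniform convergence of symbols becomes
    norm convergence of operators. The clause that [N] commutes with whatever commutes with [Q]
    brings in the adjoint of [Q], and so lets [N^* N] be treated jointly with [Q].

    A semigroup that is merely given is compared with [exp (t l)] by telescoping over short steps.
    This needs a bound on [[0, t]], hence the uniform boundedness principle.

    Estimates are made in [R], whose order is total: [nrm] and [ip] are real parts, and
    multiplication by [i] recovers what they drop. *)

Definition cabs z : R := complex.Re `|z|.

Lemma cabsE z : `|z| = (cabs z)%:C.
Proof. by rewrite /cabs normc_def. Qed.

Lemma cabs_def z : cabs z = Num.sqrt ((complex.Re z) ^+ 2 + (complex.Im z) ^+ 2).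
Proof. by rewrite /cabs normc_def. Qed.

Lemma cabs_ge0 z : 0 <= cabs z.
Proof. by rewrite cabs_def sqrtr_ge0. Qed.

Lemma cabs_sqr z : cabs z ^+ 2 = (complex.Re z) ^+ 2 + (complex.Im z) ^+ 2.
Proof. by rewrite cabs_def sqr_sqrtr // addr_ge0 ?sqr_ge0. Qed.

Lemma cabsM z w : cabs (z * w) = cabs z * cabs w.
Proof. by apply: complexI; rewrite rmorphM /= -!cabsE normrM. Qed.

Lemma cabsV z : cabs z^-1 = (cabs z)^-1.
Proof. by apply: complexI; rewrite fmorphV /= -!cabsE normfV. Qed.

Lemma cabsX z n : cabs (z ^+ n) = cabs z ^+ n.
Proof. by apply: complexI; rewrite rmorphXn /= -!cabsE normrX. Qed.

Lemma cabsN z : cabs (- z) = cabs z.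
Proof. by rewrite /cabs normrN. Qed.

Lemma cabsD z w : cabs (z + w) <= cabs z + cabs w.
Proof. by rewrite -lecR rmorphD /= -!cabsE ler_normD. Qed.

Lemma cabsB z w : cabs (z - w) <= cabs z + cabs w.
Proof. by rewrite -(cabsN w) cabsD. Qed.

Lemma cabs0 : cabs 0 = 0.
Proof. by rewrite /cabs normr0. Qed.

Lemma cabs1 : cabs 1 = 1.
Proof. by rewrite /cabs normr1. Qed.

Lemma cabs_real (a : R) : cabs a%:C = `|a|.
Proof. by rewrite cabs_def /= expr0n /= addr0 sqrtr_sqr. Qed.

Lemma cabs_eq0 z : cabs z = 0 -> z = 0.
Proof. by move=> h; apply: normr0_eq0; rewrite cabsE h. Qed.

Lemma cabs_gt0 z : z != 0 -> 0 < cabs z.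
Proof.
move=> z0; rewrite lt_neqAle cabs_ge0 andbT eq_sym.
by apply: contra z0 => /eqP /cabs_eq0 ->.
Qed.

Lemma ler_Re_cabs z : `|complex.Re z| <= cabs z.
Proof.
rewrite -(ler_pXn2r (_ : 0 < 2)%N) ?nnegrE ?cabs_ge0 //.
by rewrite cabs_sqr real_normK ?num_real // lerDl sqr_ge0.
Qed.

Lemma ler_Im_cabs z : `|complex.Im z| <= cabs z.
Proof.
rewrite -(ler_pXn2r (_ : 0 < 2)%N) ?nnegrE ?cabs_ge0 //.
by rewrite cabs_sqr real_normK ?num_real // lerDr sqr_ge0.
Qed.

Lemma cabs_le_ReIm z : cabs z <= `|complex.Re z| + `|complex.Im z|.
Proof.
rewrite -(ler_pXn2r (_ : 0 < 2)%N) ?nnegrE ?cabs_ge0 ?addr_ge0 //.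
rewrite cabs_sqr sqrrD !real_normK ?num_real //.
by have := mulr_ge0 (normr_ge0 (complex.Re z)) (normr_ge0 (complex.Im z)); lra.
Qed.

Lemma real_complex_gt0 (e : R[i]) : 0 < e -> 0 < complex.Re e /\ e = (complex.Re e)%:C.
Proof.
by case: e => a b; rewrite ltcE /= => /andP[/eqP -> ?].
Qed.

End ComplexModulus.

(** * Real-valued norm, continuity and completeness of [H] *)

Section RealHilbert.
Context {R : realType} {H : completeNormedModType R[i]}.
Implicit Types (x y z : H) (a : R[i]) (r : R).

Definition nrm x : R := complex.Re `|x|.

Lemma nrmE x : `|x| = (nrm x)%:C.
Proof.
by have := normr_ge0 x; rewrite lecE /nrm /= => /andP[/eqP h _]; rewrite {1}(complexE `|x|) h mulr0 addr0.
Qed.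

Lemma nrm_ge0 x : 0 <= nrm x.
Proof. by rewrite -lecR -nrmE normr_ge0. Qed.

Lemma nrm0 : nrm 0 = 0.
Proof. by rewrite /nrm normr0. Qed.

Lemma nrm0_eq0 x : nrm x = 0 -> x = 0.
Proof. by move=> h; apply: normr0_eq0; rewrite nrmE h. Qed.

Lemma nrm_gt0 x : x <> 0 -> 0 < nrm x.
Proof.
move=> x0; rewrite lt_neqAle nrm_ge0 andbT eq_sym.
by apply/eqP => /nrm0_eq0.
Qed.

Lemma nrmD x y : nrm (x + y) <= nrm x + nrm y.
Proof. by rewrite -lecR rmorphD /= -!nrmE ler_normD. Qed.

Lemma nrmN x : nrm (- x) = nrm x.
Proof. by rewrite /nrm normrN. Qed.

Lemma nrmB x y : nrm (x - y) <= nrm x + nrm y.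
Proof. by rewrite -(nrmN y) nrmD. Qed.

Lemma nrmC x y : nrm (x - y) = nrm (y - x).
Proof. by rewrite /nrm distrC. Qed.

Lemma nrmZ a x : nrm (a *: x) = cabs a * nrm x.
Proof. by apply: complexI; rewrite rmorphM /= -!nrmE -cabsE normrZ. Qed.

Lemma nrm_split y x z : nrm (x - z) <= nrm (x - y) + nrm (y - z).
Proof. by rewrite -(subrKA y x) nrmD. Qed.

Lemma nrm_small_eq x y : (forall e : R, 0 < e -> nrm (x - y) <= e) -> x = y.
Proof.
move=> h; apply/eqP; rewrite -subr_eq0; apply/eqP/nrm0_eq0/eqP.
by rewrite eq_le nrm_ge0 andbT; apply/ler_addgt0Pr => e e0; rewrite add0r h.
Qed.

Lemma nbhs_nrmP x (P : set H) :
  nbhs x P <-> exists2 e : R, 0 < e & forall y, nrm (x - y) < e -> P y.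
Proof.
split=> [/nbhs_normP [e /= e0 h]|[e e0 h]].
  have [e1 e2] := real_complex_gt0 e0.
  by exists (complex.Re e) => // y hy; apply: h; rewrite /= nrmE e2 ltcR.
apply/nbhs_normP; exists e%:C; first by rewrite /= ltcR.
by move=> y /=; rewrite nrmE ltcR => /h.
Qed.

Lemma cvg_nrmP (T : Type) (F : set_system T) (FF : Filter F) (f : T -> H) (l : H) :
  f @ F --> l <-> (forall e : R, 0 < e -> \forall t \near F, nrm (f t - l) < e).
Proof.
split=> [h e e0|h P /nbhs_nrmP [e e0 hP]].
  have /h : nbhs l [set y | nrm (y - l) < e].
    by apply/nbhs_nrmP; exists e => // y; rewrite /= nrmC.
  by [].
have := h _ e0; rewrite /nbhs /= /nbhs /=; apply: filterS => t ht.
by apply: hP; rewrite nrmC.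
Qed.

Lemma continuous_nrmP (f : H -> H) : continuous f <->
  forall x (e : R), 0 < e ->
    exists2 d : R, 0 < d & forall y, nrm (x - y) < d -> nrm (f x - f y) < e.
Proof.
split=> [h x e e0|h x].
  have /cvg_nrmP /(_ _ e0) /nbhs_nrmP [d d0 hd] := h x.
  by exists d => // y /hd; rewrite nrmC.
apply/cvg_nrmP => e e0; apply/nbhs_nrmP.
by have [d d0 hd] := h x _ e0; exists d => // y /hd; rewrite nrmC.
Qed.

Definition bounded_by (c : R) (f : H -> H) := forall x, nrm (f x) <= c * nrm x.

Lemma bounded_by_le c d f : c <= d -> bounded_by c f -> bounded_by d f.
Proof.
by move=> cd h x; apply: le_trans (h x) _; rewrite ler_wpM2r ?nrm_ge0.
Qed.

Lemma continuous_linear_bounded_by (f : {linear H -> H}) :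
  continuous f <-> exists2 c : R, 0 < c & bounded_by c f.
Proof.
split=> [/continuous_nrmP /(_ 0 1 ltr01) [d d0 hd]|[c c0 h]].
  exists (2 / d); first by rewrite divr_gt0.
  move=> x; have [->|/eqP x0] := eqVneq x 0.
    by rewrite linear0 nrm0 mulr0.
  have nx := nrm_gt0 x0.
  have /hd : nrm (0 - (d / (2 * nrm x))%:C *: x) < d.
    rewrite sub0r nrmN nrmZ cabs_real gtr0_norm; last by rewrite divr_gt0 ?mulr_gt0.
    suff -> : d / (2 * nrm x) * nrm x = d / 2 by lra.
    by field; rewrite gt_eqF.
  rewrite linear0 sub0r nrmN linearZ /= nrmZ cabs_real gtr0_norm; last by rewrite divr_gt0 ?mulr_gt0.
  move=> h; have -> : 2 / d * nrm x = (d / (2 * nrm x))^-1.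
    by field; rewrite !gt_eqF.
  rewrite -[leRHS]mulr1 ler_pdivlMl; first exact: ltW.
  by rewrite divr_gt0 ?mulr_gt0.
apply/continuous_nrmP => x e e0; exists (e / c); first by rewrite divr_gt0.
move=> y hy; rewrite -linearB; apply: le_lt_trans (h _) _.
by rewrite mulrC -ltr_pdivlMr.
Qed.

Lemma cauchy_nrm_cvg (u : nat -> H) :
  (forall e : R, 0 < e -> exists N, forall n m, (N <= n)%N -> (N <= m)%N -> nrm (u n - u m) < e) ->
  exists l, forall e : R, 0 < e -> exists N, forall n, (N <= n)%N -> nrm (u n - l) < e.
Proof.
move=> h.
have hc : cauchy (u @ \oo).
  apply: cauchy_exP => e e0.
  have [e1 e2] := real_complex_gt0 e0.
  have [N hN] := h _ e1.
  exists (u N); exists N => // n Nn.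
  by rewrite /= -ball_normE /= nrmE e2 ltcR; apply: hN.
have hl : cvg (u @ \oo) by apply: cauchy_cvg.
exists (lim (u @ \oo)) => e e0.
have /cvg_nrmP /(_ _ e0) [N _ hN] := hl.
by exists N => n Nn; apply: hN.
Qed.

End RealHilbert.

(** * The real part of the inner product *)

Section RealInnerProduct.
Context {R : realType} {H : completeNormedModType R[i]}.
Context {dot : {dot H for (@Num.conj R[i])}}.
Hypothesis dotE : forall x : H, dot x x = `|x| ^+ 2.
Implicit Types (x y z : H) (a : R[i]) (r : R).

Lemma dotDl x y z : dot (x + y) z = dot x z + dot y z.
Proof. exact: linearDl. Qed.

Lemma dotNl x y : dot (- x) y = - dot x y.
Proof. exact: linearNl. Qed.

Lemma dotZl a x y : dot (a *: x) y = a * dot x y.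
Proof. exact: linearZl_LR. Qed.

Lemma dotZr a x y : dot x (a *: y) = conjc a * dot x y.
Proof. exact: linearZr_LR. Qed.

Lemma dot0l x : dot 0 x = 0.
Proof. exact: linear0l. Qed.

Lemma dotC x y : dot x y = conjc (dot y x).
Proof. by rewrite hermC /= expr0 mul1r. Qed.

Lemma dot_inj x y : (forall z, dot x z = dot y z) -> x = y.
Proof.
move=> h; apply/eqP; rewrite -subr_eq0 -(dnorm_eq0 dot) /=.
by rewrite dotDl dotNl h subrr.
Qed.

Definition ip x y : R := complex.Re (dot x y).

Lemma ipC x y : ip x y = ip y x.
Proof. by rewrite /ip dotC; case: (dot y x). Qed.

Lemma ipDl x y z : ip (x + y) z = ip x z + ip y z.
Proof. by rewrite /ip dotDl; case: (dot x z) => a b; case: (dot y z). Qed.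

Lemma ipNl x z : ip (- x) z = - ip x z.
Proof. by rewrite /ip dotNl; case: (dot x z). Qed.

Lemma ipBl x y z : ip (x - y) z = ip x z - ip y z.
Proof. by rewrite ipDl ipNl. Qed.

Lemma ipZl r x z : ip (r%:C *: x) z = r * ip x z.
Proof. by rewrite /ip dotZl; case: (dot x z) => a b /=; rewrite mul0r subr0. Qed.

Lemma ipDr x y z : ip z (x + y) = ip z x + ip z y.
Proof. by rewrite !(ipC z) ipDl. Qed.

Lemma ipNr x z : ip z (- x) = - ip z x.
Proof. by rewrite !(ipC z) ipNl. Qed.

Lemma ipBr x y z : ip z (x - y) = ip z x - ip z y.
Proof. by rewrite ipDr ipNr. Qed.

Lemma ipZr r x z : ip z (r%:C *: x) = r * ip z x.
Proof. by rewrite !(ipC z) ipZl. Qed.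

Lemma ip0l x : ip 0 x = 0.
Proof. by rewrite /ip dot0l. Qed.

Lemma ip0r x : ip x 0 = 0.
Proof. by rewrite ipC ip0l. Qed.

Lemma ip_conj a x y : ip (a *: x) y = ip x (conjc a *: y).
Proof. by rewrite /ip dotZl dotZr conjcK. Qed.

Lemma ip_iscale x y : ip ('i *: x) y = - complex.Im (dot x y).
Proof. by rewrite /ip dotZl mulrC ReiNIm. Qed.

Lemma ip_nrm x : ip x x = nrm x ^+ 2.
Proof. by rewrite /ip dotE nrmE -rmorphXn. Qed.

Lemma nrm_sqD x y : nrm (x + y) ^+ 2 = nrm x ^+ 2 + 2 * ip x y + nrm y ^+ 2.
Proof. by rewrite -!ip_nrm ipDl !ipDr (ipC y x); lra. Qed.

Lemma nrm_sqB x y : nrm (x - y) ^+ 2 = nrm x ^+ 2 - 2 * ip x y + nrm y ^+ 2.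
Proof. by rewrite nrm_sqD ipNr nrmN; lra. Qed.

(** For [q > 0] the polynomial is tested at its vertex [- b / q]. For [q = 0] and [b <> 0] it is
    affine and takes the value [-1] at the point tested. *)
Lemma quadratic_ge0_discr (c b q : R) : 0 <= q -> 0 <= c ->
  (forall t : R, 0 <= c + 2 * t * b + t ^+ 2 * q) -> b ^+ 2 <= c * q.
Proof.
move=> q0 c0 h; have [q00|q00] := eqVneq q 0.
  have h1 := h (- (c + 1) / (2 * b)).
  have [->|b0] := eqVneq b 0; first by rewrite q00 expr0n mulr0.
  move: h1; rewrite q00 mulr0 addr0.
  have -> : 2 * (- (c + 1) / (2 * b)) * b = - (c + 1) by field.
  by lra.
have qp : 0 < q by rewrite lt_neqAle eq_sym q00.
have := h (- b / q).
have -> : c + 2 * (- b / q) * b + (- b / q) ^+ 2 * q = (c * q - b ^+ 2) / q by field.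
by rewrite pmulr_lge0 ?invr_gt0 // subr_ge0.
Qed.

Lemma cauchy_schwarz x y : `|ip x y| <= nrm x * nrm y.
Proof.
rewrite -(ler_pXn2r (_ : 0 < 2)%N) ?nnegrE ?mulr_ge0 ?nrm_ge0 //.
rewrite real_normK ?num_real // exprMn.
apply: quadratic_ge0_discr; rewrite ?sqr_ge0 // => t.
have := sqr_ge0 (nrm (x + t%:C *: y)).
by rewrite nrm_sqD ipZr nrmZ cabs_real exprMn real_normK ?num_real //; lra.
Qed.

Lemma ip_le x y : ip x y <= nrm x * nrm y.
Proof. exact: le_trans (ler_norm _) (cauchy_schwarz _ _). Qed.

Lemma ip_inj x y : (forall z, ip x z = ip y z) -> x = y.
Proof.
move=> h; apply/eqP; rewrite -subr_eq0; apply/eqP/nrm0_eq0/eqP.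
by rewrite -[_ == 0]sqrf_eq0 -ip_nrm ipBl h subrr.
Qed.

Lemma ip_orthogonal0 (D : set H) x :
  (forall (e : R), 0 < e -> exists2 y, D y & nrm (x - y) < e) ->
  (forall y, D y -> ip x y = 0) -> x = 0.
Proof.
move=> hD h; apply: nrm0_eq0; apply/eqP; rewrite eq_le nrm_ge0 andbT.
apply/ler_addgt0Pr => e e0; rewrite add0r leNgt; apply/negP => ex.
have [y Dy xy] := hD _ e0.
have : nrm x ^+ 2 <= nrm x * nrm (x - y).
  by rewrite -ip_nrm; apply: le_trans (ip_le x (x - y)); rewrite ipBr (h y Dy) subr0.
rewrite expr2 ler_pM2l; last exact: lt_trans ex.
by move=> /le_lt_trans /(_ xy) /(lt_trans ex); rewrite ltxx.
Qed.

(** Testing at ['i *: x], which linearity keeps in the domain, turns the real part into minus the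
    imaginary part, so the real identities contain the complex one. *)
Lemma adjoint_rel_ipP (A : operator H) y z : op_linear A ->
  adjoint_rel dot A y z <-> (forall x, op_dom A x -> ip (A x) y = ip x z).
Proof.
move=> [A0 Alin]; split=> [h x Dx|h x Dx]; first by rewrite /ip h.
apply/eqP; rewrite eq_complex; apply/andP; split; apply/eqP; first exact: h.
have [D1 E1] := Alin 'i x 0 Dx A0.
have [D2 E2] := Alin (-1) 0 0 A0 A0.
have A00 : A 0 = 0.
  have := Alin 1 0 0 A0 A0; rewrite !scale1r addr0 => -[_ /eqP].
  by rewrite -subr_eq0 opprD addrA subrr sub0r oppr_eq0 => /eqP.
move: (h _ D1); rewrite E1 A00 !addr0 !ip_iscale => /eqP.
by rewrite eqr_opp => /eqP.
Qed.

End RealInnerProduct.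

(* An identity of vectors is tested by pairing with every vector, which leaves an
   identity of scalars. *)
Ltac vec dot := apply: (@dot_inj _ _ dot) => ?; rewrite ?(dotDl, dotNl, dotZl, dot0l); ring.

(** * Nearest points, Riesz representation, bounded adjoints *)

Section Projection.
Context {R : realType} {H : completeNormedModType R[i]}.
Context {dot : {dot H for (@Num.conj R[i])}}.
Context (dotE : forall x : H, dot x x = `|x| ^+ 2).
Local Notation ip := (@ip R H dot).

Lemma vanishing_sequence : exists d : nat -> R,
  (forall n, 0 < d n) /\
  (forall e : R, 0 < e -> exists N, forall n, (N <= n)%N -> d n < e).
Proof.
exists (fun n => n.+1%:R^-1); split=> [n|e e0]; first by rewrite invr_gt0 ltr0n.
exists (Num.truncn e^-1) => n Nn.
rewrite invf_plt ?posrE ?ltr0n //; apply: lt_le_trans (truncnS_gt _) _.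
by rewrite ler_nat ltnS.
Qed.

(** [(x, v)] is the point nearest to [(h, k)] in the closure of the real subspace [G]. Stating
    closure by approximation lets kernels, graphs and ranges be used without being closed
    beforehand. *)
Lemma projection_closure (G : set (H * H)) (h k : H) : G (0, 0) ->
  (forall (r : R) p q, G p -> G q -> G (p.1 + r%:C *: q.1, p.2 + r%:C *: q.2)) ->
  exists x v,
    (forall e : R, 0 < e -> exists y w, [/\ G (y, w), nrm (x - y) < e & nrm (v - w) < e]) /\
    (forall y w, G (y, w) -> ip (x - h) y + ip (v - k) w = 0).
Proof.
move=> G0 Glin; have [d [d0 hd]] := vanishing_sequence.
pose F (p : H * H) := nrm (p.1 - h) ^+ 2 + nrm (p.2 - k) ^+ 2.
have F0 p : 0 <= F p by rewrite addr_ge0 ?sqr_ge0.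
pose m := inf (F @` G).
have hinf : has_inf (F @` G).
  by split; [exists (F (0, 0)), (0, 0)|exists 0 => _ [p _ <-]].
have mF p : G p -> m <= F p by move=> Gp; apply: ge_inf; [case: hinf|exists p].
have /choice [p hp] : forall n : nat, exists p, G p /\ F p < m + d n.
  move=> n.
  by have [_ [q Gq <-] hq] := inf_adherent (d0 n) hinf; exists q.
pose B n (q : H * H) := ip ((p n).1 - h) q.1 + ip ((p n).2 - k) q.2.
pose Q (q : H * H) := nrm q.1 ^+ 2 + nrm q.2 ^+ 2.
have Q0 q : 0 <= Q q by rewrite addr_ge0 ?sqr_ge0.
(* [p n] minimises [F] up to [d n], so moving it by [t q] can lower [F] by at most [d n]. The
   discriminant of this polynomial in [t] shows that [p n] is almost stationary. *)
have hB n q : G q -> B n q ^+ 2 <= d n * Q q.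
  move=> Gq; apply: quadratic_ge0_discr => //; first exact: ltW; move=> t.
  have [Gp Fp] := hp n.
  have := mF _ (Glin t _ _ Gp Gq).
  have E (a b c : H) : nrm (a + t%:C *: b - c) ^+ 2 =
      nrm (a - c) ^+ 2 + 2 * (t * ip (a - c) b) + t ^+ 2 * nrm b ^+ 2.
    by rewrite (addrAC a) (nrm_sqD dotE (a - c)) ipZr nrmZ cabs_real exprMn real_normK ?num_real.
  by rewrite /F /= !E; rewrite /F in Fp; rewrite /B /Q; lra.
(* For the difference [q] of two near-minimisers, [Q q = B i q - B j q]; with [hB] this bounds
   [Q q ^+ 2] by a small multiple of [Q q]. *)
have hQ i j : Q ((p i).1 - (p j).1, (p i).2 - (p j).2) <= 2 * (d i + d j).
  set q := (_, _).
  have Gq : G q.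
    have := Glin (-1) _ _ (hp i).1 (hp j).1.
    by rewrite !rmorphN1 !scaleN1r.
  have hi := hB i _ Gq; have hj := hB j _ Gq.
  have E : Q q = B i q - B j q.
    have e1 : q.1 = ((p i).1 - h) - ((p j).1 - h) by rewrite opprB addrA subrK.
    have e2 : q.2 = ((p i).2 - k) - ((p j).2 - k) by rewrite opprB addrA subrK.
    rewrite /Q /B -!(ip_nrm dotE).
    have -> : ip q.1 q.1 = ip ((p i).1 - h) q.1 - ip ((p j).1 - h) q.1 by rewrite -ipBl -e1.
    have -> : ip q.2 q.2 = ip ((p i).2 - k) q.2 - ip ((p j).2 - k) q.2 by rewrite -ipBl -e2.
    by lra.
  have [q0|q0] := eqVneq (Q q) 0.
    by rewrite q0 mulr_ge0 // addr_ge0 // ltW.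
  have qp : 0 < Q q by rewrite lt_neqAle eq_sym q0 Q0.
  rewrite -(ler_pM2r qp) -expr2 {1}E.
  have hs : 0 <= (B i q + B j q) ^+ 2 by apply: sqr_ge0.
  have -> : (B i q - B j q) ^+ 2 = 2 * B i q ^+ 2 + 2 * B j q ^+ 2 - (B i q + B j q) ^+ 2 by ring.
  by lra.
have hC (e : R) : 0 < e -> exists N, forall i j, (N <= i)%N -> (N <= j)%N ->
    Q ((p i).1 - (p j).1, (p i).2 - (p j).2) < e ^+ 2.
  move=> e0; have e2 : 0 < e ^+ 2 / 4 by rewrite divr_gt0 // exprn_gt0.
  have [N hN] := hd _ e2; exists N => i j /hN hi /hN hj.
  by apply: le_lt_trans (hQ i j) _; lra.
have [x hx] : exists l, forall e : R, 0 < e -> exists N, forall n, (N <= n)%N -> nrm ((p n).1 - l) < e.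
  apply: cauchy_nrm_cvg => e e0; have [N hN] := hC _ e0; exists N => i j Ni Nj.
  rewrite -(ltr_pXn2r (_ : 0 < 2)%N) ?nnegrE ?nrm_ge0 ?(ltW e0) //.
  by apply: le_lt_trans (hN i j Ni Nj); rewrite lerDl sqr_ge0.
have [v hv] : exists l, forall e : R, 0 < e -> exists N, forall n, (N <= n)%N -> nrm ((p n).2 - l) < e.
  apply: cauchy_nrm_cvg => e e0; have [N hN] := hC _ e0; exists N => i j Ni Nj.
  rewrite -(ltr_pXn2r (_ : 0 < 2)%N) ?nnegrE ?nrm_ge0 ?(ltW e0) //.
  by apply: le_lt_trans (hN i j Ni Nj); rewrite lerDr sqr_ge0.
exists x, v; split=> [e e0|y w Gyw].
  have [N1 h1] := hx _ e0; have [N2 h2] := hv _ e0.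
  exists (p (maxn N1 N2)).1, (p (maxn N1 N2)).2; rewrite -surjective_pairing.
  by rewrite nrmC (nrmC v); split; [exact: (hp _).1|exact/h1/leq_maxl|exact/h2/leq_maxr].
apply/eqP; rewrite -normr_eq0 eq_le normr_ge0 andbT; apply/ler_addgt0Pr => e e0.
rewrite add0r.
pose S := 1 + nrm y + nrm w; have S1 : 1 <= S by have := nrm_ge0 y; have := nrm_ge0 w; rewrite /S; lra.
have S0 : 0 < S by lra.
(* Three errors, one from the near-stationarity of [p n] and two from replacing [(x, v)] by [p n],
   are each at most [e1 * S = e / 3]. *)
pose e1 := e / (3 * S); have e10 : 0 < e1 by rewrite divr_gt0 // mulr_gt0.
have [N1 h1] := hx _ e10; have [N2 h2] := hv _ e10.
have [N3 h3] : exists N, forall n, (N <= n)%N -> d n < e1 ^+ 2.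
  by apply: hd; rewrite exprn_gt0.
pose n := maxn N1 (maxn N2 N3).
have {}h1 : nrm (x - (p n).1) < e1 by rewrite nrmC; apply/h1/leq_maxl.
have {}h2 : nrm (v - (p n).2) < e1.
  by rewrite nrmC; apply/h2; rewrite /n (leq_trans (leq_maxl N2 N3)) ?leq_maxr.
have {}h3 : d n < e1 ^+ 2.
  by apply/h3; rewrite /n (leq_trans (leq_maxr N2 N3)) ?leq_maxr.
have hBn : `|B n (y, w)| <= e1 * S.
  have eS : 0 <= e1 * S by rewrite mulr_ge0 ?ltW.
  rewrite -(ler_pXn2r (_ : 0 < 2)%N) ?nnegrE // real_normK ?num_real //.
  apply: le_trans (hB n _ Gyw) _; rewrite exprMn.
  apply: ler_pM; [exact: ltW|exact: Q0|exact: ltW|rewrite /Q /S /=].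
  by have := nrm_ge0 y; have := nrm_ge0 w; nra.
have -> : ip (x - h) y + ip (v - k) w =
    B n (y, w) + (ip (x - (p n).1) y + ip (v - (p n).2) w).
  by rewrite /B /= !ipBl; lra.
have c1 := cauchy_schwarz dotE (x - (p n).1) y.
have c2 := cauchy_schwarz dotE (v - (p n).2) w.
have d1 : nrm (x - (p n).1) * nrm y <= e1 * S.
  by apply: ler_pM; rewrite ?nrm_ge0 ?ltW // /S; have := nrm_ge0 w; lra.
have d2 : nrm (v - (p n).2) * nrm w <= e1 * S.
  by apply: ler_pM; rewrite ?nrm_ge0 ?ltW // /S; have := nrm_ge0 y; lra.
apply: le_trans (ler_normD _ _) _; apply: le_trans (lerD hBn (ler_normD _ _)) _.
have : e1 * S * 3 = e by rewrite /e1; field; rewrite gt_eqF.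
by lra.
Qed.

Lemma linear_pack (f : H -> H) : (forall a x y, f (a *: x + y) = a *: f x + f y) ->
  exists F : {linear H -> H}, forall x, F x = f x.
Proof.
move=> lf; have lf' : linear f by [].
pose F : {linear H -> H} := HB.pack f (GRing.isLinear.Build _ _ _ _ _ lf').
by exists F.
Qed.

(** A vector [w] orthogonal to the kernel represents [phi] after rescaling, because
    [y - (phi y / phi w) w] is in the kernel. *)
Lemma riesz (phi : H -> R) (c : R) :
  (forall (r : R) x y, phi (x + r%:C *: y) = phi x + r * phi y) ->
  (forall x, `|phi x| <= c * nrm x) ->
  exists z, forall x, phi x = ip x z.
Proof.
move=> plin pb.
have p0 : phi 0 = 0 by have := plin (-1) 0 0; rewrite scaler0 addr0; lra.
have [all0|/existsNP [u pu]] := pselect (forall x, phi x = 0).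
  by exists 0 => x; rewrite all0 ip0r.
have /eqP {}pu := pu.
have pB x y : phi (x - y) = phi x - phi y.
  by have := plin (-1) x y; rewrite rmorphN1 scaleN1r => ->; lra.
have [||x [v [hcl hort]]] := @projection_closure [set p | phi p.1 = 0 /\ p.2 = 0] u 0.
- by [].
- by move=> r p q /= [p1 p2] [q1 q2]; rewrite plin p1 q1 p2 q2 scaler0 mulr0 !addr0.
have px : phi x = 0.
  apply/eqP; rewrite -normr_eq0 eq_le normr_ge0 andbT; apply/ler_addgt0Pr => e e0.
  have c1 : 0 < `|c| + 1 by have := normr_ge0 c; lra.
  have [|y [w [[/= y0 _] xy _]]] := hcl (e / (`|c| + 1)); first by rewrite divr_gt0.
  rewrite add0r -(subr0 (phi x)) -y0 -pB; apply: le_trans (pb _) _.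
  move: (ltW xy); rewrite ler_pdivlMr // => h1; apply: le_trans h1.
  rewrite mulrC ler_wpM2l ?nrm_ge0 //; have := ler_norm c; lra.
have ort y : phi y = 0 -> ip (u - x) y = 0.
  move=> py; have := hort y 0; rewrite ip0r addr0 => /(_ (conj py erefl)).
  by rewrite !ipBl; lra.
pose w := u - x.
have pw : phi w = phi u by rewrite /w pB px subr0.
have nw : nrm w != 0.
  apply/eqP => /nrm0_eq0 w0; move: pw; rewrite w0 p0 => /esym/eqP.
  by rewrite (negbTE pu).
exists ((phi u / nrm w ^+ 2)%:C *: w) => y.
rewrite ipZr (ipC y).
have := ort (y + (- (phi y / phi u))%:C *: w).
rewrite plin pw => /(_ ltac:(by field)); rewrite -/w ipDr ipZr (ip_nrm dotE) => h.
have -> : ip w y = phi y / phi u * nrm w ^+ 2 by lra.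
by field; rewrite pu.
Qed.

Definition is_adjoint (f g : H -> H) := forall x y, ip (f x) y = ip x (g y).

Lemma is_adjointC f g : is_adjoint f g -> is_adjoint g f.
Proof. by move=> h x y; rewrite ipC -h ipC. Qed.

(** Riesz applied to [x |-> ip (f x) y]. The bound passes from [f] to [g] through
    [|g y|^2 = ip (f (g y)) y <= c |g y| |y|]. *)
Lemma adjoint_exists (f : {linear H -> H}) : continuous f ->
  exists g : {linear H -> H}, continuous g /\ is_adjoint f g.
Proof.
move=> /continuous_linear_bounded_by [c c0 fc].
have /choice [g hg] y : exists z, forall x, ip (f x) y = ip x z.
  apply: (@riesz (fun x => ip (f x) y) (c * nrm y)) => [r x x'|x].
    by rewrite linearD linearZ /= ipDl ipZl.
  apply: le_trans (cauchy_schwarz dotE _ _) _.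
  by rewrite mulrAC ler_wpM2r ?nrm_ge0.
have [|g' hg'] := @linear_pack g.
  move=> a x y; apply: (ip_inj dotE) => z.
  have hg1 u v : ip (g u) v = ip (f v) u by rewrite ipC hg.
  by rewrite ipDl ip_conj !hg1 linearZ /= ip_conj conjcK ipDr.
exists g'; split; last by move=> x y; rewrite hg hg'.
apply/continuous_linear_bounded_by; exists c => // y; rewrite hg'.
have [->|/eqP y0] := eqVneq (g y) 0; first by rewrite nrm0 mulr_ge0 ?nrm_ge0 // ltW.
have n0 := nrm_gt0 y0; rewrite -(ler_pM2r n0) -expr2 -(ip_nrm dotE) -hg.
apply: le_trans (ip_le dotE _ _) _; rewrite mulrAC ler_wpM2r ?nrm_ge0 //.
Qed.

End Projection.

Arguments is_adjoint {R H} dot f g.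

(** * Unbounded normal operators: adjoint, spectrum, resolvent *)

Section NormalOperator.
Context {R : realType} {H : completeNormedModType R[i]}.
Context {dot : {dot H for (@Num.conj R[i])}}.
Context (dotE : forall x : H, dot x x = `|x| ^+ 2).
Local Notation ip := (@ip R H dot).

Definition closed_op (A : operator H) := forall x v,
  (forall e : R, 0 < e -> exists y, [/\ op_dom A y, nrm (x - y) < e & nrm (v - A y) < e]) ->
  op_dom A x /\ A x = v.

Lemma closed_graph_closed_op (A : operator H) : closed (op_graph A) -> closed_op A.
Proof.
move=> cA x v h.
have [] : op_graph A (x, v).
  apply: cA => B [[P Q] /= [/nbhs_nrmP [e1 e10 hP] /nbhs_nrmP [e2 e20 hQ]] PQ].
  have e0 : 0 < Num.min e1 e2 by rewrite lt_min e10.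
  have [y [Dy xy vy]] := h _ e0; exists (y, A y); split=> //.
  by apply: PQ; split; [apply: hP|apply: hQ] => /=;
     [apply: lt_le_trans xy _|apply: lt_le_trans vy _]; rewrite ge_min lexx ?orbT.
by move=> /= Dx ->.
Qed.

Lemma dense_nrmP (D : set H) : dense D ->
  forall x (e : R), 0 < e -> exists2 y, D y & nrm (x - y) < e.
Proof.
move=> dD x e e0.
have [||y [By Dy]] := dD (interior [set y | nrm (x - y) < e]).
- by exists x; apply/nbhs_nrmP; exists e.
- exact: open_interior.
- by exists y => //; apply: interior_subset By.
Qed.

Lemma op_linear0 (A : operator H) : op_linear A -> A 0 = 0.
Proof.
move=> [A0 Alin]; have := Alin 1 0 0 A0 A0; rewrite !scale1r addr0 => -[_ /eqP].
by rewrite -subr_eq0 opprD addrA subrr sub0r oppr_eq0 => /eqP.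
Qed.

Lemma op_linearZ (A : operator H) a x : op_linear A -> op_dom A x ->
  op_dom A (a *: x) /\ A (a *: x) = a *: A x.
Proof.
move=> lA Dx; have [A0 /(_ a x 0 Dx A0)] := lA.
by rewrite (op_linear0 lA) !addr0.
Qed.

Lemma op_linearD (A : operator H) x y : op_linear A -> op_dom A x -> op_dom A y ->
  op_dom A (x + y) /\ A (x + y) = A x + A y.
Proof. by move=> [_ /(_ 1 x y)]; rewrite !scale1r. Qed.

Lemma op_linearB (A : operator H) x y : op_linear A -> op_dom A x -> op_dom A y ->
  op_dom A (x - y) /\ A (x - y) = A x - A y.
Proof.
move=> lA Dx Dy; have [Dy' Ey] := op_linearZ (-1) lA Dy.
by have := op_linearD lA Dx Dy'; rewrite Ey !scaleN1r.
Qed.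

(* [y] in [C] solves [(1 + P^* P) y = h] weakly; hence nothing in the graph of [P]
   is orthogonal to the graph of [P] restricted to [C], i.e. [C] is a core of [P]. *)
Lemma core_norm_transfer (P Q : operator H) (C : set H) :
  op_linear P -> closed_op P -> op_linear Q -> closed_op Q ->
  (forall x, C x -> op_dom P x) -> (forall x, C x -> op_dom Q x) ->
  C 0 -> (forall a x y, C x -> C y -> C (a *: x + y)) ->
  (forall x, C x -> nrm (Q x) = nrm (P x)) ->
  (forall h, exists2 y, C y &
     forall u, op_dom P u -> ip u y + ip (P u) (P y) = ip u h) ->
  forall u, op_dom P u -> op_dom Q u /\ nrm (Q u) = nrm (P u).
Proof.
move=> lP cP lQ cQ CP CQ C0 Clin CN surj u Du.
have core (e : R) : 0 < e -> exists y, [/\ C y, nrm (u - y) < e & nrm (P u - P y) < e].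
  have [||x [v [hcl hort]]] :=
      @projection_closure _ _ _ dotE [set p | C p.1 /\ p.2 = P p.1] u (P u).
  - by split=> //=; rewrite (op_linear0 lP).
  - move=> r p q /= [Cp ->] [Cq ->]; split; first by rewrite addrC; apply: Clin.
    by rewrite [in RHS]addrC (lP.2 _ _ _ (CP _ Cq) (CP _ Cp)).2 addrC.
  have [Dx Px] : op_dom P x /\ P x = v.
    apply: cP => e' e'0; have [y [w [[/= Cy ->] xy vw]]] := hcl _ e'0.
    by exists y; split=> //; apply: CP.
  have xu : x = u.
    have [Dxu Exu] := op_linearB lP Dx Du.
    have [y Cy hy] := surj (x - u).
    apply/eqP; rewrite -subr_eq0; apply/eqP/nrm0_eq0/eqP.
    rewrite -[_ == 0]sqrf_eq0 -(ip_nrm dotE) -hy // Exu Px.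
    by rewrite (hort y (P y)).
  move=> e0; have [y [w [[/= Cy ->] xy vw]]] := hcl _ e0.
  by exists y; split=> //; rewrite -?xu // Px.
have [d [d0 hd]] := @vanishing_sequence R.
have /choice [y hy] n := core _ (d0 n).
(* Equal norms on [C] make [Q (y n)] Cauchy because [P (y n)] converges; closedness of [Q] then puts
   [u] in its domain. *)
have [w hw] : exists w, forall e : R, 0 < e -> exists N, forall n, (N <= n)%N -> nrm (Q (y n) - w) < e.
  apply: cauchy_nrm_cvg => e e0.
  have e2 : 0 < e / 2 by lra.
  have [N hN] := hd _ e2; exists N => n m Nn Nm.
  have [Cn _ Pn] := hy n; have [Cm _ Pm] := hy m.
  have Cnm : C (y n - y m) by rewrite addrC -scaleN1r; apply: Clin.
  rewrite -(op_linearB lQ (CQ _ Cn) (CQ _ Cm)).2 CN // (op_linearB lP (CP _ Cn) (CP _ Cm)).2.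
  apply: le_lt_trans (nrm_split (P u) _ _) _; rewrite nrmC.
  by have := hN _ Nn; have := hN _ Nm; lra.
have close (e : R) : 0 < e -> exists n, d n < e /\ nrm (Q (y n) - w) < e.
  move=> e0; have [N1 h1] := hd _ e0; have [N2 h2] := hw _ e0.
  by exists (maxn N1 N2); split; [apply/h1/leq_maxl|apply/h2/leq_maxr].
have [Du' Qu] : op_dom Q u /\ Q u = w.
  apply: cQ => e e0; have [n [dn Qn]] := close _ e0; have [Cn un _] := hy n.
  by exists (y n); split; [exact: CQ|exact: lt_trans dn|rewrite nrmC].
split=> //; apply/eqP; rewrite -subr_eq0 -normr_eq0 eq_le normr_ge0 andbT.
apply/ler_addgt0Pr => e e0; rewrite add0r; have e2 : 0 < e / 2 by lra.
have [n [dn Qn]] := close _ e2; have [Cn un Pn] := hy n.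
rewrite ler_norml Qu; have := CN _ Cn.
have := nrm_split (Q (y n)) w 0; have := nrm_split w (Q (y n)) 0.
have := nrm_split (P (y n)) (P u) 0; have := nrm_split (P u) (P (y n)) 0.
rewrite !subr0 (nrmC w) (nrmC (P (y n)) (P u)); lra.
Qed.

Context (A : operator H) (A_normal : normal_op dot A).
Local Notation As := (adjoint dot A).

Lemma normal_linear : op_linear A. Proof. by case: A_normal. Qed.

Lemma normal_closed_op : closed_op A.
Proof. by case: A_normal => _ _ /closed_graph_closed_op. Qed.

Lemma normal_dense x (e : R) : 0 < e -> exists2 y, op_dom A y & nrm (x - y) < e.
Proof. by case: A_normal => _ /dense_nrmP h _ _; exact: h. Qed.

Lemma adjoint_ip x y : op_dom A x -> op_dom As y -> ip (A x) y = ip x (As y).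
Proof.
move=> Dx [z hz].
have := @getPex _ (adjoint_rel dot A y) (ex_intro _ z hz).
by move=> /(adjoint_rel_ipP _ _ normal_linear); apply.
Qed.

Lemma adjoint_intro y z : (forall x, op_dom A x -> ip (A x) y = ip x z) ->
  op_dom As y /\ As y = z.
Proof.
move=> h; have Dy : op_dom As y.
  by exists z; apply/(adjoint_rel_ipP _ _ normal_linear).
split=> //; apply/eqP; rewrite -subr_eq0; apply/eqP.
apply: (ip_orthogonal0 dotE (normal_dense _)) => x Dx.
by rewrite ipC ipBr -h // -adjoint_ip // subrr.
Qed.

Lemma adjoint_linear : op_linear As.
Proof.
split=> [|a x y Dx Dy]; first by apply: (proj1 (@adjoint_intro 0 0 _)) => x _; rewrite !ip0r.
apply: adjoint_intro => z Dz.
rewrite !ipDr -(adjoint_ip Dz Dy) (ipC (A z)) ip_conj ipC -(op_linearZ _ normal_linear Dz).2.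
rewrite adjoint_ip //; last exact: (op_linearZ _ normal_linear Dz).1.
by rewrite ip_conj conjcK.
Qed.

Lemma adjoint_closed_op : closed_op As.
Proof.
move=> x v h; apply: adjoint_intro => z Dz.
apply/eqP; rewrite -subr_eq0 -normr_eq0 eq_le normr_ge0 andbT.
apply/ler_addgt0Pr => e e0; rewrite add0r.
pose S := 1 + nrm z + nrm (A z).
have S0 : 0 < S by have := nrm_ge0 z; have := nrm_ge0 (A z); rewrite /S; lra.
have e1 : 0 < e / S by rewrite divr_gt0.
have [y [Dy xy vy]] := h _ e1.
have -> : ip (A z) x - ip z v = ip (A z) (x - y) - ip z (v - As y).
  by rewrite !ipBr (adjoint_ip Dz Dy); lra.
apply: le_trans (ler_normB _ _) _.
apply: le_trans (lerD (cauchy_schwarz dotE _ _) (cauchy_schwarz dotE _ _)) _.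
have : nrm (A z) * nrm (x - y) <= nrm (A z) * (e / S) by rewrite ler_wpM2l ?nrm_ge0 // ltW.
have : nrm z * nrm (v - As y) <= nrm z * (e / S) by rewrite ler_wpM2l ?nrm_ge0 // ltW.
have : S * (e / S) = e by field; rewrite gt_eqF.
by move: (e / S) (ltW e1) => w w0; rewrite /S; nra.
Qed.

Lemma normal_comm_dom x : (op_dom A x /\ op_dom As (A x)) <-> (op_dom As x /\ op_dom A (As x)).
Proof.
case: A_normal => _ _ _ [E _]; rewrite /= in E.
by split=> h; [have : [set x | op_dom As x /\ op_dom A (As x)] x by rewrite -E|
   have : [set x | op_dom A x /\ op_dom As (A x)] x by rewrite E].
Qed.

Lemma normal_comm x : op_dom A x -> op_dom As (A x) -> As (A x) = A (As x).
Proof.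
by case: A_normal => _ _ _ [_ E] Dx Dx'; apply: E; rewrite inE.
Qed.

(** Von Neumann's argument: the projection of [(h, 0)] onto the graph of [A] is some [(x, A x)], and
    orthogonality of [(x - h, A x)] to the graph says that [A x] is in the domain of the adjoint,
    with value [h - x]. *)
Lemma normal_core h : exists y, [/\ op_dom A y, op_dom As (A y) & y + As (A y) = h].
Proof.
have lA := normal_linear.
have [||x [v [hcl hort]]] := @projection_closure _ _ _ dotE (op_graph A) h 0.
- by split; [exact: lA.1|rewrite /= (op_linear0 lA)].
- move=> r [p1 p2] [q1 q2] [/= Dp ->] [/= Dq ->].
  by rewrite addrC; have [D E] := lA.2 r%:C _ _ Dq Dp; split=> //=; rewrite E addrC.
have [Dx Ax] : op_dom A x /\ A x = v.
  apply: normal_closed_op => e e0; have [y [w [[/= Dy ->] xy vw]]] := hcl _ e0.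
  by exists y.
have [D E] : op_dom As (A x) /\ As (A x) = h - x.
  apply: adjoint_intro => y Dy.
  have := hort y (A y) (conj Dy erefl); rewrite subr0 Ax (ipC (A y)) (ipC y) !ipBl; lra.
by exists x; split=> //; rewrite E addrC subrK.
Qed.

Lemma normal_core_norm x : op_dom A x -> op_dom As (A x) -> nrm (As x) = nrm (A x).
Proof.
move=> Dx Dx'; have [Dsx Dsx'] := (normal_comm_dom x).1 (conj Dx Dx').
apply/eqP; rewrite -(eqrXn2 (_ : 0 < 2)%N) ?nrm_ge0 // -!(ip_nrm dotE).
by rewrite (adjoint_ip Dx) // normal_comm // (ipC x) (adjoint_ip Dsx').
Qed.

Let C := [set x | op_dom A x /\ op_dom As (A x)].

Let Clin a x y : C x -> C y -> C (a *: x + y).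
Proof.
move=> [Dx Dx'] [Dy Dy']; have [D E] := normal_linear.2 a _ _ Dx Dy.
by split=> //; rewrite E; exact: (adjoint_linear.2 a _ _ Dx' Dy').1.
Qed.

Let C0 : C 0.
Proof.
split; first exact: normal_linear.1.
by rewrite (op_linear0 normal_linear); exact: adjoint_linear.1.
Qed.

(** By [normal_core] the domain [C] of [As A] is a core of [A]; the norms agree there, and
    [core_norm_transfer] extends this to the whole domain. *)
Lemma normal_dom_adjoint x : op_dom A x -> op_dom As x /\ nrm (As x) = nrm (A x).
Proof.
apply: (@core_norm_transfer A As C normal_linear normal_closed_op adjoint_linear adjoint_closed_op _ _ C0 Clin).
- by move=> y [].
- by move=> y /normal_comm_dom [].
- by move=> y []; exact: normal_core_norm.
- move=> h; have [y [Dy Dy' <-]] := normal_core h; exists y => // u Du.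
  by rewrite ipDr (adjoint_ip Du Dy').
Qed.

(** The roles are exchanged. The [y] of [normal_core] also solves the equation for [A As], since the
    two products agree. *)
Lemma adjoint_dom_normal x : op_dom As x -> op_dom A x.
Proof.
move=> Dx.
apply: (proj1 (@core_norm_transfer As A C adjoint_linear adjoint_closed_op normal_linear normal_closed_op _ _ C0 Clin _ _ x Dx)).
- by move=> y /normal_comm_dom [].
- by move=> y [].
- by move=> y [Dy Dy']; rewrite normal_core_norm.
- move=> h; have [y [Dy Dy' <-]] := normal_core h; exists y => // u Du.
  have [Dsy Dsy'] := (normal_comm_dom y).1 (conj Dy Dy').
  by rewrite ipDr normal_comm // (ipC u (A _)) (adjoint_ip Dsy' Du) (ipC (As y)).
Qed.

(** The operator [l - A] inherits the equality of norms: in the expanded squares the cross terms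
    agree by moving [A] across the product. *)
Lemma normal_shift_norm (l : R[i]) x : op_dom A x ->
  nrm (conjc l *: x - As x) = nrm (l *: x - A x).
Proof.
move=> Dx; have [Dsx Ex] := normal_dom_adjoint Dx.
apply/eqP; rewrite -(eqrXn2 (_ : 0 < 2)%N) ?nrm_ge0 // !(nrm_sqB dotE) Ex.
have [D E] := op_linearZ (conjc l) normal_linear Dx.
have -> : ip (conjc l *: x) (As x) = ip (l *: x) (A x).
  by rewrite -(adjoint_ip D Dsx) E (ip_conj _ (A x)) conjcK ipC.
rewrite !nrmZ.
by have -> : cabs (conjc l) = cabs l by rewrite /cabs normcJ.
Qed.

(** A normal operator has no residual spectrum. The bound makes [l - A] injective with closed range,
    and a nonzero vector orthogonal to the range would be an eigenvector of the adjoint, hence of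
    [A]. *)
Lemma normal_resolvent_of_lower_bound (l : R[i]) (c : R) : 0 < c ->
  (forall x, op_dom A x -> c * nrm x <= nrm (l *: x - A x)) -> resolvent_set A l.
Proof.
move=> c0 hc; have lA := normal_linear.
pose B x := l *: x - A x.
have BE x y : op_dom A x -> op_dom A y -> B x - B y = B (x - y).
  move=> Dx Dy; rewrite /B (op_linearB lA Dx Dy).2 scalerBr.
  by vec dot.
have Binj x y : op_dom A x -> op_dom A y -> B x = B y -> x = y.
  move=> Dx Dy E; apply: nrm_small_eq => e e0.
  rewrite -(ler_pM2l c0); apply: le_trans (hc _ _) _; first exact: (op_linearB lA Dx Dy).1.
  by rewrite -/(B _) -BE // E subrr nrm0 mulr_ge0 // ltW.
have surj h : exists x, op_dom A x /\ B x = h.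
  have [||x [v [hcl hort]]] := @projection_closure _ _ _ dotE
     [set p | exists2 y, op_dom A y & p = (B y, 0)] h 0.
  - by exists 0; [exact: lA.1|rewrite /B (op_linear0 lA) scaler0 subr0].
  - move=> r _ _ [y Dy ->] [z Dz ->] /=; have [D E] := lA.2 r%:C _ _ Dz Dy.
    exists (r%:C *: z + y) => //; rewrite /B E scaler0 addr0; congr (_, _).
    by vec dot.
  have cl (e : R) : 0 < e -> exists y, op_dom A y /\ nrm (x - B y) < e.
    by move=> e0; have [_ [_ [[y Dy [-> ->]] xy _]]] := hcl _ e0; exists y.
  have [d [d0 hd]] := @vanishing_sequence R.
  have /choice [y hy] n := cl _ (d0 n).
  (* The lower bound makes the preimages [y n] Cauchy, and closedness of [A] gives [x = B z]: the
     range is closed. *)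
  have [z hz] : exists z, forall e : R, 0 < e -> exists N, forall n, (N <= n)%N -> nrm (y n - z) < e.
    apply: cauchy_nrm_cvg => e e0.
    have e2 : 0 < c * e / 2 by rewrite divr_gt0 ?mulr_gt0.
    have [N hN] := hd _ e2; exists N => n m Nn Nm.
    have [Dn xn] := hy n; have [Dm xm] := hy m.
    rewrite -(ltr_pM2l c0); apply: le_lt_trans (hc _ _) _; first exact: (op_linearB lA Dn Dm).1.
    rewrite -/(B _) -BE //; apply: le_lt_trans (nrm_split x _ _) _; rewrite nrmC.
    by have := hN _ Nn; have := hN _ Nm; lra.
  have [Dz Az] : op_dom A z /\ A z = l *: z - x.
    apply: normal_closed_op => e e0.
    have L0 : 0 < 2 * (1 + cabs l) by have := cabs_ge0 l; lra.
    have e1 : 0 < e / (2 * (1 + cabs l)) by rewrite divr_gt0.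
    have [N1 h1] := hd _ e1; have [N2 h2] := hz _ e1.
    pose n := maxn N1 N2; have [Dn xn] := hy n.
    have {}h1 := h1 n (leq_maxl _ _); have {}h2 := h2 n (leq_maxr _ _).
    have ee : e / (2 * (1 + cabs l)) * (2 * (1 + cabs l)) = e by field; rewrite gt_eqF //; lra.
    have e3 := cabs_ge0 l.
    exists (y n); split=> //; first by rewrite nrmC; nra.
    have -> : l *: z - x - A (y n) = l *: (z - y n) - (x - B (y n)).
      by rewrite /B; vec dot.
    apply: le_lt_trans (nrmB _ _) _; rewrite nrmZ nrmC.
    have : cabs l * nrm (y n - z) <= cabs l * (e / (2 * (1 + cabs l))).
      by rewrite ler_wpM2l // ltW.
    by nra.
  have Bz : B z = x by rewrite /B Az opprB addrC subrK.
  (* As [w] is orthogonal to the range, the adjoint acts on it as [conjc l]; [normal_shift_norm]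
     then gives [B w = 0], so [w = 0] and [h] is in the range. *)
  pose w := x - h.
  have [Dw Ew] : op_dom As w /\ As w = conjc l *: w.
    apply: adjoint_intro => u Du.
    have := hort (B u) 0; rewrite ip0r addr0 => /(_ (ex_intro2 _ _ u Du erefl)).
    rewrite -/w ipC /B ipBl ip_conj; lra.
  have Dw' := adjoint_dom_normal Dw.
  have : nrm (B w) = 0 by rewrite /B -normal_shift_norm // Ew subrr nrm0.
  move=> /nrm0_eq0 Bw; exists z; split=> //.
  have w0 : w = 0.
    apply: (@Binj w 0 Dw' lA.1); rewrite Bw /B (op_linear0 lA).
    by rewrite scaler0 subr0.
  by rewrite Bz; apply/eqP; rewrite -subr_eq0 -/w w0.
have /choice [S hS] := surj.
have [|S' hS'] := @linear_pack _ _ S.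
  move=> a x y; have [Dx Ex] := hS x; have [Dy Ey] := hS y; have [Dxy Exy] := hS (a *: x + y).
  have [D E] := lA.2 a _ _ Dx Dy.
  by apply: Binj => //; rewrite Exy -{1}Ex -{1}Ey /B E; vec dot.
exists S'; split=> [|x|x Dx].
- apply/continuous_linear_bounded_by; exists c^-1; first by rewrite invr_gt0.
  move=> x; have [Dx Ex] := hS x; rewrite hS' -[leLHS]mul1r -(mulVf (lt0r_neq0 c0)) -mulrA.
  by have := hc _ Dx; rewrite -/(B _) Ex; apply: ler_wpM2l; rewrite invr_ge0 ltW.
- by rewrite hS'; have [Dx Ex] := hS x.
- by rewrite hS'; have [D E] := hS (B x); apply: Binj.
Qed.

(** [S'] inverts [conjc l - As]. The difference of the two products is killed by [l - A] followed by
    [conjc l - As]; [normal_shift_norm] replaces the second factor by [l - A], which is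
    injective. *)
Lemma normal_resolvent_comm (l : R[i]) (S S' : {linear H -> H}) :
  (forall x, op_dom A (S x) /\ l *: S x - A (S x) = x) ->
  (forall x, op_dom A x -> S (l *: x - A x) = x) ->
  is_adjoint dot S S' -> forall x, S (S' x) = S' (S x).
Proof.
move=> hS1 hS2 adj x; have lA := normal_linear; have lAs := adjoint_linear.
have hS' z : op_dom As (S' z) /\ As (S' z) = conjc l *: S' z - z.
  apply: adjoint_intro => y Dy.
  have := hS2 y Dy; rewrite linearB linearZ /= => h.
  have -> : ip (A y) (S' z) = ip (l *: S y - y) z.
    rewrite -adj; congr (ip _ z); apply/eqP.
    by rewrite eq_sym subr_eq addrC -subr_eq h.
  by rewrite ipBl ip_conj adj linearZ /= ipBr.
have [Dq Eq] := hS1 (S' x); have [Du Eu] := hS1 x.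
have [Dsq Esq] := hS' x; have [Dsp Esp] := hS' (S x).
set q := S (S' x) in Dq Eq *; set p := S' (S x) in Dsp Esp *; set u := S x in Du Eu Esp.
have Dp := adjoint_dom_normal Dsp.
(* Normality enters here: [p] is in the domain of [A As], hence in that of [As A], and the two
   products agree at [p]. *)
have DAsp : op_dom A (As p).
  by rewrite Esp; apply: (op_linearB lA _ Du).1; apply: (op_linearZ _ lA Dp).1.
have [_ DsAp] := (normal_comm_dom p).2 (conj Dsp DAsp).
have Cp := normal_comm Dp DsAp.
have AAp : A (As p) = conjc l *: A p - A u.
  by rewrite Esp (op_linearB lA (op_linearZ _ lA Dp).1 Du).2 (op_linearZ _ lA Dp).2.
pose w := l *: (p - q) - A (p - q).
have [Dpq Epq] := op_linearB lA Dp Dq.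
have wE : w = l *: p - A p - S' x.
  by rewrite /w Epq -Eq; vec dot.
have [Dlp Elp] := op_linearZ l lAs Dsp.
have [D1 E1] := op_linearB lAs Dlp DsAp.
have [D2 E2] := op_linearB lAs D1 Dsq.
have Dw : op_dom A w by apply: adjoint_dom_normal; rewrite wE.
have nw : nrm (conjc l *: w - As w) = 0.
  have -> : conjc l *: w - As w = l *: u - A u - x.
    rewrite wE E2 E1 Elp Cp AAp Esq Esp; vec dot.
  by rewrite Eu subrr nrm0.
move: nw; rewrite normal_shift_norm // => /nrm0_eq0 Bw0.
have w0 : w = 0 by rewrite -(hS2 _ Dw) Bw0 linear0.
by apply/esym/eqP; rewrite -subr_eq0 -(hS2 _ Dpq) -/w w0 linear0.
Qed.

End NormalOperator.

(** * Joint approximate eigenvectors of commuting operators *)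

Section ApproximateEigenvectors.
Context {R : realType} {H : completeNormedModType R[i]}.
Context {dot : {dot H for (@Num.conj R[i])}}.
Context (dotE : forall x : H, dot x x = `|x| ^+ 2).
Local Notation ip := (@ip R H dot).

Definition seminorm (d : H -> R) :=
  (forall x y, d (x + y) <= d x + d y) /\ (forall a x, d (a *: x) = cabs a * d x).

Lemma seminorm_ge0 d x : seminorm d -> 0 <= d x.
Proof.
move=> [dD dZ]; have := dD x (- x); rewrite subrr -scaleN1r dZ cabsN cabs1.
by have := dZ 0 0; rewrite scale0r cabs0 mul0r => ->; lra.
Qed.

(* [d x] measures the failure of [x] to be a joint eigenvector of the operators
   treated so far; a further symmetric operator commuting with them is added to [d]. *)
Lemma approx_eigenvector_sup (d : H -> R) (S : {linear H -> H}) (C c a : R) :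
  seminorm d -> (forall x, d (S x) <= C * d x) ->
  is_adjoint dot S S -> 0 < c -> bounded_by c S ->
  (forall e h : R, 0 < e -> 0 < h ->
    exists x, [/\ 0 < nrm x, d x <= e * nrm x & (a - h) * nrm x ^+ 2 <= ip (S x) x]) ->
  (forall h : R, 0 < h -> exists2 e : R, 0 < e &
    forall x, d x <= e * nrm x -> ip (S x) x <= (a + h) * nrm x ^+ 2) ->
  forall e : R, 0 < e ->
    exists x, [/\ 0 < nrm x, d x <= e * nrm x & nrm (S x - a%:C *: x) <= e * nrm x].
Proof.
move=> sd dS Ssym c0 Sc h1 h2 e e0; have [dD dZ] := sd.
pose B := c + `|a|; have B0 : 0 < B by rewrite ltr_wpDr.
(* With [t * B = 1 / 2] the norm of the vector [y] below stays between [|x| / 2] and [3 |x| / 2],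
   and the second-order term of its quadratic form is at most [t / 2 * |z|^2] in absolute value. *)
pose t := (2 * B)^-1; have t0 : 0 < t by rewrite invr_gt0 mulr_gt0.
have tB : t * B = 2^-1 by rewrite /t; field; rewrite gt_eqF.
(* This is [2 / 5 * t * e ^+ 2], so that the final [13 / 4 * h] is below [3 / 2 * t * e ^+ 2]. *)
pose h := e ^+ 2 / (5 * B); have h0 : 0 < h by rewrite divr_gt0 ?exprn_gt0 ?mulr_gt0.
have [e1 e10 he1] := h2 _ h0.
(* Since [d y <= L * d x], the smaller tolerance imposed on [x] keeps [y] where the upper bound on
   the quadratic form holds. *)
pose L := 1 + t * (`|C| + `|a|).
have L0 : 0 < L by rewrite ltr_pwDl // mulr_ge0 ?addr_ge0 // ltW.
have e20 : 0 < Num.min e (e1 / (2 * L)) by rewrite lt_min e0 divr_gt0 ?mulr_gt0.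
have [x [nx dx ipx]] := h1 _ _ e20 h0.
have dxe : d x <= e * nrm x.
  by apply: le_trans dx _; rewrite ler_wpM2r ?nrm_ge0 // ge_min lexx.
have dxe1 : L * d x <= e1 * nrm x / 2.
  have -> : e1 * nrm x / 2 = L * (e1 / (2 * L) * nrm x) by field; rewrite gt_eqF.
  rewrite ler_wpM2l ?(ltW L0) //; apply: le_trans dx _.
  by rewrite ler_wpM2r ?nrm_ge0 // ge_min lexx orbT.
exists x; split=> //.
pose T (u : H) := S u - a%:C *: u.
have TB u : nrm (T u) <= B * nrm u.
  apply: le_trans (nrmB _ _) _; rewrite nrmZ cabs_real mulrDl.
  by rewrite lerD2r Sc.
have Tsym u v : ip (T u) v = ip u (T v).
  by rewrite /T ipBl ipBr Ssym ipZl ipZr.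
(* Moving from [x] along [z = (S - a) x] raises the quadratic form of [S - a] by at least
   [3 / 2 * t * |z|^2]. It is at least [- h |x|^2] at [x] and at most [h |y|^2] at [y], so [z] is
   small. *)
have [z zE] : exists z, z = T x by exists (T x).
pose y := x + t%:C *: z.
have nz := TB x; rewrite -zE in nz.
have tz : nrm (t%:C *: z) <= nrm x / 2.
  rewrite nrmZ cabs_real gtr0_norm //.
  have -> : nrm x / 2 = t * (B * nrm x) by rewrite mulrA tB mulrC.
  by rewrite ler_wpM2l // ltW.
have ny1 : nrm x / 2 <= nrm y.
  have : nrm x <= nrm y + nrm (t%:C *: z) by rewrite -{1}(addrK (t%:C *: z) x) nrmB.
  by lra.
have ny2 : nrm y <= 3 / 2 * nrm x by apply: le_trans (nrmD _ _) _; lra.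
have dy : d y <= e1 * nrm y.
  apply: (@le_trans _ _ (L * d x)); last by apply: le_trans dxe1 _; nra.
  have d0 := seminorm_ge0 x sd.
  apply: le_trans (dD _ _) _; rewrite dZ cabs_real gtr0_norm // /L mulrDl mul1r lerD2l -mulrA.
  rewrite ler_wpM2l ?(ltW t0) // zE.
  apply: le_trans (dD _ _) _; rewrite -scaleNr dZ cabsN cabs_real mulrDl lerD2r.
  by apply: le_trans (dS _) _; rewrite ler_wpM2r ?ler_norm.
have ipy := he1 _ dy.
have Tz : - (B * nrm z ^+ 2) <= ip (T z) z.
  have := cauchy_schwarz dotE (T z) z; rewrite ler_norml => /andP[+ _].
  by apply: le_trans; rewrite lerN2 expr2 mulrA ler_wpM2r ?nrm_ge0.
have Tx : - (h * nrm x ^+ 2) <= ip (T x) x.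
  by rewrite /T ipBl ipZl (ip_nrm dotE); lra.
have Ty : ip (T y) y <= h * nrm y ^+ 2.
  by rewrite /T ipBl ipZl (ip_nrm dotE); lra.
have E : ip (T y) y = ip (T x) x + 2 * t * nrm z ^+ 2 + t ^+ 2 * ip (T z) z.
  have -> : T y = T x + t%:C *: T z.
    by rewrite /T /y linearD linearZ /=; vec dot.
  rewrite /y ipDl !ipDr !ipZl !ipZr (Tsym z x) -zE (ip_nrm dotE); ring.
have t2 : t ^+ 2 * B = t / 2 by rewrite expr2 -mulrA tB.
have n2 : nrm y ^+ 2 <= 9 / 4 * nrm x ^+ 2.
  have -> : 9 / 4 * nrm x ^+ 2 = (3 / 2 * nrm x) ^+ 2 by field.
  by rewrite ler_pXn2r ?nnegrE ?nrm_ge0 ?mulr_ge0 ?nrm_ge0.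
have s1 : t ^+ 2 * - (B * nrm z ^+ 2) <= t ^+ 2 * ip (T z) z by rewrite ler_wpM2l ?sqr_ge0.
have s2 : h * nrm y ^+ 2 <= h * (9 / 4 * nrm x ^+ 2) by rewrite ler_wpM2l ?(ltW h0).
have s3 : 3 / 2 * t * nrm z ^+ 2 <= 13 / 4 * h * nrm x ^+ 2.
  have : t ^+ 2 * - (B * nrm z ^+ 2) = - (t / 2 * nrm z ^+ 2) by rewrite -t2; ring.
  by lra.
have s4 : nrm z ^+ 2 <= (e * nrm x) ^+ 2.
  have tp : 0 < 3 / 2 * t by lra.
  rewrite -(ler_pM2l tp); apply: le_trans s3 _; rewrite exprMn.
  have -> : h = t * (2 / 5) * e ^+ 2 by rewrite /h /t; field; rewrite gt_eqF.
  have := mulr_ge0 (mulr_ge0 (ltW t0) (sqr_ge0 e)) (sqr_ge0 (nrm x)); lra.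
rewrite -/(T x) -zE.
have en : 0 <= e * nrm x by rewrite mulr_ge0 // ltW.
by rewrite -(ler_pXn2r (_ : 0 < 2)%N) ?nnegrE ?nrm_ge0.
Qed.

(** [a] is the limit, as [e] tends to [0], of the supremum of the Rayleigh quotient over the vectors
    with [d x <= e |x|]. The first conclusion records that nothing exceeds [a], which later ties [a]
    to the norm of an operator. *)
Lemma approx_eigenvector_exists (d : H -> R) (S : {linear H -> H}) (C c : R) :
  seminorm d -> (forall x, d (S x) <= C * d x) ->
  is_adjoint dot S S -> 0 < c -> bounded_by c S ->
  (forall e : R, 0 < e -> exists x, 0 < nrm x /\ d x <= e * nrm x) ->
  exists a : R,
    (forall h : R, 0 < h -> exists2 e : R, 0 < e &
      forall x, d x <= e * nrm x -> ip (S x) x <= (a + h) * nrm x ^+ 2) /\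
    (forall e : R, 0 < e ->
      exists x, [/\ 0 < nrm x, d x <= e * nrm x & nrm (S x - a%:C *: x) <= e * nrm x]).
Proof.
move=> sd dS Ssym c0 Sc hV.
pose V (e : R) := [set x : H | 0 < nrm x /\ d x <= e * nrm x].
pose q (x : H) := ip (S x) x / nrm x ^+ 2.
have qE x : 0 < nrm x -> ip (S x) x = q x * nrm x ^+ 2.
  by move=> nx; rewrite /q; field; rewrite gt_eqF.
have qc x : 0 < nrm x -> `|q x| <= c.
  move=> nx; rewrite /q normrM normfV (gtr0_norm (exprn_gt0 2 nx)) ler_pdivrMr ?exprn_gt0 //.
  apply: le_trans (cauchy_schwarz dotE _ _) _.
  by rewrite expr2 mulrA ler_wpM2r ?nrm_ge0.
pose m (e : R) := sup (q @` V e).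
have supV e : 0 < e -> has_sup (q @` V e).
  move=> e0; split; first by have [x Vx] := hV _ e0; exists (q x), x.
  by exists c => _ [x [nx _] <-]; apply: le_trans (ler_norm _) (qc _ nx).
have qm e x : 0 < e -> V e x -> q x <= m e.
  by move=> e0 Vx; apply: ub_le_sup; [case: (supV _ e0)|exists x].
pose E := m @` [set e | 0 < e].
have hE : has_inf E.
  split; first by exists (m 1), 1 => //=.
  exists (- c) => _ [e /= e0 <-]; have [x Vx] := hV _ e0.
  apply: le_trans (qm _ _ e0 Vx).
  by have := qc _ Vx.1; rewrite ler_norml => /andP[].
pose a := inf E.
have hU (h : R) : 0 < h -> exists2 e : R, 0 < e &
      forall x, d x <= e * nrm x -> ip (S x) x <= (a + h) * nrm x ^+ 2.
  move=> h0; have [_ [e /= e0 <-] me] := inf_adherent h0 hE.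
  exists e => // x dx; have [->|/eqP x0] := eqVneq x 0.
    by rewrite nrm0 expr0n mulr0 ip0r.
  have nx := nrm_gt0 x0; rewrite qE // ler_wpM2r ?sqr_ge0 //.
  by apply: le_trans (qm _ _ e0 (conj nx dx)) (ltW me).
exists a; split=> //.
apply: (approx_eigenvector_sup sd dS Ssym c0 Sc _ hU) => e h e0 h0.
have [_ [x [nx dx] <-] hx] := sup_adherent h0 (supV _ e0).
exists x; split=> //; rewrite qE // ler_wpM2r ?sqr_ge0 //.
apply: le_trans (ltW hx); rewrite lerD2r.
by apply: ge_inf; [case: hE|exists e].
Qed.

Lemma bounded_byD c c' (f g : H -> H) : bounded_by c f -> bounded_by c' g ->
  bounded_by (c + c') (fun x => f x + g x).
Proof.
by move=> hf hg x; apply: le_trans (nrmD _ _) _; rewrite mulrDl lerD.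
Qed.

(** [S1 = Q + Q'] and [S2 = i (Q - Q')] are symmetric, commute, and satisfy [Q = (S1 - i S2) / 2].
    Once [a] is found for [S1], its defect joins the seminorm and [S2] is treated under that
    constraint. *)
Lemma approx_eigenvector_normal (d : H -> R) (Q Q' : {linear H -> H}) (C : R) :
  continuous Q -> continuous Q' -> is_adjoint dot Q Q' ->
  (forall x, Q (Q' x) = Q' (Q x)) ->
  seminorm d -> (forall x, d (Q x) <= C * d x) -> (forall x, d (Q' x) <= C * d x) ->
  (forall e : R, 0 < e -> exists x, 0 < nrm x /\ d x <= e * nrm x) ->
  exists z : R[i], forall e : R, 0 < e ->
    exists x, [/\ 0 < nrm x, d x <= e * nrm x & nrm (Q x - z *: x) <= e * nrm x].
Proof.
move=> cQ cQ' adj QQ' sd dQ dQ' hV; have [dD dZ] := sd.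
have adj' := is_adjointC adj.
have [c1 c10 Qb] := (continuous_linear_bounded_by Q).1 cQ.
have [c2 c20 Qb'] := (continuous_linear_bounded_by Q').1 cQ'.
have [|S1 S1E] := @linear_pack _ _ (fun x => Q x + Q' x).
  by move=> a x y; rewrite !linearD !linearZ /=; vec dot.
have [|S2 S2E] := @linear_pack _ _ (fun x => 'i *: (Q x - Q' x)).
  by move=> a x y; rewrite !linearD !linearZ /=; vec dot.
have c12 : 0 < c1 + c2 by rewrite addr_gt0.
have S1b : bounded_by (c1 + c2) S1.
  by move=> x; rewrite S1E; apply: (bounded_byD Qb Qb').
have ci : cabs ('i : R[i]) = 1 by rewrite cabs_def /= expr0n expr1n add0r sqrtr1.
have S2b : bounded_by (c1 + c2) S2.
  move=> x; rewrite S2E nrmZ ci mul1r; apply: le_trans (nrmB _ _) _.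
  by rewrite mulrDl lerD.
have S1sym : is_adjoint dot S1 S1.
  by move=> x y; rewrite !S1E ipDl ipDr adj adj' addrC.
have S2sym : is_adjoint dot S2 S2.
  have ni : conjc 'i = - ('i : R[i]) by rewrite /= -[RHS]/(Complex (- 0) (- 1)) oppr0.
  move=> x y; rewrite !S2E ip_conj ni ipBl adj adj' -ipBr; congr (ip x _).
  by rewrite !scaleNr !linearN !linearZ /=; vec dot.
have S12 x : S1 (S2 x) = S2 (S1 x).
  by rewrite !S1E !S2E !linearZ /= !linearB !linearD /= QQ'; vec dot.
have dS1 x : d (S1 x) <= (2 * C) * d x.
  by rewrite S1E; apply: le_trans (dD _ _) _; have := dQ x; have := dQ' x; lra.
have dS2 x : d (S2 x) <= (2 * C) * d x.
  rewrite S2E dZ ci mul1r; apply: le_trans (dD _ _) _.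
  by rewrite -scaleN1r dZ cabsN cabs1 mul1r; have := dQ x; have := dQ' x; lra.
have [a [_ ha]] := approx_eigenvector_exists sd dS1 S1sym c12 S1b hV.
pose d1 (x : H) := d x + nrm (S1 x - a%:C *: x).
have sd1 : seminorm d1.
  split=> [x y|b x].
    have -> : d x + nrm (S1 x - a%:C *: x) + (d y + nrm (S1 y - a%:C *: y)) =
       (d x + d y) + (nrm (S1 x - a%:C *: x) + nrm (S1 y - a%:C *: y)) by ring.
    apply: lerD => //; apply: le_trans (nrmD _ _); rewrite linearD /=.
    by rewrite le_eqVlt; apply/orP; left; apply/eqP; congr nrm; vec dot.
  rewrite /d1 dZ mulrDr -nrmZ; congr (_ + nrm _).
  by rewrite linearZ /=; vec dot.
pose C1 := `|2 * C| + (c1 + c2).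
have d1S2 x : d1 (S2 x) <= C1 * d1 x.
  rewrite /d1 mulrDr; apply: lerD.
    apply: le_trans (dS2 x) _; rewrite ler_wpM2r ?(seminorm_ge0 x sd) //.
    by rewrite /C1; have := ler_norm (2 * C); lra.
  rewrite S12 -linearZ -linearB; apply: le_trans (S2b _) _.
  by rewrite ler_wpM2r ?nrm_ge0 // /C1 lerDr.
have hV1 (e : R) : 0 < e -> exists x, 0 < nrm x /\ d1 x <= e * nrm x.
  move=> e0; have e2 : 0 < e / 2 by lra.
  by have [x [nx dx Sx]] := ha _ e2; exists x; split=> //; rewrite /d1; lra.
have [b [_ hb]] := approx_eigenvector_exists sd1 d1S2 S2sym c12 S2b hV1.
exists (2^-1 *: (a%:C - 'i * b%:C)) => e e0.
have [x [nx dx Sx]] := hb _ e0; exists x.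
have dx0 := seminorm_ge0 x sd; have nS := nrm_ge0 (S1 x - a%:C *: x).
rewrite /d1 in dx; split=> //; first by lra.
have -> : Q x - (2^-1 *: (a%:C - 'i * b%:C)) *: x =
   2^-1%:C *: ((S1 x - a%:C *: x) - 'i *: (S2 x - b%:C *: x)).
  rewrite S1E S2E.
  have i2 : 'i * 'i = -1 :> R[i] by rewrite -expr2 sqr_i.
  have h2 : 2^-1%:C = 2^-1 :> R[i] by rewrite fmorphV rmorph_nat.
  apply: (@dot_inj _ _ dot) => w.
  rewrite !(dotDl, dotNl, dotZl) h2 -[_ *: (_ - _)]/(_ * _).
  move: (dot (Q x) w) (dot (Q' x) w) (dot x w) => q q' u.
  have -> : 2^-1 * (q + q' - a%:C * u - 'i * ('i * (q - q') - b%:C * u))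
     = 2^-1 * (q + q' - a%:C * u - ('i * 'i) * (q - q') + 'i * (b%:C * u)) by ring.
  by rewrite i2; field.
rewrite nrmZ cabs_real gtr0_norm ?invr_gt0 //.
have := nrmB (S1 x - a%:C *: x) ('i *: (S2 x - b%:C *: x)).
by rewrite nrmZ ci mul1r; lra.
Qed.

End ApproximateEigenvectors.

(** * Functional calculus of the resolvent on approximate eigenvectors *)

Section ResolventCalculus.
Context {R : realType} {H : completeNormedModType R[i]}.
Context {dot : {dot H for (@Num.conj R[i])}}.
Context (dotE : forall x : H, dot x x = `|x| ^+ 2).
Local Notation ip := (@ip R H dot).
Context (A : operator H) (A_normal : normal_op dot A).
Context (l0 : R[i]) (Q : {linear H -> H}) (cQ : continuous Q).
Context (hQ1 : forall x, op_dom A (Q x) /\ l0 *: Q x - A (Q x) = x).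
Context (hQ2 : forall x, op_dom A x -> Q (l0 *: x - A x) = x).

(* The spectrum of the resolvent [Q], possibly enlarged by [0]; [z = 1 / (l0 - l)]
   corresponds to [l] in the spectrum of [A], and [z = 0] to infinity. *)
Definition resolvent_values : set R[i] := [set z | z = 0 \/ spectrum A (l0 - z^-1)].
Local Notation K := resolvent_values.

Definition commutes_with (f g : H -> H) := forall x, f (g x) = g (f x).

(* [N] is the operator [f(Q)] of a holomorphic functional calculus. *)
Definition represents (f : R[i] -> R[i]) (N : {linear H -> H}) :=
  [/\ continuous N,
      forall M : {linear H -> H}, continuous M -> commutes_with M Q -> commutes_with M N
    & forall z, K z -> forall e : R, 0 < e -> exists2 d : R, 0 < d &
        forall x, nrm (Q x - z *: x) <= d * nrm x -> nrm (N x - f z *: x) <= e * nrm x].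

Lemma represents_Q : represents id Q.
Proof. by split=> // z _ e e0; exists e. Qed.

Lemma represents_cst a (P : {linear H -> H}) : (forall x, P x = a *: x) ->
  represents (fun=> a) P.
Proof.
move=> hP; split.
- apply/continuous_linear_bounded_by; exists (1 + cabs a); first by have := cabs_ge0 a; lra.
  by move=> x; rewrite hP nrmZ mulrDl mul1r lerDr nrm_ge0.
- by move=> M _ _ x; rewrite !hP linearZ.
- move=> z _ e e0; exists 1 => // x _.
  by rewrite hP subrr nrm0 mulr_ge0 ?nrm_ge0 // ltW.
Qed.

(** The error splits as [N (M x - g x) + g (N x - f x)], each part receiving half of [e];
    [1 + cabs (g z)] avoids division by zero. *)
Lemma represents_comp f g (N M P : {linear H -> H}) :
  represents f N -> represents g M -> (forall x, P x = N (M x)) ->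
  represents (fun z => f z * g z) P.
Proof.
move=> [cN bN aN] [cM bM aM] hP.
have [c1 c10 Nb] := (continuous_linear_bounded_by N).1 cN.
have [c2 c20 Mb] := (continuous_linear_bounded_by M).1 cM.
split.
- apply/continuous_linear_bounded_by; exists (c1 * c2); first by rewrite mulr_gt0.
  move=> x; rewrite hP; apply: le_trans (Nb _) _.
  by rewrite -mulrA ler_wpM2l ?(ltW c10).
- by move=> L cL LQ x; rewrite !hP (bN L cL LQ) (bM L cL LQ).
- move=> z Kz e e0.
  have ge0 := cabs_ge0 (g z).
  have g1 : 0 < 2 * (1 + cabs (g z)) by lra.
  have e1 : 0 < e / (2 * c1) by rewrite divr_gt0 ?mulr_gt0.
  have e2 : 0 < e / (2 * (1 + cabs (g z))) by rewrite divr_gt0.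
  have [d1 d10 h1] := aM z Kz _ e1; have [d2 d20 h2] := aN z Kz _ e2.
  exists (Num.min d1 d2); first by rewrite lt_min d10.
  move=> x hx.
  have {}h1 : nrm (M x - g z *: x) <= e / (2 * c1) * nrm x.
    by apply: h1; apply: le_trans hx _; rewrite ler_wpM2r ?nrm_ge0 // ge_min lexx.
  have {}h2 : nrm (N x - f z *: x) <= e / (2 * (1 + cabs (g z))) * nrm x.
    by apply: h2; apply: le_trans hx _; rewrite ler_wpM2r ?nrm_ge0 // ge_min lexx orbT.
  have -> : P x - (f z * g z) *: x = N (M x - g z *: x) + g z *: (N x - f z *: x).
    by rewrite hP [N (_ - _)]linearB [N (_ *: _)]linearZ /=; vec dot.
  apply: le_trans (nrmD _ _) _; rewrite nrmZ.
  have s1 : nrm (N (M x - g z *: x)) <= e / 2 * nrm x.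
    apply: le_trans (Nb _) _.
    have -> : e / 2 * nrm x = c1 * (e / (2 * c1) * nrm x) by field; rewrite gt_eqF.
    by rewrite ler_wpM2l ?(ltW c10).
  have s2 : cabs (g z) * nrm (N x - f z *: x) <= e / 2 * nrm x.
    apply: (@le_trans _ _ ((1 + cabs (g z)) * (e / (2 * (1 + cabs (g z))) * nrm x))).
      by apply: ler_pM => //; rewrite ?nrm_ge0 ?lerDr.
    rewrite le_eqVlt; apply/orP; left; apply/eqP; field; rewrite gt_eqF //; lra.
  by lra.
Qed.

Lemma represents_lin a f g (N M P : {linear H -> H}) :
  represents f N -> represents g M -> (forall x, P x = a *: N x + M x) ->
  represents (fun z => a * f z + g z) P.
Proof.
move=> [cN bN aN] [cM bM aM] hP.
have [c1 c10 Nb] := (continuous_linear_bounded_by N).1 cN.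
have [c2 c20 Mb] := (continuous_linear_bounded_by M).1 cM.
have a0 := cabs_ge0 a.
split.
- apply/continuous_linear_bounded_by; exists (cabs a * c1 + c2).
    by rewrite ltr_wpDl // mulr_ge0 // ltW.
  move=> x; rewrite hP; apply: le_trans (nrmD _ _) _.
  rewrite mulrDl nrmZ -mulrA; apply: lerD => //.
  by rewrite ler_wpM2l.
- by move=> L cL LQ x; rewrite !hP linearD linearZ /= (bN L cL LQ) (bM L cL LQ).
- move=> z Kz e e0.
  have g1 : 0 < 2 * (1 + cabs a) by lra.
  have e1 : 0 < e / 2 by lra.
  have e2 : 0 < e / (2 * (1 + cabs a)) by rewrite divr_gt0.
  have [d1 d10 h1] := aM z Kz _ e1; have [d2 d20 h2] := aN z Kz _ e2.
  exists (Num.min d1 d2); first by rewrite lt_min d10.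
  move=> x hx.
  have {}h1 : nrm (M x - g z *: x) <= e / 2 * nrm x.
    by apply: h1; apply: le_trans hx _; rewrite ler_wpM2r ?nrm_ge0 // ge_min lexx.
  have {}h2 : nrm (N x - f z *: x) <= e / (2 * (1 + cabs a)) * nrm x.
    by apply: h2; apply: le_trans hx _; rewrite ler_wpM2r ?nrm_ge0 // ge_min lexx orbT.
  have -> : P x - (a * f z + g z) *: x = a *: (N x - f z *: x) + (M x - g z *: x).
    by rewrite hP; vec dot.
  apply: le_trans (nrmD _ _) _; rewrite nrmZ.
  have s2 : cabs a * nrm (N x - f z *: x) <= e / 2 * nrm x.
    apply: (@le_trans _ _ ((1 + cabs a) * (e / (2 * (1 + cabs a)) * nrm x))).
      by apply: ler_pM => //; rewrite ?nrm_ge0 ?lerDr.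
    rewrite le_eqVlt; apply/orP; left; apply/eqP; field; rewrite gt_eqF //; lra.
  by lra.
Qed.

Lemma represents_ext f g (N M : {linear H -> H}) : represents f N ->
  (forall z, K z -> f z = g z) -> (forall x, M x = N x) -> represents g M.
Proof.
move=> [cN bN aN] fg hM; split.
- by have -> : (M : H -> H) = N by apply/funext.
- by move=> L cL LQ x; rewrite !hM bN.
- move=> z Kz e e0; have [d d0 h] := aN z Kz e e0; exists d => // x hx.
  by rewrite -fg // hM h.
Qed.

(** Every [x] of the domain is [Q (l0 x - A x)], so [M x] is again a value of [Q]. *)
Lemma commutes_with_normal (M : {linear H -> H}) : commutes_with M Q ->
  forall x, op_dom A x -> op_dom A (M x) /\ A (M x) = M (A x).
Proof.
move=> MQ x Dx; have [D E] := hQ1 (M (l0 *: x - A x)).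
have Ex : Q (M (l0 *: x - A x)) = M x by rewrite -MQ hQ2.
rewrite Ex in D E; split=> //; move: E.
by rewrite [M (_ - _)]linearB [M (_ *: _)]linearZ /= => /addrI/oppr_inj.
Qed.

(** With [z = 1 / (l0 - l)] this symbol is [1 / (mu - l)]. *)
Lemma represents_resolvent (mu : R[i]) (S : {linear H -> H}) : continuous S ->
  (forall x, op_dom A (S x) /\ mu *: S x - A (S x) = x) ->
  (forall x, op_dom A x -> S (mu *: x - A x) = x) ->
  represents (fun z => z / (1 + (mu - l0) * z)) S.
Proof.
move=> cS hS1 hS2.
have [c c0 Sb] := (continuous_linear_bounded_by S).1 cS.
split=> //.
- move=> M cM MQ x.
  have [Dx Ex] := hS1 x; have [D E] := commutes_with_normal MQ Dx.
  by rewrite -(hS2 _ D) E -linearZ -linearB Ex.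
- move=> z Kz e e0.
  pose b := 1 + (mu - l0) * z.
  (* If the denominator vanished, [l0 - z^-1 = mu] would be in the spectrum, although [S] is a
     resolvent there. *)
  have b0 : b != 0.
    have [z0|z0] := eqVneq z 0; first by rewrite /b z0 mulr0 addr0 oner_neq0.
    case: Kz => [/eqP|Kz]; first by rewrite (negbTE z0).
    apply/eqP => bz; apply: Kz.
    have -> : l0 - z^-1 = mu.
      have : b / z = 0 by rewrite bz mul0r.
      have -> : b / z = z^-1 + (mu - l0) by rewrite /b; field.
      by move=> h; apply/eqP; rewrite -subr_eq0 -oppr_eq0 -h; apply/eqP; ring.
    by exists S.
  pose L := (1 + cabs (mu - l0) * c) / cabs b.
  have cb := cabs_gt0 b0; have m0 := cabs_ge0 (mu - l0).
  have L1 : 0 < 1 + cabs (mu - l0) * c by rewrite ltr_wpDr // mulr_ge0 // ltW.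
  have L0 : 0 < L by rewrite divr_gt0.
  exists (e / L); first by rewrite divr_gt0.
  move=> x hx; pose r := Q x - z *: x.
  have SB u v : S (u - v) = S u - S v by exact: linearB.
  have SZ a u : S (a *: u) = a *: S u by exact: linearZ.
  (* The resolvent identity; it expresses the defect of [S] at [x] through the defect [r] of [Q]. *)
  have Sx : S x = Q x - (mu - l0) *: S (Q x).
    have [D E] := hQ1 x; rewrite -{1}E -{3}(hS2 _ D) -SZ -SB.
    by congr (S _); vec dot.
  have -> : S x - (z / b) *: x = b^-1 *: (r - (mu - l0) *: S r).
    have bS : b *: S x = (Q x - (mu - l0) *: S (Q x)) + ((mu - l0) * z) *: S x.
      by rewrite -Sx /b; vec dot.
    have -> : r - (mu - l0) *: S r = b *: S x - z *: x.
      by rewrite bS /r [S (_ - _)]linearB [S (_ *: _)]linearZ /=; vec dot.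
    by rewrite scalerBr !scalerA mulVf // scale1r mulrC.
  rewrite nrmZ cabsV.
  have : nrm (r - (mu - l0) *: S r) <= (1 + cabs (mu - l0) * c) * nrm r.
    apply: le_trans (nrmB _ _) _; rewrite nrmZ mulrDl mul1r lerD2l -mulrA.
    by rewrite ler_wpM2l.
  move=> h; rewrite mulrC ler_pdivrMr //; apply: le_trans h _.
  have -> : e * nrm x * cabs b = (1 + cabs (mu - l0) * c) * (e / L * nrm x).
    by rewrite /L; field; rewrite !gt_eqF.
  by rewrite ler_wpM2l ?(ltW L1).
Qed.

(** If [x] is almost an eigenvector of [Q] at [z <> 0], then [Q x], of norm close to [|z| |x|], is
    almost one of [A] at [l0 - z^-1], which excludes a bounded inverse. *)
Lemma resolvent_values_approx z :
  (forall e : R, 0 < e -> exists x, 0 < nrm x /\ nrm (Q x - z *: x) <= e * nrm x) -> K z.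
Proof.
move=> h; have [z0|z0] := eqVneq z 0; [by left|right] => -[S [cS hS1 hS2]].
have [c c0 Sb] := (continuous_linear_bounded_by S).1 cS.
have zc := cabs_gt0 z0.
pose L := 1 + c / cabs z; have L0 : 0 < L by rewrite ltr_wpDr // divr_ge0 // ltW.
pose e := cabs z / (2 * L); have e0 : 0 < e by rewrite divr_gt0 ?mulr_gt0.
have [x [nx hx]] := h _ e0.
have [D E] := hQ1 x; have E2 := hS2 _ D.
have F : (l0 - z^-1) *: Q x - A (Q x) = - z^-1 *: (Q x - z *: x).
  have -> : (l0 - z^-1) *: Q x - A (Q x) = (l0 *: Q x - A (Q x)) - z^-1 *: Q x by vec dot.
  rewrite E scaleNr scalerBr scalerA mulVf // scale1r opprB //.
have s1 : nrm (Q x) <= c / cabs z * (e * nrm x).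
  rewrite -E2 F; apply: le_trans (Sb _) _.
  rewrite nrmZ cabsN cabsV -mulrA ler_wpM2l ?(ltW c0) //.
  by rewrite ler_wpM2l ?invr_ge0 ?cabs_ge0.
have s2 : cabs z * nrm x <= nrm (Q x) + e * nrm x.
  rewrite -nrmZ; apply: (@le_trans _ _ (nrm (Q x) + nrm (Q x - z *: x))); last by rewrite lerD2l.
  by have := nrmB (Q x) (Q x - z *: x); rewrite opprB addrCA subrr addr0.
have : cabs z * nrm x <= L * e * nrm x by rewrite /L; lra.
rewrite ler_pM2r //; have -> : L * e = cabs z / 2 by rewrite /e; field; rewrite gt_eqF.
by lra.
Qed.

(** The adjoint of [Q] commutes with [Q], so the second clause of [represents] makes it commute with
    [N]; the relations for [N'] are the adjoint ones. *)
Lemma represents_adjoint_commutes f (N N' Q' : {linear H -> H}) :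
  represents f N -> continuous Q' -> is_adjoint dot Q Q' -> is_adjoint dot N N' ->
  [/\ commutes_with Q N, commutes_with Q' N, commutes_with Q N' & commutes_with Q' N'].
Proof.
move=> [cN bN aN] cQ' adjQ adjN.
have adjQ' := is_adjointC adjQ; have adjN' := is_adjointC adjN.
have QQ' : commutes_with Q Q' := normal_resolvent_comm dotE A_normal hQ1 hQ2 adjQ.
have NQ : commutes_with Q N by apply: bN.
have NQ' : commutes_with Q' N by apply: bN => // x; rewrite QQ'.
by split=> // x; apply: (ip_inj dotE) => y; [rewrite !(adjQ, adjN') NQ'|rewrite !(adjQ', adjN') NQ].
Qed.

Theorem represents_norm_le f (N : {linear H -> H}) (c : R) : represents f N -> 0 <= c ->
  (forall z, K z -> cabs (f z) <= c) -> bounded_by c N.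
Proof.
move=> repN; have [cN bN aN] := repN => c0 fc x0; rewrite leNgt; apply/negP => hx0.
have [Q' [cQ' adjQ]] := adjoint_exists dotE cQ.
have QQ' : commutes_with Q Q' := normal_resolvent_comm dotE A_normal hQ1 hQ2 adjQ.
have [N' [cN' adjN]] := adjoint_exists dotE cN.
have adjN' := is_adjointC adjN.
have [NQ NQ' N'Q N'Q'] := represents_adjoint_commutes repN cQ' adjQ adjN.
have [c1 c10 Nb] := (continuous_linear_bounded_by N).1 cN.
have [c2 c20 Nb'] := (continuous_linear_bounded_by N').1 cN'.
have [|P PE] := @linear_pack _ _ (fun x => N' (N x)).
  by move=> a x y; rewrite !linearD !linearZ.
have Psym : is_adjoint dot P P.
  by move=> x y; rewrite !PE adjN' adjN.
have Pb : bounded_by (c2 * c1) P.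
  move=> x; rewrite PE; apply: le_trans (Nb' _) _.
  by rewrite -mulrA ler_wpM2l ?(ltW c20).
have PN x : ip (P x) x = nrm (N x) ^+ 2.
  by rewrite PE adjN' (ip_nrm dotE).
have nx0 : 0 < nrm x0.
  apply: nrm_gt0 => x00; move: hx0; rewrite x00 linear0 nrm0 mulr0 ltxx //.
(* Under the zero seminorm every vector is admissible, so [a] is the top of the numerical range of
   [N' N]. *)
have sd0 : seminorm (fun _ : H => 0 : R) by split=> *; rewrite ?addr0 ?mulr0.
have [||a [ha1 ha2]] := @approx_eigenvector_exists _ _ _ dotE (fun=> 0) P 0 (c2 * c1) sd0 _ Psym (mulr_gt0 c20 c10) Pb.
- by move=> x; rewrite mul0r.
- by move=> e e0; exists x0; split=> //; rewrite mulr_ge0 // ltW.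
have ac : c ^+ 2 < a.
  rewrite ltNge; apply/negP => ac.
  have : nrm (N x0) ^+ 2 <= (c * nrm x0) ^+ 2.
    rewrite -PN; apply/ler_addgt0Pr => h h0.
    have h'0 : 0 < h / nrm x0 ^+ 2 by rewrite divr_gt0 ?exprn_gt0.
    have [e e0 /(_ x0)] := ha1 _ h'0.
    rewrite mulr_ge0 ?(ltW e0) ?nrm_ge0 // => /(_ isT) hh; apply: le_trans hh _.
    have -> : (a + h / nrm x0 ^+ 2) * nrm x0 ^+ 2 = a * nrm x0 ^+ 2 + h by field; rewrite gt_eqF.
    by rewrite lerD2r exprMn ler_wpM2r ?sqr_ge0.
  rewrite ler_pXn2r ?nnegrE ?nrm_ge0 ?mulr_ge0 ?nrm_ge0 //.
  by rewrite leNgt hx0.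
pose d x := nrm (P x - a%:C *: x).
have sd : seminorm d.
  split=> [x y|b x].
    rewrite /d; apply: le_trans (nrmD _ _); rewrite linearD /=.
    by rewrite le_eqVlt; apply/orP; left; apply/eqP; congr nrm; vec dot.
  by rewrite /d -nrmZ; congr nrm; rewrite linearZ /=; vec dot.
have [c3 c30 Qb] := (continuous_linear_bounded_by Q).1 cQ.
have [c4 c40 Qb'] := (continuous_linear_bounded_by Q').1 cQ'.
have dQ x : d (Q x) <= (c3 + c4) * d x.
  rewrite /d; have -> : P (Q x) - a%:C *: Q x = Q (P x - a%:C *: x).
    by rewrite [Q (_ - _)]linearB [Q (_ *: _)]linearZ /= !PE N'Q NQ.
  by apply: le_trans (Qb _) _; rewrite ler_wpM2r ?nrm_ge0 // lerDl ltW.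
have dQ' x : d (Q' x) <= (c3 + c4) * d x.
  rewrite /d; have -> : P (Q' x) - a%:C *: Q' x = Q' (P x - a%:C *: x).
    by rewrite [Q' (_ - _)]linearB [Q' (_ *: _)]linearZ /= !PE N'Q' NQ'.
  by apply: le_trans (Qb' _) _; rewrite ler_wpM2r ?nrm_ge0 // lerDr ltW.
have hV (e : R) : 0 < e -> exists x, 0 < nrm x /\ d x <= e * nrm x.
  by move=> /ha2 [x [nx _ hx]]; exists x.
(* On these joint approximate eigenvectors [|N x|^2] is close to [a |x|^2], and also to
   [|f z|^2 |x|^2], which is at most [c ^+ 2 * |x|^2]. *)
have [z hz] := approx_eigenvector_normal dotE cQ cQ' adjQ QQ' sd dQ dQ' hV.
have Kz : K z.
  by apply: resolvent_values_approx => e /hz [x [nx _ hx]]; exists x.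
pose g := a - c ^+ 2; have g0 : 0 < g by rewrite subr_gt0.
(* The estimates end in [a - e <= (c + e) ^+ 2]; as [e <= 1], this gives
   [g <= e * (2 + 2 * c) <= g / 2], which is absurd. *)
pose e := Num.min 1 (g / (2 * (2 + 2 * c))).
have c22 : 0 < 2 * (2 + 2 * c) by lra.
have e0 : 0 < e by rewrite lt_min ltr01 divr_gt0.
have [d1 d10 hd1] := aN z Kz e e0.
have me : 0 < Num.min e d1 by rewrite lt_min e0.
have [x [nx dx Qx]] := hz _ me.
have {}Qx : nrm (N x - f z *: x) <= e * nrm x.
  by apply: hd1; apply: le_trans Qx _; rewrite ler_wpM2r ?nrm_ge0 // ge_min lexx orbT.
have {}dx : nrm (P x - a%:C *: x) <= e * nrm x.
  by apply: le_trans dx _; rewrite ler_wpM2r ?nrm_ge0 // ge_min lexx.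
have s1 : nrm (N x) <= (c + e) * nrm x.
  rewrite -(subrK (f z *: x) (N x)); apply: le_trans (nrmD _ _) _.
  rewrite nrmZ mulrDl addrC lerD // ler_wpM2r ?nrm_ge0 //; exact: fc.
have s2 : (a - e) * nrm x ^+ 2 <= nrm (N x) ^+ 2.
  have := cauchy_schwarz dotE (P x - a%:C *: x) x; rewrite ler_norml => /andP[+ _].
  rewrite ipBl ipZl (ip_nrm dotE) PN.
  have : nrm (P x - a%:C *: x) * nrm x <= e * nrm x * nrm x by rewrite ler_wpM2r ?nrm_ge0.
  by rewrite -mulrA -expr2; lra.
have s3 : nrm (N x) ^+ 2 <= (c + e) ^+ 2 * nrm x ^+ 2.
  rewrite -exprMn ler_pXn2r ?nnegrE ?nrm_ge0 ?mulr_ge0 ?nrm_ge0 ?addr_ge0 //; exact: ltW.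
have s4 : a - e <= (c + e) ^+ 2.
  by rewrite -(ler_pM2r (exprn_gt0 2 nx)); apply: le_trans s3.
have e1 : e <= 1 by rewrite ge_min lexx.
have e2 : e * (2 * (2 + 2 * c)) <= g by rewrite -ler_pdivlMr // ge_min lexx orbT.
have ee : e ^+ 2 <= e by rewrite expr2 -[leRHS]mulr1 ler_wpM2l ?(ltW e0).
by rewrite /g in e2; nra.
Qed.

Lemma represents_pow f (N : {linear H -> H}) n : represents f N ->
  exists P, represents (fun z => f z ^+ n) P.
Proof.
move=> fN; elim: n => [|n [P fP]].
  have [|P PE] := @linear_pack _ _ (fun x : H => 1 *: x).
    by move=> a x y; rewrite !scale1r.
  by exists P; apply: (represents_ext (represents_cst PE)).
have [|P' PE] := @linear_pack _ _ (fun x => N (P x)).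
  by move=> a x y; rewrite !linearD !linearZ.
by exists P'; apply: (represents_ext (represents_comp fN fP PE)) => // z _; rewrite exprS.
Qed.

(** [represents_norm_le], applied to differences, makes the operators Cauchy in norm. Uniformity in
    [x] is what carries the approximate-eigenvector clause to the limit. *)
Lemma represents_limit (f : nat -> R[i] -> R[i]) (F : R[i] -> R[i]) :
  (forall n, exists N, represents (f n) N) ->
  (forall e : R, 0 < e -> exists n0, forall n, (n0 <= n)%N ->
     forall z, K z -> cabs (f n z - F z) <= e) ->
  exists P, represents F P.
Proof.
move=> /choice [N fN] hF.
have diff (e : R) : 0 < e -> exists n0, forall n m, (n0 <= n)%N -> (n0 <= m)%N ->
    forall x, nrm (N n x - N m x) <= e * nrm x.
  move=> e0; have e2 : 0 < e / 2 by lra.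
  have [n0 hn0] := hF _ e2; exists n0 => n m hn hm x.
  have [|D DE] := @linear_pack _ _ (fun x => -1 *: N m x + N n x).
    by move=> a u v; rewrite !linearD !linearZ /=; vec dot.
  have -> : N n x - N m x = D x by rewrite DE scaleN1r addrC.
  apply: (represents_norm_le (represents_lin (fN m) (fN n) DE) (ltW e0)) => z Kz.
  have -> : -1 * f m z + f n z = (f n z - F z) - (f m z - F z) by ring.
  apply: le_trans (cabsB _ _) _.
  by have := hn0 n hn z Kz; have := hn0 m hm z Kz; lra.
have /choice [p hp] x : exists l, forall e : R, 0 < e -> exists n0, forall n, (n0 <= n)%N -> nrm (N n x - l) < e.
  apply: cauchy_nrm_cvg => e e0.
  have x1 : 0 < 1 + nrm x by have := nrm_ge0 x; lra.
  have [n0 hn0] := diff _ (divr_gt0 e0 x1); exists n0 => n m hn hm.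
  apply: le_lt_trans (hn0 n m hn hm x) _.
  rewrite mulrAC ltr_pdivrMr // ltr_pM2l //; lra.
have pclose (e : R) : 0 < e -> exists n0, forall n, (n0 <= n)%N ->
    forall x, nrm (N n x - p x) <= e * nrm x.
  move=> e0; have [n0 hn0] := diff _ e0; exists n0 => n hn x.
  apply/ler_addgt0Pr => e' e'0; have [n1 hn1] := hp x _ e'0.
  apply: le_trans (nrm_split (N (maxn n0 n1) x) _ _) _.
  by apply: lerD; [apply: hn0; rewrite ?leq_maxl|apply/ltW/hn1/leq_maxr].
have [|P PE] := @linear_pack _ _ p.
  move=> a x y; apply: nrm_small_eq => e e0.
  have a0 := cabs_ge0 a.
  pose S := nrm (a *: x + y) + cabs a * nrm x + nrm y + 1.
  have S0 : 0 < S by rewrite ltr_wpDl // !addr_ge0 ?mulr_ge0 ?nrm_ge0.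
  have [n0 hn0] := pclose _ (divr_gt0 e0 S0).
  have h := hn0 n0 (leqnn _).
  have -> : p (a *: x + y) - (a *: p x + p y) =
     - (N n0 (a *: x + y) - p (a *: x + y)) + (a *: (N n0 x - p x) + (N n0 y - p y)).
    by rewrite [N n0 (a *: x + y)]linearD [N n0 (a *: x)]linearZ /=; vec dot.
  apply: le_trans (nrmD _ _) _; rewrite nrmN.
  apply: le_trans (lerD (h _) (nrmD _ _)) _; rewrite nrmZ.
  have h1 : cabs a * nrm (N n0 x - p x) <= e / S * (cabs a * nrm x).
    by rewrite mulrCA ler_wpM2l.
  have h2 := h y.
  have E : e = e / S * (nrm (a *: x + y) + cabs a * nrm x + nrm y + 1).
    by rewrite -/S; field; rewrite gt_eqF.
  by have := divr_gt0 e0 S0; lra.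
have Pclose (e : R) : 0 < e -> exists n, (forall x, nrm (N n x - P x) <= e * nrm x) /\
    (forall z, K z -> cabs (f n z - F z) <= e).
  move=> e0; have [n0 hn0] := pclose _ e0; have [n1 hn1] := hF _ e0.
  exists (maxn n0 n1); split=> [x|]; last by apply: hn1; rewrite leq_maxr.
  by rewrite PE; apply: hn0; rewrite leq_maxl.
exists P; split.
- have [n [hn _]] := Pclose _ ltr01; have [cN _ _] := fN n.
  have [c c0 Nb] := (continuous_linear_bounded_by (N n)).1 cN.
  apply/continuous_linear_bounded_by; exists (1 + c); first by rewrite addr_gt0.
  move=> x; have -> : P x = - (N n x - P x) + N n x by rewrite opprB subrK.
  by apply: le_trans (nrmD _ _) _; rewrite nrmN mulrDl lerD.
- move=> M cM MQ x; apply: nrm_small_eq => e e0.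
  have [c c0 Mb] := (continuous_linear_bounded_by M).1 cM.
  pose S := c * nrm x + nrm (M x) + 1.
  have S0 : 0 < S by rewrite ltr_wpDl // addr_ge0 ?mulr_ge0 ?nrm_ge0 ?(ltW c0).
  have [n [hn _]] := Pclose _ (divr_gt0 e0 S0); have [_ bN _] := fN n.
  have -> : M (P x) - P (M x) = - M (N n x - P x) + (N n (M x) - P (M x)).
    by rewrite [M (_ - _)]linearB /= (bN M cM MQ); vec dot.
  apply: le_trans (nrmD _ _) _; rewrite nrmN.
  have h1 : nrm (M (N n x - P x)) <= e / S * (c * nrm x).
    by apply: le_trans (Mb _) _; rewrite mulrCA ler_wpM2l ?(ltW c0).
  have h2 := hn (M x).
  have : e = e / S * (c * nrm x + nrm (M x) + 1) by rewrite -/S; field; rewrite gt_eqF.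
  by have := divr_gt0 e0 S0; lra.
- move=> z Kz e e0; have e3 : 0 < e / 3 by lra.
  have [n [hn fn]] := Pclose _ e3; have [_ _ aN] := fN n.
  have [d d0 hd] := aN z Kz _ e3; exists d => // x /hd hx.
  have -> : P x - F z *: x = - (N n x - P x) + (N n x - f n z *: x) + (f n z - F z) *: x by vec dot.
  apply: le_trans (nrmD _ _) _; rewrite nrmZ.
  have h1 := nrmD (- (N n x - P x)) (N n x - f n z *: x).
  rewrite nrmN in h1; have h2 := hn x.
  have : cabs (f n z - F z) * nrm x <= e / 3 * nrm x by rewrite ler_wpM2r ?nrm_ge0 ?fn.
  by lra.
Qed.

End ResolventCalculus.

(** * The complex exponential and its Euler approximations *)

Section ComplexExponential.
Context {R : realType}.
Implicit Types z w u v : R[i].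

Lemma is_derive_small (f : R -> R) (l : R) : is_derive (0 : R) (1 : R) f l ->
  forall e : R, 0 < e -> exists2 d : R, 0 < d &
    forall h : R, `|h| <= d -> `|f h - f 0 - l * h| <= e * `|h|.
Proof.
move=> [df fl] e e0.
have : h^-1 *: ((f \o shift 0) (h *: (1 : R)) - f 0) @[h --> (0 : R)^'] --> l.
  by rewrite -fl; exact: df.
move=> /cvgrPdist_le /(_ e e0) /nbhs_ballP [d /= d0 hd].
exists (d / 2); first by rewrite divr_gt0.
move=> h hh; have [->|h0] := eqVneq h 0; first by rewrite subrr mulr0 subr0 normr0 mulr0.
have : `|l - h^-1 * (f h - f 0)| <= e.
  have := hd h; rewrite /= addr0 [_%:A]mulr1; apply => //.
  by rewrite /ball /= sub0r normrN; apply: le_lt_trans hh _; lra.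
move=> he; have -> : f h - f 0 - l * h = - ((l - h^-1 * (f h - f 0)) * h) by field.
by rewrite normrN normrM ler_wpM2r.
Qed.

Definition cexp z : R[i] :=
  (expR (complex.Re z) * cos (complex.Im z)) +i* (expR (complex.Re z) * sin (complex.Im z)).

Lemma cexp0 : cexp 0 = 1.
Proof. by rewrite /cexp /= expR0 cos0 sin0 mulr1 mulr0. Qed.

Lemma cexpD z w : cexp (z + w) = cexp z * cexp w.
Proof.
case: z w => a b [c d]; apply/eqP.
rewrite eq_complex /= expRD cosD sinD; apply/andP; split; apply/eqP; ring.
Qed.

Lemma cexpX z n : cexp (n%:R * z) = cexp z ^+ n.
Proof.
by elim: n => [|n IH]; rewrite ?mul0r ?cexp0 // -natr1 mulrDl mul1r cexpD IH exprSr.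
Qed.

Lemma cabs_cexp z : cabs (cexp z) = expR (complex.Re z).
Proof.
rewrite cabs_def /= !exprMn -mulrDr cos2Dsin2 mulr1 sqrtr_sqr gtr0_norm //.
exact: expR_gt0.
Qed.

Lemma cexp_taylor1 (e : R) : 0 < e -> exists2 d : R, 0 < d &
  forall z, cabs z <= d -> cabs (cexp z - 1 - z) <= e * cabs z.
Proof.
(* The real and imaginary parts will cost [3 * e1] and [5 * e1] times [cabs z]. *)
move=> e0; pose e1 := Num.min 1 (e / 10).
have e10 : 0 < e1 by rewrite lt_min ltr01 divr_gt0.
have e11 : e1 <= 1 by rewrite ge_min lexx.
have e1e : e1 <= e / 10 by rewrite ge_min lexx orbT.
have [d1 d10 h1] := is_derive_small (is_derive_expR 0) e10.
have [d2 d20 h2] := is_derive_small (is_derive_sin 0) e10.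
have [d3 d30 h3] := is_derive_small (is_derive_cos 0) e10.
exists (Num.min e1 (Num.min d1 (Num.min d2 d3))); first by rewrite lt_min e10 lt_min d10 lt_min d20.
move=> [x y]; rewrite !le_min => /andP[z1 /andP[z2 /andP[z3 z4]]].
have {}z1 : cabs (x +i* y) <= e1 by rewrite le_min.
have := ler_Re_cabs (x +i* y); have := ler_Im_cabs (x +i* y).
move: (cabs (x +i* y)) z1 z2 z3 z4 => r z1 z2 z3 z4 /= yr xr.
have {}h1 : `|expR x - 1 - x| <= e1 * `|x|.
  by have := h1 x (le_trans xr z2); rewrite expR0 mul1r.
have {}h2 : `|sin y - y| <= e1 * `|y|.
  by have := h2 y (le_trans yr z3); rewrite sin0 cos0 mul1r subr0.
have {}h3 : `|cos y - 1| <= e1 * `|y|.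
  by have := h3 y (le_trans yr z4); rewrite cos0 sin0 oppr0 mul0r subr0.
have x0 := normr_ge0 x; have y0 := normr_ge0 y.
have r0 : 0 <= r by lra.
have g1 : `|expR x - 1 - x| <= e1 * r by apply: le_trans h1 _; rewrite ler_wpM2l ?(ltW e10).
have g2 : `|sin y - y| <= e1 * r by apply: le_trans h2 _; rewrite ler_wpM2l ?(ltW e10).
have g3 : `|cos y - 1| <= e1 * r by apply: le_trans h3 _; rewrite ler_wpM2l ?(ltW e10).
have c1 : `|cos y| <= 1 by rewrite ler_norml cos_geN1 cos_le1.
have er : e1 * r <= r by rewrite ler_piMl.
have ex1 : `|expR x - 1| <= 2 * r.
  have -> : expR x - 1 = (expR x - 1 - x) + x by ring.
  by apply: le_trans (ler_normD _ _) _; lra.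
have ex : `|expR x| <= 3.
  have -> : expR x = (expR x - 1) + 1 by ring.
  by apply: le_trans (ler_normD _ _) _; rewrite normr1; lra.
apply: le_trans (cabs_le_ReIm _) _ => /=.
have s1 : `|expR x * cos y - 1 - x| <= 3 * (e1 * r).
  have -> : expR x * cos y - 1 - x = (expR x - 1 - x) * cos y + (1 + x) * (cos y - 1) by ring.
  apply: le_trans (ler_normD _ _) _; rewrite !normrM.
  have : `|expR x - 1 - x| * `|cos y| <= e1 * r * 1 by apply: ler_pM.
  have : `|1 + x| * `|cos y - 1| <= 2 * (e1 * r).
    by apply: ler_pM => //; apply: le_trans (ler_normD _ _) _; rewrite normr1; lra.
  by lra.
have s2 : `|expR x * sin y - 0 - y| <= 5 * (e1 * r).
  have -> : expR x * sin y - 0 - y = expR x * (sin y - y) + (expR x - 1) * y by ring.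
  apply: le_trans (ler_normD _ _) _; rewrite !normrM.
  have : `|expR x| * `|sin y - y| <= 3 * (e1 * r) by apply: ler_pM.
  have : `|expR x - 1| * `|y| <= 2 * r * e1 by apply: ler_pM => //; rewrite (le_trans yr).
  by lra.
have : e1 * r <= e / 10 * r by rewrite ler_wpM2r.
by have := mulr_ge0 (ltW e0) r0; lra.
Qed.

Lemma cabs_natr n : cabs (n%:R : R[i]) = n%:R.
Proof. by rewrite -(rmorph_nat (real_complex R)) cabs_real ger0_norm. Qed.

Lemma natr_large (r : R) : exists n, (0 < n)%N /\ r <= n%:R.
Proof.
exists (Num.truncn r).+1; split=> //; exact: ltW (truncnS_gt r).
Qed.

Lemma cabs_subX1 u (E : R) n : (forall k, (k < n)%N -> cabs (u ^+ k) <= E) ->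
  cabs (u ^+ n - 1) <= n%:R * (E * cabs (u - 1)).
Proof.
elim: n => [_|n IH hE]; first by rewrite subrr cabs0 mul0r.
have -> : u ^+ n.+1 - 1 = u ^+ n * (u - 1) + (u ^+ n - 1) by rewrite exprSr; ring.
apply: le_trans (cabsD _ _) _.
rewrite -natr1 mulrDl mul1r addrC; apply: lerD.
  by apply: IH => k kn; apply: hE; rewrite ltnS ltnW.
by rewrite cabsM ler_wpM2r ?cabs_ge0 // hE.
Qed.

(** * Taylor bounds uniform on a half-plane *)

Section HalfPlane.
Context (b : R) (b0 : 0 <= b).

Let root_pow w n k : (k < n)%N -> complex.Re w <= b ->
  cabs (cexp (n%:R^-1 * w) ^+ k) <= expR b.
Proof.
move=> kn wb; have n0 : 0 < n%:R :> R by rewrite ltr0n (leq_ltn_trans _ kn).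
rewrite -cexpX cabs_cexp ler_expR.
have -> : complex.Re (k%:R * (n%:R^-1 * w)) = k%:R / n%:R * complex.Re w.
  rewrite mulrA -!(rmorph_nat (real_complex R)) -fmorphV -rmorphM.
  by case: w {wb} => x y /=; rewrite mul0r subr0.
have k1 : k%:R / n%:R <= 1 :> R by rewrite ler_pdivrMr // mul1r ler_nat ltnW.
have k0 : 0 <= k%:R / n%:R :> R by rewrite divr_ge0.
have [w0|w0] := leP 0 (complex.Re w).
  by apply: le_trans wb; rewrite ler_piMl.
by apply: le_trans b0; rewrite mulr_ge0_le0 // ltW.
Qed.

Let root_small w (e : R) : 0 < e -> exists n, [/\ (0 < n)%N,
  cexp w = cexp (n%:R^-1 * w) ^+ n &
  cabs (cexp (n%:R^-1 * w) - 1 - n%:R^-1 * w) <= e * (n%:R^-1 * cabs w)].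
Proof.
move=> e0; have [d d0 hd] := cexp_taylor1 e0.
have [n [n0 hn]] := natr_large (cabs w / d).
have n0' : 0 < n%:R :> R by rewrite ltr0n.
have En : cabs (n%:R^-1 * w) = n%:R^-1 * cabs w by rewrite cabsM cabsV cabs_natr.
exists n; split=> //.
  rewrite -cexpX mulrA mulfV ?mul1r // pnatr_eq0 -lt0n //.
rewrite -En; apply: hd; rewrite En mulrC ler_pdivrMr // mulrC -ler_pdivrMr //.
Qed.

(** [exp w] is the [n]-th power of [u = exp (w / n)]. For large [n], [u - 1] is close to [w / n],
    and the powers [u ^+ k] with [k < n] are at most [exp b], so telescoping [u ^+ n - 1] gives the
    bound. *)
Lemma cexp_sub1_le w : complex.Re w <= b -> cabs (cexp w - 1) <= 2 * expR b * cabs w.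
Proof.
move=> wb; have [n [n0 -> hn]] := root_small w ltr01.
have n0' : 0 < n%:R :> R by rewrite ltr0n.
apply: le_trans (cabs_subX1 (fun k kn => root_pow kn wb)) _.
have E0 := expR_ge0 b.
have : cabs (cexp (n%:R^-1 * w) - 1) <= 2 * (n%:R^-1 * cabs w).
  rewrite -(subrK (n%:R^-1 * w) (cexp _ - 1)); apply: le_trans (cabsD _ _) _.
  by rewrite cabsM cabsV cabs_natr; lra.
move=> h; have -> : 2 * expR b * cabs w = n%:R * (expR b * (2 * (n%:R^-1 * cabs w))).
  by field; rewrite gt_eqF.
by rewrite ler_wpM2l ?(ltW n0') // ler_wpM2l.
Qed.

(** The same subdivision one order further; the first-order errors of the [n] steps add up to at
    most the arbitrary [e]. *)
Lemma cexp_taylor2 w : complex.Re w <= b ->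
  cabs (cexp w - 1 - w) <= 2 * expR b * cabs w ^+ 2.
Proof.
move=> wb; apply/ler_addgt0Pr => e e0.
have E0 := expR_gt0 b; have w0 := cabs_ge0 w.
pose e1 := Num.min 1 (e / (expR b * (1 + cabs w))).
have e10 : 0 < e1 by rewrite lt_min ltr01 divr_gt0 // mulr_gt0 // ltr_pwDl.
have [n [n0 -> hn]] := root_small w e10.
have n0' : 0 < n%:R :> R by rewrite ltr0n.
pose u := cexp (n%:R^-1 * w); pose v := n%:R^-1 * w.
have vE : cabs v = n%:R^-1 * cabs w by rewrite /v cabsM cabsV cabs_natr.
rewrite -/u -/v -vE in hn *.
have u1 : cabs (u - 1) <= 2 * cabs v.
  rewrite -(subrK v (u - 1)); apply: le_trans (cabsD _ _) _.
  have : e1 * cabs v <= 1 * cabs v by rewrite ler_wpM2r ?cabs_ge0 // ge_min lexx.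
  by lra.
have uk k : (k < n)%N -> cabs (u ^+ k) <= expR b by move=> kn; apply: root_pow.
have step k : (k <= n)%N -> cabs (u ^+ k - 1 - k%:R * v) <=
    k%:R * (expR b * (e1 * cabs v) + n%:R * expR b * (2 * cabs v) * cabs v).
  elim: k => [_|k IH kn]; first by rewrite expr0 subrr !mul0r subr0 cabs0.
  have -> : u ^+ k.+1 - 1 - k.+1%:R * v =
     u ^+ k * (u - 1 - v) + (u ^+ k - 1) * v + (u ^+ k - 1 - k%:R * v).
    by rewrite exprSr -natr1; ring.
  apply: le_trans (cabsD _ _) _; rewrite -[k.+1%:R in leRHS]natr1 [leRHS]mulrDl mul1r [leRHS]addrC.
  apply: lerD; last exact: IH (ltnW kn).
  apply: le_trans (cabsD _ _) _; rewrite (cabsM (u ^+ k)) (cabsM (u ^+ k - 1)); apply: lerD.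
    exact: (ler_pM (cabs_ge0 _) (cabs_ge0 _) (uk _ kn) hn).
  rewrite ler_wpM2r ?cabs_ge0 //.
  apply: le_trans (cabs_subX1 (fun j jk => uk j (ltn_trans jk kn))) _.
  have k1 : k%:R <= n%:R :> R by rewrite ler_nat ltnW.
  rewrite -mulrA; apply: ler_pM => //; first by rewrite mulr_ge0 ?cabs_ge0 ?(ltW E0).
  by rewrite ler_wpM2l ?(ltW E0).
have := step n (leqnn n).
have -> : n%:R * v = w by rewrite /v mulrA mulfV ?mul1r // pnatr_eq0 -lt0n.
move=> h; apply: le_trans h _; rewrite vE.
have -> : n%:R * (expR b * (e1 * (n%:R^-1 * cabs w)) +
   n%:R * expR b * (2 * (n%:R^-1 * cabs w)) * (n%:R^-1 * cabs w)) =
   expR b * e1 * cabs w + 2 * expR b * cabs w ^+ 2 by field; rewrite gt_eqF.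
rewrite addrC lerD2l.
have h1 : e1 <= e / (expR b * (1 + cabs w)) by rewrite ge_min lexx orbT.
rewrite ler_pdivlMr in h1; last by rewrite mulr_gt0 // ltr_pwDl.
have := mulr_ge0 (ltW E0) (ltW e10); lra.
Qed.

End HalfPlane.

Lemma cabs_subXX u v n : cabs u <= 1 -> cabs v <= 1 ->
  cabs (u ^+ n - v ^+ n) <= n%:R * cabs (u - v).
Proof.
move=> u1 v1; elim: n => [|n IH]; first by rewrite subrr cabs0 mul0r.
have -> : u ^+ n.+1 - v ^+ n.+1 = u ^+ n * (u - v) + (u ^+ n - v ^+ n) * v.
  by rewrite !exprSr; ring.
apply: le_trans (cabsD _ _) _; rewrite !cabsM -natr1 mulrDl mul1r addrC; apply: lerD.
  by apply: le_trans IH; rewrite ler_piMr ?cabs_ge0.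
by rewrite ler_piMl ?cabs_ge0 // cabsX exprn_ile1 ?cabs_ge0.
Qed.

Definition euler_factor n w : R[i] := (1 + n%:R^-1 * w)^-1.

Lemma Re_euler n w : complex.Re (1 + n%:R^-1 * w) = 1 + n%:R^-1 * complex.Re w.
Proof.
rewrite -(rmorph_nat (real_complex R)) -fmorphV.
by case: w => x y /=; rewrite mul0r subr0.
Qed.

Lemma cabs_euler_factor n w : 0 <= complex.Re w ->
  cabs (euler_factor n w) <= (1 + n%:R^-1 * complex.Re w)^-1.
Proof.
move=> w0; rewrite /euler_factor cabsV.
have h0 : 0 <= n%:R^-1 * complex.Re w by rewrite mulr_ge0 ?invr_ge0.
have h : 1 + n%:R^-1 * complex.Re w <= cabs (1 + n%:R^-1 * w).
  by rewrite -Re_euler; apply: le_trans (ler_norm _) (ler_Re_cabs _).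
by rewrite lef_pV2 ?posrE //; lra.
Qed.

(** Bernoulli's inequality with [a = Re w / n]. The decay in [Re w] does not depend on [n], which
    serves the part of the spectrum far to the left. *)
Lemma euler_far n w : (0 < n)%N -> 0 <= complex.Re w ->
  cabs (euler_factor n w ^+ n) <= (1 + complex.Re w)^-1.
Proof.
move=> n0 w0; have n0' : 0 < n%:R :> R by rewrite ltr0n.
rewrite cabsX; apply: (@le_trans _ _ ((1 + n%:R^-1 * complex.Re w)^-1 ^+ n)).
  by apply: lerXn2r; rewrite ?nnegrE ?cabs_ge0 ?cabs_euler_factor // invr_ge0 addr_ge0 ?mulr_ge0 ?invr_ge0.
have bern (a : R) k : 0 <= a -> 1 + k%:R * a <= (1 + a) ^+ k.
  move=> a0; elim: k => [|k IH]; first by rewrite mul0r addr0.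
  rewrite exprSr -natr1; apply: le_trans (ler_wpM2r _ IH); last by lra.
  by have := mulr_ge0 (mulr_ge0 (ler0n R k) a0) a0; lra.
have h0 : 0 <= n%:R^-1 * complex.Re w by rewrite mulr_ge0 ?invr_ge0.
have := bern _ n h0; rewrite mulrA mulfV ?mul1r ?gt_eqF // => h.
by rewrite exprVn lef_pV2 ?posrE ?exprn_gt0 //; lra.
Qed.

Lemma cexp_far w : 0 <= complex.Re w -> cabs (cexp (- w)) <= (1 + complex.Re w)^-1.
Proof.
move=> w0; rewrite cabs_cexp.
have -> : complex.Re (- w) = - complex.Re w by case: w {w0}.
rewrite expRN lef_pV2 ?posrE ?expR_gt0 ?expR_ge1Dx //; lra.
Qed.

(** Both factors have modulus at most [1], so their [n]-th powers differ by at most [n] times their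
    difference. Each is [1 - v] up to [e1 |v|] with [v = w / n], and [n |v| = |w| <= B]. *)
Lemma euler_near (B e : R) : 0 < B -> 0 < e -> exists N, forall n, (N <= n)%N ->
  forall w, 0 <= complex.Re w -> cabs w <= B ->
  cabs (euler_factor n w ^+ n - cexp (- w)) <= e.
Proof.
move=> B0 e0; pose e1 := e / (2 * B); have e10 : 0 < e1 by rewrite divr_gt0 ?mulr_gt0.
have [d d0 hd] := cexp_taylor1 e10.
have m0 : 0 < Num.min d e1 by rewrite lt_min d0.
have [N [N0 hN]] := natr_large (B / Num.min d e1).
exists N => n Nn w w0 wB.
have n0 : (0 < n)%N by apply: leq_trans Nn.
have n0' : 0 < n%:R :> R by rewrite ltr0n.
have nB : n%:R^-1 * B <= Num.min d e1.
  rewrite mulrC ler_pdivrMr // mulrC -ler_pdivrMr //.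
  by apply: le_trans hN _; rewrite ler_nat.
pose v := n%:R^-1 * w.
have vE : cabs v = n%:R^-1 * cabs w by rewrite /v cabsM cabsV cabs_natr.
have vm : cabs v <= Num.min d e1.
  by apply: le_trans nB; rewrite vE ler_wpM2l ?invr_ge0 ?(ltW n0').
have [vd ve] : cabs v <= d /\ cabs v <= e1 by apply/andP; rewrite -le_min.
have -> : cexp (- w) = cexp (- v) ^+ n.
  by rewrite -cexpX /v mulrN mulrA mulfV ?mul1r // pnatr_eq0 -lt0n.
have Rv : 0 <= complex.Re v.
  rewrite /v -(rmorph_nat (real_complex R)) -fmorphV.
  by case: (w) w0 => x y /= x0; rewrite mul0r subr0 mulr_ge0 ?invr_ge0.
have fa : cabs (euler_factor n w) <= 1.
  apply: le_trans (cabs_euler_factor _ w0) _.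
  have : 0 <= n%:R^-1 * complex.Re w by rewrite mulr_ge0 ?invr_ge0.
  by move=> h; rewrite invf_le1; lra.
have fb : cabs (cexp (- v)) <= 1.
  by rewrite cabs_cexp -expR0 ler_expR; move: Rv; case: (v) => x y /=; rewrite oppr_le0.
apply: le_trans (cabs_subXX n fa fb) _.
have b1 : cabs (cexp (- v) - 1 - - v) <= e1 * cabs v.
  by rewrite -(cabsN v); apply: hd; rewrite cabsN.
have v1 : 1 + v != 0.
  by apply/eqP => h; have := Re_euler n w; rewrite -/v h /=; have := mulr_ge0 (ltW (divr_gt0 ltr01 n0')) w0; rewrite mul1r; lra.
have b2 : cabs (euler_factor n w - (1 - v)) <= e1 * cabs v.
  have -> : euler_factor n w - (1 - v) = euler_factor n w * (v * v).
    by rewrite /euler_factor -/v; field.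
  rewrite (cabsM (euler_factor n w)) (cabsM v); apply: (@le_trans _ _ (1 * (e1 * cabs v))); last by rewrite mul1r.
  by apply: ler_pM; rewrite ?cabs_ge0 ?mulr_ge0 ?cabs_ge0 // ler_wpM2r ?cabs_ge0.
have b3 : cabs (euler_factor n w - cexp (- v)) <= 2 * e1 * cabs v.
  have -> : euler_factor n w - cexp (- v) =
     (euler_factor n w - (1 - v)) - (cexp (- v) - 1 - - v) by ring.
  by apply: le_trans (cabsB _ _) _; lra.
apply: (@le_trans _ _ (n%:R * (2 * e1 * cabs v))); first by rewrite ler_wpM2l ?(ltW n0').
have -> : n%:R * (2 * e1 * cabs v) = 2 * e1 * cabs w by rewrite vE; field; rewrite gt_eqF.
apply: (@le_trans _ _ (2 * e1 * B)); first by rewrite ler_wpM2l // mulr_ge0 // ltW.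
by rewrite le_eqVlt; apply/orP; left; apply/eqP; rewrite /e1; field; rewrite gt_eqF.
Qed.

End ComplexExponential.

(** * One-sided limits and the operator norm *)

Section Topology.
Context {R : realType} {H : completeNormedModType R[i]}.

Lemma cvg_right0_nrmP (f : R -> H) (l : H) : f h @[h --> 0^'+] --> l <->
  forall e : R, 0 < e -> exists2 d : R, 0 < d &
    forall h, 0 < h -> h < d -> nrm (f h - l) < e.
Proof.
split=> [/cvg_nrmP h e e0|h].
  have /nbhs_ballP [d /= d0 hd] := h _ e0; exists d => // t t0 td.
  by apply: hd => //; rewrite /ball /= sub0r normrN gtr0_norm.
apply/cvg_nrmP => e /h [d d0 hd].
apply/nbhs_ballP; exists d => //= t; rewrite /ball /= sub0r normrN => td t0.
by apply: hd => //; rewrite gtr0_norm in td.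
Qed.

Lemma cvg_right0_unique (f : R -> H) (l l' : H) :
  f h @[h --> 0^'+] --> l -> f h @[h --> 0^'+] --> l' -> l = l'.
Proof. by apply: cvg_unique; exact: norm_hausdorff. Qed.

Lemma opnorm_has_sup c (f : H -> H) : 0 <= c -> bounded_by c f ->
  has_sup [set complex.Re `|f x| | x in [set x : H | `|x| <= 1]] /\ opnorm f <= c.
Proof.
move=> c0 fc.
have ub : ubound [set complex.Re `|f x| | x in [set x : H | `|x| <= 1]] c.
  move=> _ [x /= x1 <-]; apply: le_trans (fc x) _.
  have : nrm x <= 1 by rewrite -lecR -nrmE.
  by move=> n1; rewrite ler_piMr.
have ne : [set complex.Re `|f x| | x in [set x : H | `|x| <= 1]] !=set0.
  by exists (nrm (f 0)), 0 => //=; rewrite normr0.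
by split; [split=> //; exists c|apply: ge_sup].
Qed.

Lemma opnorm_le c (f : H -> H) : 0 <= c -> bounded_by c f -> opnorm f <= c.
Proof. by move=> c0 fc; have [] := opnorm_has_sup c0 fc. Qed.

Lemma opnorm_ge0 c (f : H -> H) : 0 <= c -> bounded_by c f -> 0 <= opnorm f.
Proof.
move=> c0 fc; have [[_ ub] _] := opnorm_has_sup c0 fc.
apply: le_trans (nrm_ge0 (f 0)) _; apply: ub_le_sup => //.
by exists 0 => //=; rewrite normr0.
Qed.

Lemma opnorm_bound c (f : {linear H -> H}) : 0 <= c -> bounded_by c f ->
  bounded_by (opnorm f) f.
Proof.
move=> c0 fc x; have [[_ ub] _] := opnorm_has_sup c0 fc.
have [->|/eqP x0] := eqVneq x 0; first by rewrite linear0 nrm0 mulr0.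
have nx := nrm_gt0 x0.
have h : nrm (f ((nrm x)^-1%:C *: x)) <= opnorm f.
  apply: ub_le_sup => //; exists ((nrm x)^-1%:C *: x) => //=.
  by rewrite nrmE nrmZ cabs_real gtr0_norm ?invr_gt0 // mulVf ?gt_eqF.
rewrite linearZ /= nrmZ cabs_real gtr0_norm ?invr_gt0 // in h.
by rewrite -ler_pdivrMr // mulrC.
Qed.

End Topology.

(** * Construction of the semigroup and its generator *)

Section SemigroupConstruction.
Context {R : realType} {H : completeNormedModType R[i]}.
Context {dot : {dot H for (@Num.conj R[i])}}.
Context (dotE : forall x : H, dot x x = `|x| ^+ 2).
Context (A : operator H) (A_normal : normal_op dot A).
Context (l0 : R) (l0_ge0 : 0 <= l0) (Q : {linear H -> H}) (cQ : continuous Q).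
Context (hQ1 : forall x, op_dom A (Q x) /\ l0%:C *: Q x - A (Q x) = x).
Context (hQ2 : forall x, op_dom A x -> Q (l0%:C *: x - A x) = x).
Local Notation K := (resolvent_values A l0%:C).
Local Notation rep := (represents A l0%:C Q).
Context (K_right : forall z, K z -> z != 0 -> 1 <= complex.Re z^-1).
Context (K_bounded : forall B : R, exists M : R, forall z, K z -> z != 0 ->
   complex.Re z^-1 <= B -> cabs z^-1 <= M).
Context (resolvent_right : forall mu : R, l0 <= mu -> resolvent_set A mu%:C).

Definition semigroup_symbol (t : R) (z : R[i]) : R[i] :=
  if z == 0 then 0 else cexp (t%:C * (l0%:C - z^-1)).
Local Notation symb := semigroup_symbol.

Let norm_le := represents_norm_le dotE A_normal cQ hQ1 hQ2.

Let Re_realM (r : R) (z : R[i]) : complex.Re (r%:C * z) = r * complex.Re z.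
Proof. by case: z => a b /=; rewrite mul0r subr0. Qed.

Let Re_exponent z : complex.Re (l0%:C - z^-1) = l0 - complex.Re z^-1.
Proof. by case: (z^-1). Qed.

(** For [c = (n + 1) / t], the multiple by [c] of the resolvent at [l0 + c] has symbol
    [c z / (1 + c z)], which for [z <> 0] is the Euler factor at [t / z]. *)
Lemma euler_represented t n : 0 < t -> exists N,
  rep (fun z => if z == 0 then 0 else
    cexp (t%:C * l0%:C) * euler_factor n.+1 (t%:C * z^-1) ^+ n.+1) N.
Proof.
move=> t0; have n0 : 0 < n.+1%:R :> R by rewrite ltr0n.
pose c : R := n.+1%:R / t; have c0 : 0 < c by rewrite divr_gt0.
have [S [cS hS1 hS2]] : resolvent_set A (l0 + c)%:C.
  by apply: resolvent_right; rewrite lerDl ltW.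
have Srep := represents_resolvent (dot := dot) hQ1 hQ2 cS hS1 hS2.
have [|C1 C1E] := @linear_pack _ _ (fun x : H => c%:C *: x).
  by move=> a x y; vec dot.
have [|C2 C2E] := @linear_pack _ _ (fun x : H => cexp (t%:C * l0%:C) *: x).
  by move=> a x y; vec dot.
have [|S1 S1E] := @linear_pack _ _ (fun x => C1 (S x)).
  by move=> a x y; rewrite !linearD !linearZ.
have [P hP] := represents_pow (dot := dot) n.+1
   (represents_comp (dot := dot) (represents_cst A l0%:C Q C1E) Srep S1E).
have [|P1 P1E] := @linear_pack _ _ (fun x => C2 (P x)).
  by move=> a x y; rewrite !linearD !linearZ.
exists P1; apply: (represents_ext
  (represents_comp (dot := dot) (represents_cst A l0%:C Q C2E) hP P1E)) => // z Kz.
case: eqVneq => [->|z0]; first by rewrite mul0r mulr0 expr0n mulr0.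
congr (_ * _ ^+ _); rewrite /euler_factor.
have Rw : 0 <= complex.Re (t%:C * z^-1).
  by rewrite Re_realM mulr_ge0 ?(ltW t0) //; have := K_right Kz z0; lra.
have nz : 1 + n.+1%:R^-1 * (t%:C * z^-1) != 0.
  apply/eqP => h; have := Re_euler n.+1 (t%:C * z^-1).
  rewrite h -[complex.Re 0]/0.
  have : 0 <= n.+1%:R^-1 * complex.Re (t%:C * z^-1) by rewrite mulr_ge0 // invr_ge0 ltW.
  by move: (_ * _) => r; lra.
have tC : t%:C != 0 by rewrite -(rmorph0 (real_complex R)) (inj_eq (@complexI R)) gt_eqF.
have nC : n.+1%:R != 0 :> R[i] by rewrite pnatr_eq0.
have cE : c%:C = n.+1%:R / t%:C by rewrite /c rmorphM fmorphV rmorph_nat.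
have -> : (l0 + c)%:C - l0%:C = c%:C by rewrite rmorphD /= addrC addKr.
rewrite cE; move: nC nz; move: (n.+1%:R) => m nC nz.
have E : 1 + m / t%:C * z = (m / t%:C * z) * (1 + m^-1 * (t%:C * z^-1)).
  by field; rewrite z0 nC tC.
rewrite E invfM mulrA mulrA mulfV ?mul1r //.
by rewrite !mulf_neq0 ?invr_neq0.
Qed.

Lemma semigroup_represented t : 0 < t -> exists P, rep (symb t) P.
Proof.
move=> t0.
apply: (represents_limit dotE A_normal cQ hQ1 hQ2 (fun n => euler_represented n t0)) => e e0.
pose E := expR (t * l0); have E0 : 0 < E := expR_gt0 _.
have cE : cabs (cexp (t%:C * l0%:C)) = E by rewrite cabs_cexp Re_realM.
pose e1 := e / E; have e10 : 0 < e1 by rewrite divr_gt0.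
(* Beyond [Re w = B] the exponential and its approximation are each at most [e1 / 2]; below it,
   [K_bounded] confines [w] to a bounded set and [euler_near] applies. *)
pose B := 2 / e1; have B0 : 0 < B by rewrite divr_gt0.
have [M hM] := K_bounded (B / t).
have M0 : 0 < t * `|M| + 1 by have := mulr_ge0 (ltW t0) (normr_ge0 M); lra.
have [N hN] := euler_near M0 e10.
exists N => n Nn z Kz; rewrite /symb.
case: eqVneq => [z0|z0]; first by rewrite subrr cabs0 ltW.
have -> : t%:C * (l0%:C - z^-1) = t%:C * l0%:C + - (t%:C * z^-1) by ring.
rewrite cexpD -mulrBr cabsM cE.
have Rz := K_right Kz z0.
have Rw : 0 <= complex.Re (t%:C * z^-1) by rewrite Re_realM mulr_ge0 ?(ltW t0) //; lra.
suff h : cabs (euler_factor n.+1 (t%:C * z^-1) ^+ n.+1 - cexp (- (t%:C * z^-1))) <= e1.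
  have -> : e = E * e1 by rewrite /e1; field; rewrite gt_eqF.
  by rewrite ler_wpM2l ?(ltW E0).
have [wB|wB] := leP (complex.Re (t%:C * z^-1)) B.
  apply: hN => //; first exact: leq_trans Nn _.
  rewrite cabsM cabs_real gtr0_norm //.
  have zM : cabs z^-1 <= M by apply: hM => //; rewrite ler_pdivlMr // mulrC -Re_realM.
  apply: (@le_trans _ _ (t * `|M|)); last by lra.
  by rewrite ler_wpM2l ?(ltW t0) // (le_trans zM) ?ler_norm.
apply: le_trans (cabsB _ _) _.
have h1 := @euler_far _ n.+1 _ (ltn0Sn _) Rw; have h2 := cexp_far Rw.
have h3 : (1 + complex.Re (t%:C * z^-1))^-1 <= e1 / 2.
  rewrite -[e1 / 2]invrK lef_pV2 ?posrE ?invr_gt0 ?divr_gt0 //; last by lra.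
  have -> : (e1 / 2)^-1 = B by rewrite /B invf_div.
  by lra.
by lra.
Qed.

(** Time [0] is set apart: the symbol there is [1] for [z <> 0] but [0] at [z = 0], which is not the
    symbol of the identity. *)
Lemma semigroup_family : exists T : R -> {linear H -> H},
  (forall x, T 0 x = x) /\ (forall t, 0 < t -> rep (symb t) (T t)).
Proof.
have [|I IE] := @linear_pack _ _ (fun x : H => x); first by [].
have /choice [T hT] t : exists P : {linear H -> H},
    (t = 0 -> P = I) /\ (0 < t -> rep (symb t) P).
  have [t0|t0] := ltP 0 t.
    by have [P hP] := semigroup_represented t0; exists P; split=> // h; move: t0; rewrite h ltxx.
  by exists I; split.
exists T; split=> [x|t]; last exact: (hT t).2.
by rewrite ((hT 0).1 erefl) IE.
Qed.

Context (T : R -> {linear H -> H}) (T0 : forall x, T 0 x = x).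
Context (TE : forall t, 0 < t -> rep (symb t) (T t)).

Let comb a (N M : {linear H -> H}) : exists P : {linear H -> H}, forall x, P x = a *: N x + M x.
Proof.
by apply: linear_pack => b x y; rewrite !linearD !linearZ /=; vec dot.
Qed.

Let comp (N M : {linear H -> H}) : exists P : {linear H -> H}, forall x, P x = N (M x).
Proof. by apply: linear_pack => b x y; rewrite !linearD !linearZ. Qed.

Lemma symbol_bound t z : 0 <= t -> K z -> cabs (symb t z) <= expR (t * l0).
Proof.
move=> t0 Kz; rewrite /symb; case: eqVneq => [z0|z0]; first by rewrite cabs0 expR_ge0.
rewrite cabs_cexp ler_expR Re_realM Re_exponent ler_wpM2l //.
by have := K_right Kz z0; lra.
Qed.

Lemma semigroup_bound t : 0 <= t -> bounded_by (expR (t * l0)) (T t).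
Proof.
rewrite le_eqVlt => /orP[/eqP <-|t0].
  by move=> x; rewrite T0 mul0r expR0 mul1r.
by apply: norm_le (TE t0) (expR_ge0 _) _ => z Kz; apply: symbol_bound => //; exact: ltW.
Qed.

(** The difference of the two sides is represented by the zero symbol, hence bounded by [0]. *)
Lemma semigroup_law s t : 0 <= s -> 0 <= t -> forall x, T (s + t) x = T s (T t x).
Proof.
rewrite le_eqVlt => /orP[/eqP <- _ x|s0]; first by rewrite add0r T0.
rewrite le_eqVlt => /orP[/eqP <- x|t0 x]; first by rewrite addr0 T0.
have [P PE] := comp (T s) (T t).
have [D DE] := comb (-1) P (T (s + t)).
have hD := represents_lin (dot := dot) (represents_comp (dot := dot) (TE s0) (TE t0) PE)
  (TE (addr_gt0 s0 t0)) DE.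
have : bounded_by 0 D.
  apply: norm_le hD _ _ => // z Kz; rewrite /symb.
  case: eqVneq => [z0|z0]; first by rewrite !mulr0 addr0 cabs0.
  rewrite -cexpD rmorphD /= mulrDl mulN1r addrC subrr cabs0 //.
move=> /(_ x); rewrite mul0r DE PE scaleN1r => h.
have /nrm0_eq0/eqP : nrm (- T s (T t x) + T (s + t) x) = 0.
  by apply/eqP; rewrite eq_le h nrm_ge0.
by rewrite addrC subr_eq0 => /eqP.
Qed.

Let E1 := expR l0.
Let E1_gt0 : 0 < E1. Proof. exact: expR_gt0. Qed.

(** A factor [z] absorbs the unbounded exponent, since [(l0 - z^-1) z = l0 z - 1] and [|z| <= 1];
    for operators, [A Q] is bounded. *)
Let scaled_exponent t z : 0 < t -> K z -> z != 0 -> cabs (t%:C * (l0%:C - z^-1)) * cabs z <= t * (l0 + 1).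
Proof.
move=> t0 Kz z0; rewrite cabsM cabs_real gtr0_norm // -mulrA -cabsM.
rewrite mulrBl mulVf //; apply: ler_wpM2l; first exact: ltW.
apply: le_trans (cabsB _ _) _; rewrite cabs1 cabsM cabs_real ger0_norm // lerD2r.
rewrite ler_piMr //.
have z1 : 1 <= cabs z^-1 by apply: le_trans (K_right Kz z0) (le_trans (ler_norm _) (ler_Re_cabs _)).
by rewrite -(invrK z) cabsV invf_le1 //; lra.
Qed.

Let Re_exponent_le t z : 0 < t -> t <= 1 -> K z -> z != 0 ->
  complex.Re (t%:C * (l0%:C - z^-1)) <= l0.
Proof.
move=> t0 t1 Kz z0; rewrite Re_realM Re_exponent; have := K_right Kz z0 => h.
by apply: (@le_trans _ _ (t * l0)); [rewrite ler_wpM2l ?(ltW t0) //; lra|rewrite ler_piMl].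
Qed.

Lemma semigroup_sub1_resolvent t : 0 < t -> t <= 1 ->
  forall y, nrm (T t (Q y) - Q y) <= 2 * E1 * (t * (l0 + 1)) * nrm y.
Proof.
move=> t0 t1 y.
have [P PE] := comp (T t) Q; have [D DE] := comb (-1) Q P.
have -> : T t (Q y) - Q y = D y by rewrite DE PE scaleN1r addrC.
have hD := represents_lin (dot := dot) (represents_Q A l0%:C cQ)
  (represents_comp (dot := dot) (TE t0) (represents_Q A l0%:C cQ) PE) DE.
apply: norm_le hD _ _ y; first by rewrite !mulr_ge0 ?addr_ge0 ?(ltW E1_gt0) ?(ltW t0).
move=> z Kz; rewrite /symb; case: eqVneq => [z0|z0].
  by rewrite z0 mul0r mulr0 addr0 cabs0 !mulr_ge0 ?addr_ge0 ?(ltW E1_gt0) ?(ltW t0).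
have -> : -1 * z + cexp (t%:C * (l0%:C - z^-1)) * z = (cexp (t%:C * (l0%:C - z^-1)) - 1) * z by ring.
rewrite cabsM; apply: le_trans (ler_wpM2r (cabs_ge0 _) (cexp_sub1_le l0_ge0 (Re_exponent_le t0 t1 Kz z0))) _.
rewrite -/E1 -[leLHS]mulrA; apply: ler_wpM2l; last exact: scaled_exponent.
by rewrite mulr_ge0 // ltW.
Qed.

Lemma semigroup_strongly_continuous x : T t x @[t --> 0^'+] --> x.
Proof.
apply/cvg_right0_nrmP => e e0.
have e3 : 0 < e / (3 * (E1 + 1)) by rewrite divr_gt0 // mulr_gt0 // ltr_wpDl // ltW.
have [u Du xu] := normal_dense A_normal x e3.
pose y := l0%:C *: u - A u; have uE : u = Q y by rewrite hQ2.
pose C := 2 * E1 * (l0 + 1) * nrm y.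
have C0 : 0 <= C by rewrite !mulr_ge0 ?addr_ge0 ?nrm_ge0 ?(ltW E1_gt0).
exists (Num.min 1 (e / (3 * (C + 1)))).
  by rewrite lt_min ltr01 divr_gt0 // mulr_gt0 // ltr_wpDl.
move=> t t0; rewrite lt_min => /andP[/ltW t1 tC].
have h1 := semigroup_sub1_resolvent t0 t1 y; rewrite -uE in h1.
have -> : T t x - x = T t (x - u) + (T t u - u) - (x - u).
  by rewrite [T t (x - u)]linearB /=; vec dot.
apply: le_lt_trans (nrmB _ _) _.
have h2 := nrmD (T t (x - u)) (T t u - u).
have h3 : nrm (T t (x - u)) <= E1 * nrm (x - u).
  apply: le_trans (semigroup_bound (ltW t0) _) _; rewrite ler_wpM2r ?nrm_ge0 //.
  by rewrite ler_expR ler_piMl.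
have h4 : (E1 + 1) * nrm (x - u) <= e / 3.
  have -> : e / 3 = (E1 + 1) * (e / (3 * (E1 + 1))).
    by field; rewrite gt_eqF // ltr_wpDl // ltW.
  by rewrite ler_wpM2l ?(ltW xu) // addr_ge0 // ltW.
have h5 : 2 * E1 * (t * (l0 + 1)) * nrm y <= e / 3.
  have -> : 2 * E1 * (t * (l0 + 1)) * nrm y = t * C by rewrite /C; ring.
  have h6 : t * (3 * (C + 1)) <= e by rewrite -ler_pdivlMr ?(ltW tC) // mulr_gt0 // ltr_wpDl.
  by lra.
by lra.
Qed.

Lemma semigroup_difference_quotient x : op_dom A x ->
  diff_quotient T x h @[h --> 0^'+] --> A x.
Proof.
move=> Dx; apply/cvg_right0_nrmP => e e0.
pose y := l0%:C *: x - A x; have xE : x = Q y by rewrite hQ2.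
have AxE : A x = l0%:C *: Q y - y by rewrite -xE /y; vec dot.
pose C1 := 2 * E1 * (l0 + 1) + (l0 + 1).
pose C2 := 2 * E1 * (l0 + 1) ^+ 2.
have l1 : 0 < l0 + 1 by have := l0_ge0; lra.
have C10 : 0 < C1 by rewrite addr_gt0 ?mulr_gt0.
have C20 : 0 < C2 by rewrite !mulr_gt0 ?exprn_gt0.
(* The error of the quotient on the range of [Q] has symbol [t^-1 (exp w - 1 - w) z] for [z <> 0],
   and [1] at [z = 0]. It is bounded uniformly in [t] and, after one more factor [Q], of order [t];
   density of the domain combines the two bounds. *)
have main t : 0 < t -> t <= 1 -> forall v, nrm (t^-1%:C *: (T t (Q v) - Q v) - (l0%:C *: Q v - v)) <= C1 * nrm v /\
    nrm (t^-1%:C *: (T t (Q (Q v)) - Q (Q v)) - (l0%:C *: Q (Q v) - Q v)) <= C2 * t * nrm v.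
  move=> t0 t1 v.
  have tC : t%:C != 0 by rewrite -(rmorph0 (real_complex R)) (inj_eq (@complexI R)) gt_eqF.
  have [|I IE] := @linear_pack _ _ (fun x : H => 1 *: x); first by move=> *; rewrite !scale1r.
  have [P PE] := comp (T t) Q; have [D DE] := comb (-1) Q P.
  have hD := represents_lin (dot := dot) (represents_Q A l0%:C cQ)
    (represents_comp (dot := dot) (TE t0) (represents_Q A l0%:C cQ) PE) DE.
  have [D2 D2E] := comb (t^-1%:C) D I.
  have hD2 := represents_lin (dot := dot) hD (represents_cst A l0%:C Q IE) D2E.
  have [G GE] := comb (- l0%:C) Q D2.
  have hG := represents_lin (dot := dot) (represents_Q A l0%:C cQ) hD2 GE.
  have [GQ GQE] := comp G Q.
  have hGQ := represents_comp (dot := dot) hG (represents_Q A l0%:C cQ) GQE.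
  have EG w : t^-1%:C *: (T t (Q w) - Q w) - (l0%:C *: Q w - w) = G w.
    by rewrite GE D2E DE PE IE; vec dot.
  rewrite !EG -GQE.
  pose w z := t%:C * (l0%:C - z^-1).
  have symbE z : z != 0 -> (- l0%:C) * z + (t^-1%:C * (-1 * z + symb t z * z) + 1) =
      t^-1%:C * ((cexp (w z) - 1 - w z) * z).
    move=> z0; rewrite /symb (negbTE z0) -/(w z) fmorphV.
    by rewrite [in RHS]/w -/(w z); move: (cexp (w z)) => c; rewrite /w; field; rewrite tC z0.
  have tinv : cabs t^-1%:C = t^-1 by rewrite cabs_real gtr0_norm ?invr_gt0.
  split.
    apply: norm_le hG (ltW C10) _ v => z Kz.
    case: (eqVneq z 0) => [z0|z0].
      rewrite z0 /symb eqxx !mulr0 addr0 mulr0 !add0r cabs1 /C1.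
      by have := mulr_gt0 (mulr_gt0 (ltr0Sn R 1) E1_gt0) l1; have := l0_ge0; lra.
    rewrite (symbE z z0) cabsM tinv cabsM.
    have h1 : cabs (cexp (w z) - 1 - w z) <= (2 * E1 + 1) * cabs (w z).
      apply: le_trans (cabsB _ _) _; rewrite mulrDl mul1r lerD2r.
      exact: (cexp_sub1_le l0_ge0 (Re_exponent_le t0 t1 Kz z0)).
    have h2 := scaled_exponent t0 Kz z0; rewrite -/(w z) in h2.
    rewrite mulrC ler_pdivrMr //.
    apply: le_trans (ler_wpM2r (cabs_ge0 _) h1) _.
    have -> : C1 * t = (2 * E1 + 1) * (t * (l0 + 1)) by rewrite /C1; ring.
    by rewrite -mulrA ler_wpM2l // addr_ge0 ?mulr_ge0 // ltW.
  apply: norm_le hGQ _ _ v; first by rewrite mulr_ge0 // ltW.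
  move=> z Kz; case: (eqVneq z 0) => [z0|z0].
    by rewrite z0 mulr0 cabs0 mulr_ge0 // ltW.
  rewrite (symbE z z0) !cabsM tinv.
  have h1 := cexp_taylor2 l0_ge0 (Re_exponent_le t0 t1 Kz z0); rewrite -/(w z) -/E1 in h1.
  have h2 := scaled_exponent t0 Kz z0; rewrite -/(w z) in h2.
  rewrite -mulrA mulrC ler_pdivrMr // -mulrA -expr2.
  apply: le_trans (ler_wpM2r (sqr_ge0 _) h1) _.
  have -> : C2 * t * t = 2 * E1 * (t * (l0 + 1)) ^+ 2 by rewrite /C2; ring.
  rewrite -[leLHS]mulrA -exprMn; apply: ler_wpM2l; first by rewrite mulr_ge0 // ltW.
  by rewrite ler_pXn2r ?nnegrE ?mulr_ge0 ?cabs_ge0 // ?(ltW t0) // ltW.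
have e2 : 0 < e / (3 * C1) by rewrite divr_gt0 // mulr_gt0.
have [u Du yu] := normal_dense A_normal y e2.
pose v := l0%:C *: u - A u; have uE : u = Q v by rewrite hQ2.
pose S := C2 * nrm v + 1; have S0 : 0 < S by have := mulr_ge0 (ltW C20) (nrm_ge0 v); rewrite /S; lra.
exists (Num.min 1 (e / (3 * S))); first by rewrite lt_min ltr01 divr_gt0 // mulr_gt0.
move=> t t0; rewrite lt_min => /andP[/ltW t1 tS].
rewrite /diff_quotient AxE xE.
have [h1 _] := main t t0 t1 (y - u); have [_ h2] := main t t0 t1 v.
rewrite -uE in h2.
have -> : t^-1%:C *: (T t (Q y) - Q y) - (l0%:C *: Q y - y) =
  (t^-1%:C *: (T t (Q (y - u)) - Q (y - u)) - (l0%:C *: Q (y - u) - (y - u))) +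
  (t^-1%:C *: (T t (Q u) - Q u) - (l0%:C *: Q u - u)).
  by rewrite [Q (y - u)]linearB [T t (_ - _)]linearB /=; vec dot.
apply: le_lt_trans (nrmD _ _) _.
have h3 : C1 * nrm (y - u) <= e / 3.
  have -> : e / 3 = C1 * (e / (3 * C1)) by field; rewrite gt_eqF.
  by rewrite ler_wpM2l ?(ltW C10) // ltW.
have h4 : C2 * t * nrm v <= e / 3.
  have h5 : t * (3 * S) <= e by rewrite -ler_pdivlMr ?(ltW tS) // mulr_gt0.
  have -> : C2 * t * nrm v = t * (C2 * nrm v) by ring.
  by move: h5; rewrite /S; lra.
by lra.
Qed.

(** The generator does not properly extend [A]: if the quotient at [x] tends to [v], applying [Q]
    gives [A (Q x) = Q v], hence [x = Q (l0 x - v)], which lies in the domain. *)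
Lemma semigroup_generates : generates A T.
Proof.
have TQ t : 0 < t -> forall x, Q (T t x) = T t (Q x).
  by move=> t0; have [_ h _] := TE t0; apply: h.
have dq x v : diff_quotient T x h @[h --> 0^'+] --> v -> op_dom A x /\ A x = v.
  move=> hv; have [c c0 Qc] := (continuous_linear_bounded_by Q).1 cQ.
  have hQv : diff_quotient T (Q x) h @[h --> 0^'+] --> Q v.
    apply/cvg_right0_nrmP => e e0.
    have /cvg_right0_nrmP /(_ _ (divr_gt0 e0 c0)) [d d0 hd] := hv.
    exists d => // h h0 hhd.
    have -> : diff_quotient T (Q x) h - Q v = Q (diff_quotient T x h - v).
      rewrite /diff_quotient [Q (_ - _)]linearB [Q (_ *: _)]linearZ /=.
      by rewrite [Q (_ - _)]linearB /= TQ.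
    apply: le_lt_trans (Qc _) _; rewrite mulrC -ltr_pdivlMr //.
    exact: hd.
  have [Dx Ex] := hQ1 x.
  have E := cvg_right0_unique (semigroup_difference_quotient Dx) hQv.
  have xE : x = Q (l0%:C *: x - v).
    by rewrite [Q (_ - _)]linearB [Q (_ *: _)]linearZ /= -E Ex.
  have [D E2] := hQ1 (l0%:C *: x - v).
  rewrite -xE in D E2; split=> //.
  by move/addrI/oppr_inj: E2.
split.
  split=> //.
  - move=> t t0; apply/continuous_linear_bounded_by.
    by exists (expR (t * l0)); [exact: expR_gt0|exact: semigroup_bound].
  - exact: semigroup_law.
  - exact: semigroup_strongly_continuous.
split.
  apply/seteqP; split=> x /=.
    by move=> Dx; apply/cvg_ex; exists (A x); exact: semigroup_difference_quotient.
  by move=> /cvg_ex [v /dq []].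
move=> x; rewrite inE => Dx /=; apply/esym/cvg_lim; first exact: norm_hausdorff.
exact: semigroup_difference_quotient.
Qed.

Lemma semigroup_immediately_norm_continuous : immediately_norm_continuous T.
Proof.
move=> t t0; apply/cvgrPdist_le => e e0.
(* As [s] stays above [t / 2] and [t / 2 * B = 2 / e], both exponentials are at most [e / 2] where
   [Re l < - B]. Elsewhere [|l| <= M1]. *)
pose B := 4 / (t * e); have B0 : 0 < B by rewrite divr_gt0 // mulr_gt0.
have [M hM] := K_bounded (l0 + B).
pose M1 := `|M| + l0 + 1; have M10 : 0 < M1 by have := normr_ge0 M; have := l0_ge0; rewrite /M1; lra.
pose Et := expR (t * l0); have Et0 : 0 < Et := expR_gt0 _.
(* The three entries keep [s] above [t / 2], make [|s - t| |l| <= 1] so that [cexp_sub1_le] applies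
   with [b = 1], and bring the resulting product under [e]. *)
pose d := Num.min (t / 2) (Num.min M1^-1 (e / (2 * expR 1 * M1 * Et))).
have X0 : 0 < 2 * expR 1 * M1 * Et by rewrite !mulr_gt0 ?expR_gt0.
have d0 : 0 < d by rewrite /d !lt_min invr_gt0 M10 !divr_gt0.
apply/nbhs_ballP; exists d => // s; rewrite /ball /= => st.
rewrite sub0r normrN.
have [s1 [s2 s3]] : `|t - s| < t / 2 /\ `|t - s| < M1^-1 /\ `|t - s| < e / (2 * expR 1 * M1 * Et).
  by move: st; rewrite !lt_min => /andP[? /andP[? ?]].
have s0 : t / 2 < s by move: s1; rewrite ltr_norml; lra.
have s00 : 0 < s by lra.
have [D DE] := comb (-1) (T t) (T s).
have hD := represents_lin (dot := dot) (TE t0) (TE s00) DE.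
have De : bounded_by e (T s \- T t).
  have -> : (T s \- T t) = D by apply/funext => x /=; rewrite DE scaleN1r addrC.
  apply: norm_le hD (ltW e0) _ => z Kz; rewrite /symb.
  case: eqVneq => [z0|z0]; first by rewrite mulr0 addr0 cabs0 ltW.
  pose l := l0%:C - z^-1; rewrite -/l mulN1r addrC.
  have Rl : complex.Re l = l0 - complex.Re z^-1 by rewrite Re_exponent.
  have Rz := K_right Kz z0; have l00 := l0_ge0.
  have [zB|zB] := leP (complex.Re z^-1) (l0 + B).
    have lM : cabs l <= M1.
      apply: le_trans (cabsB _ _) _; rewrite cabs_real ger0_norm //.
      by have := hM z Kz z0 zB; have := ler_norm M; rewrite /M1; lra.
    have -> : s%:C * l = t%:C * l + (s - t)%:C * l by rewrite rmorphB /=; ring.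
    rewrite cexpD -[X in _ - X]mulr1 -mulrBr cabsM.
    have h1 : cabs (cexp (t%:C * l)) <= Et.
      by rewrite cabs_cexp ler_expR Re_realM Rl ler_wpM2l ?(ltW t0) //; lra.
    have h2 : cabs ((s - t)%:C * l) <= `|t - s| * M1.
      by rewrite cabsM cabs_real distrC ler_wpM2l.
    have h3 : `|t - s| * M1 <= 1.
      by rewrite -ler_pdivlMr // mul1r ltW.
    have h4 : complex.Re ((s - t)%:C * l) <= 1.
      exact: le_trans (ler_norm _) (le_trans (ler_Re_cabs _) (le_trans h2 h3)).
    have h5 := cexp_sub1_le ler01 h4.
    have h6 : cabs (cexp ((s - t)%:C * l) - 1) <= 2 * expR 1 * (`|t - s| * M1).
      by apply: le_trans h5 _; rewrite ler_wpM2l // mulr_ge0 ?expR_ge0.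
    apply: le_trans (ler_pM (cabs_ge0 _) (cabs_ge0 _) h1 h6) _.
    have : `|t - s| * (2 * expR 1 * M1 * Et) <= e by rewrite -ler_pdivlMr // ltW.
    by lra.
  have far r : t / 2 <= r -> cabs (cexp (r%:C * l)) <= e / 2.
    move=> tr; rewrite cabs_cexp Re_realM Rl.
    have r0 : 0 < r by lra.
    have -> : r * (l0 - complex.Re z^-1) = - (r * (complex.Re z^-1 - l0)) by ring.
    rewrite expRN.
    have rB : 2 / e <= r * (complex.Re z^-1 - l0).
      have -> : 2 / e = t / 2 * B by rewrite /B; field; rewrite !gt_eqF.
      by apply: ler_pM => //; lra.
    rewrite -[e / 2]invrK lef_pV2 ?posrE ?invr_gt0 ?divr_gt0 ?expR_gt0 // invf_div.
    by apply: le_trans rB _; apply: le_trans (expR_ge1Dx _); lra.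
  apply: le_trans (cabsB _ _) _.
  by have := far s (ltW s0); have := far t; lra.
rewrite ger0_norm; first exact: opnorm_le (ltW e0) De.
exact: opnorm_ge0 (ltW e0) De.
Qed.

End SemigroupConstruction.

(** * The uniform boundedness principle *)

Section UniformBoundedness.
Context {R : realType} {H : completeNormedModType R[i]}.

(** As [f (x + u) - f (x - u) = 2 f u], the norm of [f] at one of [x + u], [x - u] is at least that
    of [f u], whatever [f x] is. *)
Lemma linear_large_in_ball (f : {linear H -> H}) (c r : R) x v : 0 < r ->
  c * nrm v < nrm (f v) -> exists y, nrm (x - y) <= r /\ c * r < nrm (f y).
Proof.
move=> r0 hv.
have v0 : v <> 0 by move=> v0; move: hv; rewrite v0 linear0 nrm0 mulr0 ltxx.
have nv := nrm_gt0 v0.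
pose u := (r / nrm v)%:C *: v.
have ru : 0 < r / nrm v by rewrite divr_gt0.
have nu : nrm u = r by rewrite nrmZ cabs_real gtr0_norm // divfK ?gt_eqF.
have fu : c * r < nrm (f u).
  rewrite linearZ /= nrmZ cabs_real gtr0_norm //.
  have -> : c * r = r / nrm v * (c * nrm v) by field; rewrite gt_eqF.
  by rewrite ltr_pM2l.
have [h|h] := ltP (c * r) (nrm (f (x + u))).
  by exists (x + u); rewrite opprD addrA subrr sub0r nrmN nu.
exists (x - u); rewrite opprB addrCA subrr addr0 nu; split=> //.
have := nrmB (f (x + u)) (f (x - u)).
have -> : f (x + u) - f (x - u) = 2%:C *: f u.
  rewrite [f (x + u)]linearD [f (x - u)]linearB rmorph_nat scaler_nat mulr2n opprB.
  by rewrite addrC addrA subrK.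
rewrite nrmZ cabs_real ger0_norm //; lra.
Qed.

(** Nested balls: stage [k] finds a smaller ball on which some [F n] is at least [k], and the common
    point of all balls contradicts pointwise boundedness. *)
Lemma uniform_boundedness (F : nat -> {linear H -> H}) :
  (forall n, continuous (F n)) ->
  (forall x, exists M : R, forall n, nrm (F n x) <= M) ->
  exists M : R, forall n, bounded_by M (F n).
Proof.
move=> cF pb; apply: contrapT => hU.
have big (c : R) : exists n v, c * nrm v < nrm (F n v).
  apply: contrapT => h; apply: hU; exists c => n v; rewrite leNgt; apply/negP => hv.
  by apply: h; exists n, v.
have step (p : nat * (H * R)) : exists q : H * R, 0 < p.2.2 ->
    [/\ 0 < q.2, q.2 <= p.2.2 / 2, nrm (p.2.1 - q.1) <= p.2.2 / 2 &
     exists n, forall z, nrm (q.1 - z) <= q.2 -> p.1%:R <= nrm (F n z)].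
  case: p => k [x r] /=; have [r0|_] := ltP 0 r; last by exists (x, r).
  have r2 : 0 < r / 2 by lra.
  (* This slope yields a point [y] within [r / 2] of [x] where [F n] exceeds [k + 1]; continuity
     costs at most [1] on a small ball around [y]. *)
  have [n [v hv]] := big ((k%:R + 1) / (r / 2)).
  have [y [xy hy]] := linear_large_in_ball x r2 hv.
  rewrite divfK ?gt_eqF // in hy.
  have [d d0 hd] := (continuous_nrmP (F n)).1 (cF n) y 1 ltr01.
  exists (y, Num.min (r / 2) (d / 2)) => _ /=; split=> //.
  - by rewrite lt_min r2 divr_gt0.
  - by rewrite ge_min lexx.
  - exists n => z; rewrite le_min => /andP[_ zd].
    have := hd z; have -> : nrm (y - z) < d by lra.
    move=> /(_ isT); have := nrm_split (F n z) (F n y) 0.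
    by rewrite !subr0; lra.
have /choice [next hnext] := step.
pose s := fix s (k : nat) : H * R := if k is k'.+1 then next (k', s k') else (0, 1).
have s0 k : 0 < (s k).2.
  by elim: k => [|k IH] //=; have [] := hnext (k, s k) IH.
have half k : (s k.+1).2 <= (s k).2 / 2 by have [] := hnext (k, s k) (s0 k).
have nest k m : nrm ((s k).1 - (s (k + m)%N).1) + (s (k + m)%N).2 <= (s k).2.
  elim: m => [|m IH]; first by rewrite addn0 subrr nrm0 add0r.
  rewrite addnS; have [_ h1 h2 _] := hnext ((k + m)%N, s (k + m)%N) (s0 (k + m)%N).
  have h3 := nrm_split (s (k + m)%N).1 (s k).1 (s (k + m).+1).1.
  have h4 := half (k + m)%N; have h5 := s0 (k + m)%N.
  by rewrite /= in h2 *; rewrite /= in h3 h4; lra.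
have small k : (s k).2 * k.+1%:R <= 1.
  elim: k => [|k IH]; first by rewrite mulr1.
  have h := half k; have h1 := s0 k; have h2 := s0 k.+1.
  apply: le_trans IH; apply: (@le_trans _ _ ((s k).2 / 2 * k.+2%:R)); first by rewrite ler_wpM2r.
  by rewrite -mulrA ler_wpM2l ?(ltW h1) // mulrC ler_pdivrMr // -natrM ler_nat muln2 -addnn addSn addnS !ltnS leq_addr.
have dist k j : (k <= j)%N -> nrm ((s k).1 - (s j).1) <= (s k).2.
  move=> kj; have := nest k (j - k)%N; rewrite subnKC //.
  by have := s0 j; lra.
have [d [d0 hd]] := @vanishing_sequence R.
have [x hx] : exists l, forall e : R, 0 < e -> exists N, forall n, (N <= n)%N -> nrm ((s n).1 - l) < e.
  apply: cauchy_nrm_cvg => e e0.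
  have [N [N0 hN]] := natr_large (2 / e).
  rewrite ler_pdivrMr // in hN.
  have N1 : (s N).2 * N.+1%:R <= 1 := small N.
  have N2 : 2 * (s N).2 < e.
    rewrite -natr1 in N1; have h1 := s0 N; have n0 : 0 < N%:R :> R by rewrite ltr0n.
    rewrite ltNge; apply/negP => he.
    have : N%:R * e <= N%:R * (2 * (s N).2) by rewrite ler_wpM2l ?(ltW n0).
    by lra.
  exists N => i j Ni Nj; apply: le_lt_trans (nrm_split (s N).1 _ _) _; rewrite nrmC.
  by have := dist _ _ Ni; have := dist _ _ Nj; lra.
have xk k : nrm ((s k).1 - x) <= (s k).2.
  apply/ler_addgt0Pr => e e0; have [N hN] := hx _ e0.
  apply: le_trans (nrm_split (s (maxn k N)).1 _ _) _; apply: lerD.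
    by apply: dist; rewrite leq_maxl.
  by apply/ltW/hN; rewrite leq_maxr.
have [M hM] := pb x.
have [k [_ hk]] := natr_large (M + 1).
have [_ _ _ [n hn]] := hnext (k, s k) (s0 k).
have := hn x (xk k.+1); have := hM n; rewrite /=; lra.
Qed.

End UniformBoundedness.

(** * Local bounds and comparison of semigroups *)

Section Semigroups.
Context {R : realType} {H : completeNormedModType R[i]}.
Context {dot : {dot H for (@Num.conj R[i])}}.

(** Otherwise there are times [t n] tending to [0] with [T (t n)] not bounded by [n]. Strong
    continuity at [0] bounds [T (t n) x] for each [x], against uniform boundedness. *)
Lemma C0_semigroup_near0_bound (T : R -> {linear H -> H}) : C0_semigroup T ->
  exists M d : R, 0 < d /\ forall s, 0 <= s -> s <= d -> bounded_by M (T s).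
Proof.
move=> [cT T0 TD Tc]; apply: contrapT => hU.
have [d [d0 hd]] := @vanishing_sequence R.
have /choice [t ht] n : exists t, [/\ 0 <= t, t <= d n & ~ bounded_by n%:R (T t)].
  apply: contrapT => h; apply: hU; exists n%:R, (d n); split=> // s s0 sd.
  by apply: contrapT => hs; apply: h; exists s.
have [||M hM] := uniform_boundedness (F := fun n => T (t n)).
- by move=> n; have [t0 _ _] := ht n; exact: cT.
- move=> x; have /cvg_right0_nrmP /(_ 1 ltr01) [e e0 he] := Tc x.
  have [N hN] := hd _ e0.
  exists (nrm x + 1 + \sum_(i < N) nrm (T (t i) x)) => n.
  have S0 : 0 <= \sum_(i < N) nrm (T (t i) x) by apply: sumr_ge0 => i _; exact: nrm_ge0.
  have [nN|Nn] := ltnP n N.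
    rewrite (bigD1 (Ordinal nN)) //=.
    have : 0 <= \sum_(i < N | i != Ordinal nN) nrm (T (t i) x) by apply: sumr_ge0 => i _; exact: nrm_ge0.
    by have := nrm_ge0 x; lra.
  have [t0 td _] := ht n.
  have : nrm (T (t n) x) <= nrm x + 1; last by lra.
  move: t0; rewrite le_eqVlt => /orP[/eqP <-|t0]; first by rewrite T0; lra.
  have := he _ t0 (le_lt_trans td (hN _ Nn)).
  by have := nrm_split x (T (t n) x) 0; rewrite !subr0 /=; lra.
- have [n [_ hn]] := natr_large M; have [_ _] := ht n; apply.
  exact: bounded_by_le hn (hM n).
Qed.

Lemma C0_semigroup_bound (T : R -> {linear H -> H}) (t : R) : C0_semigroup T ->
  exists M : R, 0 <= M /\ forall s, 0 <= s -> s <= t -> bounded_by M (T s).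
Proof.
move=> hT; have [M0 [d [d0 hd]]] := C0_semigroup_near0_bound hT.
have [_ _ TD _] := hT.
pose M := Num.max 1 M0.
have M1 : 1 <= M by rewrite le_max lexx.
have {}hd s : 0 <= s -> s <= d -> bounded_by M (T s).
  by move=> s0 sd; apply: bounded_by_le (hd s s0 sd); rewrite le_max lexx orbT.
have main n s : 0 <= s -> s <= n.+1%:R * d -> bounded_by (M ^+ n.+1) (T s).
  elim: n s => [|n IH] s s0 sn; first by apply: hd => //; rewrite mul1r in sn.
  have [sd|sd] := leP s d.
    by apply: bounded_by_le (hd s s0 sd); apply: ler_eXnr.
  move=> x; have -> : s = d + (s - d) by ring.
  have sd0 : 0 <= s - d by lra.
  rewrite TD ?(ltW d0) // exprS -mulrA.
  apply: le_trans (hd _ (ltW d0) (lexx _) _) _; rewrite ler_wpM2l; [by []|lra|].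
  by apply: IH => //; move: sn; rewrite -[n.+2%:R]natr1 mulrDl mul1r; lra.
have [n [n0 hn]] := natr_large (t / d).
rewrite ler_pdivrMr // in hn.
exists (M ^+ n.+1); split; first by rewrite exprn_ge0 //; lra.
move=> s s0 st; apply: main => //; rewrite -natr1 mulrDl mul1r; lra.
Qed.

(** With [h = t / n] the difference telescopes into [n] terms [S (j h) T (k h) (T h x - S h x)],
    each at most [N M (eps + e) h]. Commutation lets [T h - S h] act on [x] itself, the only vector
    where it is controlled. *)
Lemma semigroup_comparison (T S : R -> {linear H -> H}) (t M N eps : R) x :
  0 < t -> 0 <= M -> 0 <= N ->
  (forall x, T 0 x = x) -> (forall x, S 0 x = x) ->
  (forall r s, 0 <= r -> 0 <= s -> forall x, T (r + s) x = T r (T s x)) ->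
  (forall r s, 0 <= r -> 0 <= s -> forall x, S (r + s) x = S r (S s x)) ->
  (forall r s, 0 <= r -> 0 <= s -> forall x, T r (S s x) = S s (T r x)) ->
  (forall s, 0 <= s -> s <= t -> bounded_by M (T s)) ->
  (forall s, 0 <= s -> s <= t -> bounded_by N (S s)) ->
  (forall e : R, 0 < e -> exists2 d : R, 0 < d &
     forall h, 0 < h -> h < d -> nrm (T h x - S h x) <= (eps + e) * h) ->
  nrm (T t x - S t x) <= N * M * t * eps.
Proof.
move=> t0 M0 N0 T0 S0 TD SD TS TM SN near0.
apply/ler_addgt0Pr => e e0.
have C0 : 0 < N * M * t + 1 by have := mulr_ge0 (mulr_ge0 N0 M0) (ltW t0); lra.
have [d d0 hd] := near0 _ (divr_gt0 e0 C0).
have [n [n0 hn]] := natr_large (2 * t / d).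
have n0' : 0 < n%:R :> R by rewrite ltr0n.
pose h := t / n%:R; have h0 : 0 < h by rewrite divr_gt0.
have nh : n%:R * h = t by rewrite /h mulrC divfK ?gt_eqF.
have hhd : h < d.
  by rewrite /h ltr_pdivrMr // mulrC -ltr_pdivrMr //; apply: lt_le_trans hn; rewrite ltr_pM2r ?invr_gt0 //; lra.
have dl := hd h h0 hhd; set delta := nrm _ in dl.
have kh k : 0 <= k%:R * h by rewrite mulr_ge0 // ltW.
(* [S (j h)] is carried through the induction so that the bound [N] is paid once per term and does
   not accumulate. *)
have main k j : (j + k <= n)%N -> nrm (S (j%:R * h) (T (k%:R * h) x - S (k%:R * h) x)) <= k%:R * (N * M * delta).
  elim: k j => [|k IH] j jk; first by rewrite mul0r T0 S0 subrr linear0 nrm0 mul0r.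
  have lt i : (i <= n)%N -> i%:R * h <= t by move=> ni; rewrite -nh ler_wpM2r ?(ltW h0) // ler_nat.
  have -> : S (j%:R * h) (T (k.+1%:R * h) x - S (k.+1%:R * h) x) =
     S (j%:R * h) (T (k%:R * h) (T h x - S h x)) +
     S (j.+1%:R * h) (T (k%:R * h) x - S (k%:R * h) x).
    rewrite -[j.+1%:R]natr1 [(j%:R + 1) * h]mulrDl mul1r SD ?(ltW h0) //.
    rewrite -linearD /=; congr (S _ _).
    rewrite -natr1 mulrDl mul1r TD ?(ltW h0) // [_ + h]addrC SD ?(ltW h0) //.
    rewrite [T _ (_ - _)]linearB [S h (_ - _)]linearB /= TS ?(ltW h0) //.
    by rewrite addrA subrK.
  apply: le_trans (nrmD _ _) _; rewrite -[k.+1%:R in leRHS]natr1 [leRHS]mulrDl mul1r [leRHS]addrC.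
  apply: lerD; last by apply: IH; rewrite addSnnS.
  have jn : (j <= n)%N by apply: leq_trans jk; exact: leq_addr.
  have kn : (k <= n)%N by apply: leq_trans jk; rewrite addnS ltnW // ltnS leq_addl.
  apply: le_trans (SN _ (kh _) (lt _ jn) _) _; rewrite -mulrA ler_wpM2l //.
  exact: TM (kh _) (lt _ kn) _.
have := main n 0%N (leqnn _); rewrite mul0r S0 nh => hm; apply: le_trans hm _.
have NM : 0 <= N * M by rewrite mulr_ge0.
apply: (@le_trans _ _ (n%:R * (N * M * ((eps + e / (N * M * t + 1)) * h)))).
  by rewrite ler_wpM2l ?(ltW n0') // ler_wpM2l.
have -> : n%:R * (N * M * ((eps + e / (N * M * t + 1)) * h)) =
   N * M * t * eps + N * M * t * (e / (N * M * t + 1)) by rewrite -nh; ring.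
rewrite lerD2l.
by rewrite mulrCA ler_piMr ?(ltW e0) // ler_pdivrMr // mul1r lerDl.
Qed.

Context (A : operator H) (T : R -> {linear H -> H}) (AT : generates A T).

Lemma generator_cvg x : op_dom A x -> diff_quotient T x h @[h --> 0^'+] --> A x.
Proof.
case: AT => _ [E1 E2] Dx.
have /E2 -> : x \in op_dom A by rewrite inE.
by move: Dx; rewrite E1.
Qed.

Lemma generator_of_cvg x v : diff_quotient T x h @[h --> 0^'+] --> v ->
  op_dom A x /\ A x = v.
Proof.
move=> hv; case: (AT) => _ [E1 _].
have Dx : op_dom A x by rewrite E1 /=; apply/cvg_ex; exists v.
split=> //; exact: cvg_right0_unique (generator_cvg Dx) hv.
Qed.

Lemma generator_estimate x (e : R) : op_dom A x -> 0 < e -> exists2 d : R, 0 < d &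
  forall h, 0 < h -> h < d -> nrm (T h x - x - h%:C *: A x) <= e * h.
Proof.
move=> Dx e0; have /cvg_right0_nrmP /(_ _ e0) [d d0 hd] := generator_cvg Dx.
exists d => // h h0 hhd; have := ltW (hd h h0 hhd); rewrite /diff_quotient => hh.
have hC : h%:C != 0 by rewrite -(rmorph0 (real_complex R)) (inj_eq (@complexI R)) gt_eqF.
have -> : T h x - x - h%:C *: A x = h%:C *: ((h^-1)%:C *: (T h x - x) - A x).
  by rewrite scalerBr scalerA fmorphV /= mulfV // scale1r.
by rewrite nrmZ cabs_real gtr0_norm // mulrC ler_wpM2r ?(ltW h0).
Qed.

Lemma semigroup_commutes_generator t x : 0 <= t -> op_dom A x ->
  op_dom A (T t x) /\ A (T t x) = T t (A x).
Proof.
move=> t0 Dx; have [[cT _ TD _] _] := AT; apply: generator_of_cvg.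
have [c c0 Tb] := (continuous_linear_bounded_by (T t)).1 (cT t t0).
apply/cvg_right0_nrmP => e e0.
have /cvg_right0_nrmP /(_ _ (divr_gt0 e0 c0)) [d d0 hd] := generator_cvg Dx.
exists d => // h h0 hhd.
have -> : diff_quotient T (T t x) h - T t (A x) = T t (diff_quotient T x h - A x).
  rewrite /diff_quotient [T t (_ - _)]linearB [T t (_ *: _)]linearZ /= [T t (_ - _)]linearB /=.
  by rewrite -!TD ?(ltW h0) // [t + h]addrC.
apply: le_lt_trans (Tb _) _; rewrite mulrC -ltr_pdivlMr //.
exact: hd.
Qed.

(** Comparison with the scalar semigroup [exp (s l)]: to first order the difference at [x] is
    [h (A x - l x)], whence [eps]. [C] does not depend on [x]. *)
Lemma approx_eigenvector_semigroup (l : R[i]) (t : R) : 0 < t ->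
  exists C : R, 0 <= C /\ forall x, op_dom A x ->
    nrm (T t x - cexp (t%:C * l) *: x) <= C * nrm (l *: x - A x).
Proof.
move=> t0; have [hC0 _] := AT; have [_ T0 TD _] := hC0.
have [M [M0 hM]] := C0_semigroup_bound t hC0.
have /choice [S hS] s : exists P : {linear H -> H}, forall x, P x = cexp (s%:C * l) *: x.
  by apply: linear_pack => a x y; rewrite scalerDr !scalerA mulrC.
pose N := expR (t * `|complex.Re l|); have N0 : 0 < N := expR_gt0 _.
exists (N * M * t); split; first by rewrite !mulr_ge0 // ltW.
move=> x Dx; rewrite -hS.
apply: (semigroup_comparison t0 M0 (ltW N0) T0 _ TD) => //.
- by move=> y; rewrite hS mul0r cexp0 scale1r.
- by move=> r s _ _ y; rewrite !hS rmorphD mulrDl cexpD scalerA.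
- by move=> r s _ _ y; rewrite !hS linearZ.
- move=> s s0 st y; rewrite hS nrmZ ler_wpM2r ?nrm_ge0 // cabs_cexp ler_expR.
  have -> : complex.Re (s%:C * l) = s * complex.Re l by case: (l) => a b /=; rewrite mul0r subr0.
  apply: (@le_trans _ _ (s * `|complex.Re l|)); first by rewrite ler_wpM2l ?ler_norm.
  by rewrite ler_wpM2r.
- move=> e e0; have e2 : 0 < e / 2 by lra.
  have L0 : 0 < cabs l * nrm x + 1 by have := mulr_ge0 (cabs_ge0 l) (nrm_ge0 x); lra.
  have [d1 d10 h1] := generator_estimate Dx e2.
  have [d2 d20 h2] := cexp_taylor1 (divr_gt0 e2 L0).
  have l1 : 0 < cabs l + 1 by have := cabs_ge0 l; lra.
  exists (Num.min d1 (d2 / (cabs l + 1))); first by rewrite lt_min d10 divr_gt0.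
  move=> h h0; rewrite lt_min => /andP[hd1 hd2].
  have {}h1 := h1 h h0 hd1.
  have hl : cabs (h%:C * l) = h * cabs l by rewrite cabsM cabs_real gtr0_norm.
  have {}h2 : cabs (cexp (h%:C * l) - 1 - h%:C * l) <= e / 2 / (cabs l * nrm x + 1) * (h * cabs l).
    rewrite -hl; apply: h2; rewrite hl; apply: (@le_trans _ _ (h * (cabs l + 1))).
      by rewrite ler_wpM2l ?(ltW h0) // lerDl.
    by rewrite -ler_pdivlMr // ltW.
  rewrite hS; set u := cexp _ in h2 *.
  have -> : T h x - u *: x = (T h x - x - h%:C *: A x) - h%:C *: (l *: x - A x) -
     (u - 1 - h%:C * l) *: x.
    by vec dot.
  apply: le_trans (nrmB _ _) _; rewrite nrmZ.
  have h3 := nrmB (T h x - x - h%:C *: A x) (h%:C *: (l *: x - A x)).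
  rewrite [nrm (h%:C *: _)]nrmZ cabs_real gtr0_norm // in h3.
  have h4 : cabs (u - 1 - h%:C * l) * nrm x <= e / 2 * h.
    apply: le_trans (ler_wpM2r (nrm_ge0 x) h2) _.
    have -> : e / 2 / (cabs l * nrm x + 1) * (h * cabs l) * nrm x =
       e / 2 * h * ((cabs l * nrm x) / (cabs l * nrm x + 1)) by field; rewrite gt_eqF.
    apply: ler_piMr; first by rewrite mulr_ge0 ?(ltW h0) ?(ltW e2).
    by rewrite ler_pdivrMr // mul1r lerDl.
  by lra.
Qed.

End Semigroups.

(** * Spectrum and semigroup of a normal operator *)

Section NormalSemigroups.
Context {R : realType} {H : completeNormedModType R[i]}.
Context {dot : {dot H for (@Num.conj R[i])}}.
Context (dotE : forall x : H, dot x x = `|x| ^+ 2).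
Local Notation ip := (@ip R H dot).

Lemma bounded_set_cabsP (S : set R[i]) : bounded_set (S : set R[i]^o) <->
  exists M : R, forall l, S l -> cabs l <= M.
Proof.
split=> [[M [_ hM]]|[M hM]].
  exists (complex.Re (M + 1)) => l Sl.
  have := hM (M + 1) (ltr_pwDr ltr01 (lexx M)) l Sl.
  by rewrite /= lecE => /andP[].
exists M%:C; split=> [|x Mx l Sl /=]; first by rewrite complex_real.
by apply: le_trans (ltW Mx); rewrite [`|_|]cabsE lecR hM.
Qed.

Lemma normal_total_op (N N' : {linear H -> H}) : continuous N -> is_adjoint dot N N' ->
  commutes_with N N' -> normal_op dot (total_op N).
Proof.
move=> cN adj NN'.
have lN : op_linear (total_op N) by split=> // a x y _ _; rewrite /= linearD linearZ.
have relE y : adjoint_rel dot (total_op N) y = [set N' y].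
  apply/seteqP; split=> [z /adjoint_rel_ipP -/(_ lN) h|_ ->] /=.
    by apply: (ip_inj dotE) => x; rewrite ipC -h // ipC -(ipC (N x)) adj ipC.
  by apply/(adjoint_rel_ipP _ _ lN) => x _; exact: adj.
have getE y : get (adjoint_rel dot (total_op N) y) = N' y.
  by rewrite relE; apply: get_unique => // z.
have [c c0 Nb] := (continuous_linear_bounded_by N).1 cN.
split=> //.
- by move=> O [x Ox] _; exists x; split.
- move=> [x v] h; split=> //=; apply: nrm_small_eq => e e0.
  have c1 : 0 < c + 1 by lra.
  have [] := h [set p | nrm (x - p.1) < e / (c + 1) /\ nrm (v - p.2) < e / (c + 1)].
    exists ([set y | nrm (x - y) < e / (c + 1)], [set y | nrm (v - y) < e / (c + 1)]) => //=.
    by split; apply/nbhs_nrmP; exists (e / (c + 1)) => //; rewrite divr_gt0.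
  move=> [y w] [[/= _ ->] [xy vw]].
  apply: le_trans (nrm_split (N y) _ _) _; rewrite -linearB.
  have h1 := Nb (y - x); rewrite nrmC in xy.
  have h2 : c * nrm (y - x) <= c * (e / (c + 1)) by rewrite ler_wpM2l ?(ltW c0) ?(ltW xy).
  have : e / (c + 1) * (c + 1) = e by rewrite divfK ?gt_eqF.
  by lra.
split.
  apply/seteqP; split=> x /= _; split=> //.
    by exists (N' x); rewrite relE.
  by exists (N' (N x)); rewrite relE.
by move=> x _; rewrite /= !getE NN'.
Qed.

Context (A : operator H) (A_normal : normal_op dot A).

(** The last conclusion prepares uniqueness: the operators of any semigroup generated by [A] commute
    with [A], hence with the one constructed. *)
Lemma semigroup_of_bounded_spectrum :
  (forall b : R, exists M : R, forall l, spectrum A l -> b <= complex.Re l -> cabs l <= M) ->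
  exists T : R -> {linear H -> H},
    [/\ generates A T, immediately_norm_continuous T,
        forall t, 0 <= t -> normal_op dot (total_op (T t))
      & forall M : {linear H -> H}, continuous M ->
          (forall x, op_dom A x -> op_dom A (M x) /\ A (M x) = M (A x)) ->
          forall t, 0 <= t -> commutes_with M (T t)].
Proof.
move=> hB; have [M0 hM0] := hB 0.
(* Spectral points with [0 <= Re l] have modulus at most [M0], so [l0] is at least [2] to the right
   of the spectrum and [Re z^-1 >= 1] holds with room. *)
pose l0 : R := `|M0| + 2.
have l00 : 0 <= l0 by rewrite addr_ge0.
have M00 := ler_norm M0; have M0a := normr_ge0 M0.
have res (mu : R) : l0 <= mu -> resolvent_set A mu%:C.
  move=> lmu; apply: contrapT => /hM0 /=; rewrite cabs_real.
  by have := ler_norm mu; rewrite /l0 in lmu; move=> ? /(_ ltac:(lra)); lra.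
have Rl l : spectrum A l -> complex.Re l <= `|M0|.
  move=> sl; have [|l1] := leP 0 (complex.Re l); last by lra.
  by move=> /(hM0 _ sl); have := ler_Re_cabs l; have := ler_norm (complex.Re l); lra.
have [Q [cQ hQ1 hQ2]] := res l0 (lexx _).
have ReE z : complex.Re (l0%:C - z^-1) = l0 - complex.Re z^-1 by case: (z^-1).
have Kr z : resolvent_values A l0%:C z -> z != 0 -> 1 <= complex.Re z^-1.
  by move=> [->|/Rl]; [rewrite eqxx|rewrite ReE /l0; lra].
have Kb (B : R) : exists M : R, forall z, resolvent_values A l0%:C z -> z != 0 ->
   complex.Re z^-1 <= B -> cabs z^-1 <= M.
  have [M hM] := hB (l0 - B); exists (l0 + M) => z [->|sz]; first by rewrite eqxx.
  move=> z0 zB; have := hM _ sz; rewrite ReE => /(_ ltac:(lra)) h.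
  have -> : z^-1 = l0%:C - (l0%:C - z^-1) by ring.
  by apply: le_trans (cabsB _ _) _; rewrite cabs_real ger0_norm // lerD2l.
have [T [T0 TE]] := semigroup_family dotE A_normal cQ hQ1 hQ2 Kr Kb res.
exists T; split.
- exact: (semigroup_generates dotE A_normal l00 cQ hQ1 hQ2 Kr T0 TE).
- exact: (semigroup_immediately_norm_continuous dotE A_normal l00 cQ hQ1 hQ2 Kr Kb TE).
- move=> t; rewrite le_eqVlt => /orP[/eqP <-|t0].
    apply: (@normal_total_op (T 0) (T 0)) => //.
    + by apply/continuous_linear_bounded_by; exists 1 => // x; rewrite T0 mul1r.
    + by move=> x y; rewrite !T0.
  have rT := TE t t0; have [cT bT _] := rT.
  have [T' [cT' adjT]] := adjoint_exists dotE cT.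
  have [Q' [cQ' adjQ]] := adjoint_exists dotE cQ.
  (* The adjoint of [T t] commutes with [Q], and [T t] commutes with every bounded operator that
     does. *)
  have [_ _ T'Q _] := represents_adjoint_commutes dotE A_normal cQ hQ1 hQ2 rT cQ' adjQ adjT.
  apply: normal_total_op cT adjT _ => x.
  by rewrite [RHS](bT T') // => y; rewrite T'Q.
- move=> M cM MA t; rewrite le_eqVlt => /orP[/eqP <-|t0]; first by move=> x; rewrite !T0.
  have [_ bT _] := TE t t0; apply: bT => // x.
  have [D E] := hQ1 x; have [D2 E2] := MA _ D.
  by rewrite -(hQ2 _ D2) E2 -linearZ -linearB E.
Qed.

Lemma spectrum_approx_eigenvector l (e : R) : spectrum A l -> 0 < e ->
  exists x, [/\ op_dom A x, 0 < nrm x & nrm (l *: x - A x) <= e * nrm x].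
Proof.
move=> sl e0; apply: contrapT => h; apply: sl.
apply: (normal_resolvent_of_lower_bound dotE A_normal e0) => x Dx.
rewrite leNgt; apply/negP => hx; apply: h; exists x; split=> //; last exact: ltW.
apply: nrm_gt0 => x0; move: hx; rewrite x0 nrm0 mulr0.
by rewrite ltNge nrm_ge0.
Qed.

Lemma semigroup_difference_ge l (T : R -> {linear H -> H}) (s t c : R) : generates A T ->
  spectrum A l -> 0 < s -> 0 < t -> bounded_by c (T s \- T t) ->
  cabs (cexp (s%:C * l) - cexp (t%:C * l)) <= c.
Proof.
move=> AT sl s0 t0 hc.
have [C1 [C10 h1]] := approx_eigenvector_semigroup (dot := dot) AT l s0.
have [C2 [C20 h2]] := approx_eigenvector_semigroup (dot := dot) AT l t0.
apply/ler_addgt0Pr => e e0.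
have C0 : 0 < C1 + C2 + 1 by lra.
have [x [Dx nx hx]] := spectrum_approx_eigenvector sl (divr_gt0 e0 C0).
rewrite -(ler_pM2r nx) -nrmZ.
have -> : (cexp (s%:C * l) - cexp (t%:C * l)) *: x =
  (T s \- T t) x - (T s x - cexp (s%:C * l) *: x) + (T t x - cexp (t%:C * l) *: x).
  by rewrite /=; vec dot.
apply: le_trans (nrmD _ _) _.
have h3 := nrmB ((T s \- T t) x) (T s x - cexp (s%:C * l) *: x).
have h4 := hc x; have h5 := h1 x Dx; have h6 := h2 x Dx.
have h7 : (C1 + C2) * nrm (l *: x - A x) <= e * nrm x.
  apply: (@le_trans _ _ ((C1 + C2 + 1) * (e / (C1 + C2 + 1) * nrm x))).
    by apply: ler_pM => //; rewrite ?nrm_ge0 ?addr_ge0 ?lerDl.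
  by rewrite mulrA mulrCA mulfV ?mulr1 // gt_eqF.
by lra.
Qed.

Lemma semigroup_ge l (T : R -> {linear H -> H}) (t c : R) : generates A T ->
  spectrum A l -> 0 < t -> bounded_by c (T t) -> cabs (cexp (t%:C * l)) <= c.
Proof.
move=> AT sl t0 hc.
have [C [C0 h]] := approx_eigenvector_semigroup (dot := dot) AT l t0.
apply/ler_addgt0Pr => e e0.
have C1 : 0 < C + 1 by lra.
have [x [Dx nx hx]] := spectrum_approx_eigenvector sl (divr_gt0 e0 C1).
rewrite -(ler_pM2r nx) -nrmZ.
have -> : cexp (t%:C * l) *: x = T t x - (T t x - cexp (t%:C * l) *: x) by vec dot.
apply: le_trans (nrmB _ _) _.
have h4 := hc x; have h5 := h x Dx.
have h7 : C * nrm (l *: x - A x) <= e * nrm x.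
  apply: (@le_trans _ _ ((C + 1) * (e / (C + 1) * nrm x))).
    by apply: ler_pM => //; rewrite ?nrm_ge0 ?lerDl.
  by rewrite mulrA mulrCA mulfV ?mulr1 // gt_eqF.
by lra.
Qed.

Lemma bounded_spectrum_of_semigroup (T : R -> {linear H -> H}) :
  generates A T -> immediately_norm_continuous T ->
  forall b : R, exists M : R, forall l, spectrum A l -> b <= complex.Re l -> cabs l <= M.
Proof.
move=> AT Tc b; have [hC0 _] := AT.
have [M [M0 TM]] := C0_semigroup_bound 2 hC0.
have b0 : 0 < expR b / 2 by rewrite divr_gt0 ?expR_gt0.
have /cvgrPdist_lt /(_ _ b0) /nbhs_ballP [d /= d0 hd] := Tc 1 ltr01.
(* [|b| + M] bounds [|Re l|], because [1 + Re l <= exp (Re l) <= M]; the last term bounds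
   [|Im l|]. *)
exists (`|b| + M + pi / Num.min d 1) => l sl bl.
have m0 : 0 < Num.min d 1 by rewrite lt_min d0 ltr01.
have c1 : 1%:C * l = l by rewrite mul1r.
have Rl : expR (complex.Re l) <= M.
  rewrite -cabs_cexp -{1}c1; apply: semigroup_ge AT sl ltr01 (TM 1 ler01 _); lra.
have Rl2 : `|complex.Re l| <= `|b| + M.
  have := expR_ge1Dx (complex.Re l); have := ler_norm (- b).
  by rewrite normrN ler_norml => ? ?; apply/andP; split; have := normr_ge0 b; lra.
apply: le_trans (cabs_le_ReIm _) _; rewrite lerD //.
rewrite leNgt; apply/negP => Il.
have pi0 := pi_gt0 R.
have I0 : 0 < `|complex.Im l| by apply: lt_trans Il; rewrite divr_gt0.
(* A half turn: [exp (h l)] is a negative real, so [|exp (h l) - 1| >= 1]. A large [|Im l|] makes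
   [h < d], and then [|T (1 + h) - T 1| >= exp b] contradicts the choice of [d]. *)
pose h := pi / `|complex.Im l|.
have h0 : 0 < h by rewrite divr_gt0.
have hm : h < Num.min d 1 by rewrite /h ltr_pdivrMr // mulrC -ltr_pdivrMr.
have [hd1 h1] : h < d /\ h < 1 by apply/andP; rewrite -lt_min.
have opd : opnorm (T (1 + h) \- T 1) < expR b / 2.
  have := hd (1 + h); rewrite /ball /= opprD addrA subrr sub0r normrN gtr0_norm // => /(_ hd1).
  by rewrite sub0r normrN; apply: le_lt_trans (ler_norm _).
have [D DE] : exists D : {linear H -> H}, forall x, D x = T (1 + h) x - T 1 x.
  by apply: linear_pack => a x y; rewrite !linearD !linearZ /=; vec dot.
have DT : (T (1 + h) \- T 1) = D by apply/funext => x; rewrite DE.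
have Db : bounded_by (M + M) D.
  move=> x; rewrite DE; apply: le_trans (nrmB _ _) _; rewrite mulrDl.
  by apply: lerD; apply: TM; lra.
have Db' := opnorm_bound (addr_ge0 M0 M0) Db; rewrite -DT in Db'.
have h10 : 0 < 1 + h by lra.
have key := semigroup_difference_ge AT sl h10 ltr01 Db'.
have : expR b <= opnorm (T (1 + h) \- T 1); last by lra.
apply: le_trans key.
have -> : cexp ((1 + h)%:C * l) - cexp (1%:C * l) = cexp l * (cexp (h%:C * l) - 1).
  by rewrite rmorphD mulrDl c1 cexpD; ring.
rewrite cabsM cabs_cexp -[expR b]mulr1; apply: ler_pM; [exact: expR_ge0|exact: ler01|by rewrite ler_expR|].
have E : cexp (h%:C * l) = - (expR (h * complex.Re l))%:C.
  have ReE : complex.Re (h%:C * l) = h * complex.Re l by case: (l) => ? ? /=; rewrite mul0r subr0.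
  have ImE : complex.Im (h%:C * l) = h * complex.Im l by case: (l) => ? ? /=; rewrite mul0r addr0.
  rewrite /cexp ReE ImE.
  have [hI|hI] : h * complex.Im l = pi \/ h * complex.Im l = - pi.
    have [I1|I1] := leP 0 (complex.Im l).
      by left; rewrite /h ger0_norm // divfK // -(ger0_norm I1) -normr_gt0 normr_id.
    by right; rewrite /h ltr0_norm // invrN mulrN mulNr divfK // lt_eqF.
  - by rewrite hI cospi sinpi mulr0 mulrN1; apply/eqP; rewrite eq_complex /= oppr0 !eqxx.
  - by rewrite hI cosN sinN cospi sinpi oppr0 mulr0 mulrN1; apply/eqP; rewrite eq_complex /= oppr0 !eqxx.
have e0 := expR_ge0 (h * complex.Re l).
apply: le_trans (ler_Re_cabs _); rewrite E.
have -> : complex.Re (- (expR (h * complex.Re l))%:C - 1) = - (expR (h * complex.Re l) + 1).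
  by rewrite opprD.
by rewrite normrN ger0_norm; lra.
Qed.

(** On the domain both semigroups have the same first-order expansion, so the comparison applies
    with [eps = 0]; density and local bounds give the rest. *)
Lemma generated_semigroup_unique (T S : R -> {linear H -> H}) :
  generates A T -> generates A S ->
  (forall r s, 0 <= r -> 0 <= s -> forall x, T r (S s x) = S s (T r x)) ->
  forall t, 0 <= t -> forall x, T t x = S t x.
Proof.
move=> AT AS TS t; rewrite le_eqVlt => /orP[/eqP <- x|t0].
  by have [[_ -> _ _] _] := AT; have [[_ -> _ _] _] := AS.
have [hT _] := AT; have [hS _] := AS.
have [_ T0 TD _] := hT; have [_ S0 SD _] := hS.
have [M [M0 TM]] := C0_semigroup_bound t hT; have [N [N0 SN]] := C0_semigroup_bound t hS.
have onD x : op_dom A x -> T t x = S t x.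
  move=> Dx; apply: nrm_small_eq => e e0; apply: (@le_trans _ _ (N * M * t * 0)); last by rewrite mulr0 ltW.
  apply: (semigroup_comparison t0 M0 N0 T0 S0 TD SD TS TM SN) => e' e'0.
  have e2 : 0 < e' / 2 by lra.
  have [d1 d10 h1] := generator_estimate AT Dx e2.
  have [d2 d20 h2] := generator_estimate AS Dx e2.
  exists (Num.min d1 d2); first by rewrite lt_min d10.
  move=> h h0; rewrite lt_min => /andP[/(h1 h h0) {}h1 /(h2 h h0) {}h2].
  have -> : T h x - S h x = (T h x - x - h%:C *: A x) - (S h x - x - h%:C *: A x) by vec dot.
  by apply: le_trans (nrmB _ _) _; lra.
move=> x; apply: nrm_small_eq => e e0.
have C0 : 0 < M + N + 1 by lra.
have [y Dy xy] := normal_dense A_normal x (divr_gt0 e0 C0).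
have -> : T t x - S t x = T t (x - y) - S t (x - y).
  by rewrite [T t (x - y)]linearB [S t (x - y)]linearB /= (onD y Dy); vec dot.
apply: le_trans (nrmB _ _) _.
have h1 := TM t (ltW t0) (lexx _) (x - y); have h2 := SN t (ltW t0) (lexx _) (x - y).
have h3 : (M + N) * nrm (x - y) <= (M + N + 1) * (e / (M + N + 1)).
  by apply: ler_pM; rewrite ?nrm_ge0 ?addr_ge0 ?lerDl // ltW.
have : (M + N + 1) * (e / (M + N + 1)) = e by rewrite mulrC divfK ?gt_eqF.
by lra.
Qed.

End NormalSemigroups.

Unset Implicit Arguments.

Theorem corollary6p1 (R : realType) (H : completeNormedModType R[i])
    (dot : {dot H for (@Num.conj R[i])})
    (dotE : forall x : H, dot x x = `|x| ^+ 2)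
    (A : operator H) (A_normal : normal_op dot A) :
  ((exists T : R -> {linear H -> H},
      generates A T /\ immediately_norm_continuous T) <->
   (forall b : R, bounded_set
      ([set l | spectrum A l /\ b <= complex.Re l] : set R[i]^o)))
  /\
  (forall T : R -> {linear H -> H},
     generates A T -> immediately_norm_continuous T ->
     forall t : R, 0 <= t -> normal_op dot (total_op (T t))).
Proof.
split.
  split=> [[T [AT Tc]] b|hB].
    apply/bounded_set_cabsP.
    have [M hM] := bounded_spectrum_of_semigroup dotE A_normal AT Tc b.
    by exists M => l [sl bl]; exact: hM.
  have [|T [AT Tc _ _]] := semigroup_of_bounded_spectrum dotE A_normal; last by exists T.
  move=> b; have /bounded_set_cabsP [M hM] := hB b.
  by exists M => l sl bl; apply: hM.
move=> T AT Tc t t0.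
have [S [AS _ Sn SA]] :=
  semigroup_of_bounded_spectrum dotE A_normal (bounded_spectrum_of_semigroup dotE A_normal AT Tc).
(* [T r] commutes with its generator [A], and [S] commutes with all bounded operators that do, so
   uniqueness identifies [T] with the normal semigroup [S]. *)
have TS r s : 0 <= r -> 0 <= s -> forall x, T r (S s x) = S s (T r x).
  move=> r0 s0; apply: SA => //; first by have [[cT _ _ _] _] := AT; exact: cT.
  by move=> x Dx; exact: semigroup_commutes_generator AT _ _ r0 Dx.
have -> : (T t : H -> H) = S t.
  have U := generated_semigroup_unique A_normal AT AS TS t0.
  by apply/funext => x; apply: U.
exact: Sn.
Qed.
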